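(* Let $M\subset\mathbb C^{n+k}$ be a CR-generic submanifold of finite type, holomorphically nondegenerate, and given as the graph $v_j=\Phi_j(z,\overline z,u)$, $j=1,\dots,k$, of weighted homogeneous polynomials $\Phi_j$ of weight $[w_j]$ (see context). Then the Lie algebra $\mathfrak g:=\mathfrak{aut}_{CR}(M)$ of infinitesimal CR-automorphisms of $M$ is a graded Lie algebra in the sense of Tanaka, of the form $$\mathfrak g=\mathfrak g_{-\rho}\oplus\cdots\oplus\mathfrak g_{-1}\oplus\mathfrak g_0\oplus\mathfrak g_1\oplus\cdots\oplus\mathfrak g_\varrho,\qquad \rho,\varrho\in\mathbb N,\qquad [\mathfrak g_i,\mathfrak g_j]\subset\mathfrak g_{i+j},$$ where $\mathfrak g_t$ denotes the space of all elements of $\mathfrak g$ that are weighted homogeneous of weight $t$.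
   Context: Let $n,k\ge 1$. Equip $\mathbb C^{n+k}$ with coordinates $z=(z_1,\dots,z_n)$ and $w=(w_1,\dots,w_k)$, $w_l=u_l+iv_l$. Weights: $[z_j]=1$ for all $j$, and $[w_l]$ are integers with $1<[w_1]\le[w_2]\le\cdots\le[w_k]$. The conjugate, real part and imaginary part of a variable have the same weight as the variable; nonzero constants have weight $0$; $[\partial_{z_j}]=-[z_j]$, $[\partial_{w_l}]=-[w_l]$. The weight of a monomial is the sum of the weights of its variables counted with powers; a field $F\,\partial_x$ with $F$ a monomial and $x\in\{z_j,w_l\}$ has weight $[F]-[x]$. A polynomial or vector field is weighted homogeneous of weight $d$ if each of its (Taylor) terms has weight $d$ (zero is regarded as weighted homogeneous of every weight). $M$ is a real analytic CR-generic submanifold of CR dimension $n$ and codimension $k$ given by $v_j=\Phi_j(z,\overline z,u)$, $j=1,\dots,k$, where $\Phi_j$ is a real-valued weighted homogeneous polynomial of weight $[w_j]$. Holomorphically nondegenerate: there is no nonzero local $(1,0)$ vector field with holomorphic coefficients whose restriction to $M$ is tangent to $M$. Finite type: the $(1,0)$ and $(0,1)$ vector fields tangent to $M$, together with all their iterated Lie brackets, span the complexified tangent space $\mathbb C\otimes T_pM$ at each $p\in M$. $\mathfrak{aut}_{CR}(M)$ is the real Lie algebra of (local, near the origin) holomorphic vector fields ${\sf X}=\sum_{j=1}^n Z^j(z,w)\,\partial_{z_j}+\sum_{l=1}^k W^l(z,w)\,\partial_{w_l}$ with holomorphic coefficients whose real part $\frac12({\sf X}+\overline{\sf X})$ is tangent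 to $M$. A Lie algebra is graded in the sense of Tanaka if it can be written as $\mathfrak g=\mathfrak g_{-\rho}\oplus\cdots\oplus\mathfrak g_\varrho$, $\rho,\varrho\in\mathbb N$, with $[\mathfrak g_i,\mathfrak g_j]\subset\mathfrak g_{i+j}$ (where $\mathfrak g_s=0$ for $s$ outside $\{-\rho,\dots,\varrho\}$). *)

(* Defs.v *)
From mathcomp Require Import all_boot all_order all_algebra.
From mathcomp Require Import mpoly complex.
From mathcomp Require Import boolp classical_sets functions reals topology.
From mathcomp Require Import normedtype sequences.

Set Implicit Arguments.
Unset Strict Implicit.
Unset Printing Implicit Defensive.

Import Order.TTheory GRing.Theory Num.Theory numFieldNormedType.Exports.

Local Open Scope classical_set_scope.
Local Open Scope ring_scope.
Local Open Scope complex_scope.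

(** * Germs of analytic functions as convergent power series

   A germ at a point [p] of a holomorphic (resp. complex-valued real analytic)
   function is represented by the coefficients of its Taylor series in
   [Z - p] (resp. in [Z - p] and its conjugate, see below).  The operations on
   germs are the formal ones.  Beware that ring operations on functions are
   pointwise in the library: products of series must be written [ps_mul]. *)

Definition ps (R : realType) (m : nat) : Type := 'X_{1..m} -> R[i].

Definition ps_mul (R : realType) (m : nat) (f g : ps R m) : ps R m :=
  fun a => \sum_(b : 'X_{1..m < (mdeg a).+1} | (b <= a)%MM) f b * g (a - b)%MM.

Definition ps_deriv (R : realType) (m : nat) (i : 'I_m) (f : ps R m) : ps R m :=
  fun a => f (a + U_(i))%MM *+ (a i).+1.

Definition ps_partial (R : realType) (m : nat) (f : ps R m)
    (x : 'I_m -> R[i]) (d : nat) : R[i] :=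
  \sum_(a : 'X_{1..m < d}) f a * mmap1 x a.

Definition ps_summable (R : realType) (m : nat) (f : ps R m)
    (x : 'I_m -> R[i]) : Prop :=
  cvgn (fun d => \sum_(a : 'X_{1..m < d}) Normc.normc (f a * mmap1 x a) : R).

Definition polydisc (R : realType) (m : nat) (p : 'I_m -> R[i]) (eps : R) :
    set ('I_m -> R[i]) :=
  [set x | forall i, Normc.normc (x i - p i) < eps].

Definition ps_convergent (R : realType) (m : nat) (f : ps R m) : Prop :=
  exists2 eps : R, 0 < eps &
    forall x, polydisc (fun=> 0) eps x -> ps_summable f x.

(* The sum of the series at [x]; only meaningful when [ps_summable f x]. *)
Definition ps_eval (R : realType) (m : nat) (f : ps R m) (x : 'I_m -> R[i]) :
    R[i] :=
  limn (fun d => complex.Re (ps_partial f x d) : R)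
    +i* limn (fun d => complex.Im (ps_partial f x d) : R).

(* [X : vf R m] stands for the derivation [\sum_j X j * d/dx_j]. *)
Definition vf (R : realType) (m : nat) : Type := 'I_m -> ps R m.

Definition vf_bracket (R : realType) (m : nat) (X Y : vf R m) : vf R m :=
  fun j => \sum_(i < m)
    (ps_mul (X i) (ps_deriv i (Y j)) - ps_mul (Y i) (ps_deriv i (X j))).

Definition vf_convergent (R : realType) (m : nat) (X : vf R m) : Prop :=
  forall j, ps_convergent (X j).

(** * The graph [v = Phi(z, zbar, u)]

   A point [Z] of C^(n+k) is [(z, w)]: the first [n] coordinates are [z], the
   last [k] are [w = u + iv].  The variables of [Phi l] are, in this order,
   [z] ([n] variables), [zbar] ([n] variables) and [u] ([k] variables). *)

Definition wt (n k : nat) (omega : 'I_k -> nat) (j : 'I_(n + k)) : nat :=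
  match fintype.split j with inl _ => 1%N | inr l => omega l end.

Definition wtPhi (n k : nat) (omega : 'I_k -> nat) (i : 'I_(n + n + k)) : nat :=
  match fintype.split i with inl _ => 1%N | inr l => omega l end.

Definition mon_weight (m : nat) (c : 'I_m -> nat) (a : 'X_{1..m}) : nat :=
  (\sum_(i < m) c i * a i)%N.

Definition Phi_args (R : realType) (n k : nat) (Z : 'I_(n + k) -> R[i])
    (i : 'I_(n + n + k)) : R[i] :=
  match fintype.split i with
  | inl j => match fintype.split j with
             | inl a => Z (lshift k a)
             | inr a => (Z (lshift k a))^*
             end
  | inr l => (complex.Re (Z (rshift n l)))%:C
  end.

Definition real_valued (R : realType) (n k : nat)
    (P : {mpoly R[i][n + n + k]}) : Prop :=
  forall Z : 'I_(n + k) -> R[i], complex.Im P.@[Phi_args Z] = 0.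

Definition poly_weighted_homogeneous (R : realType) (n k : nat)
    (omega : 'I_k -> nat) (d : nat) (P : {mpoly R[i][n + n + k]}) : Prop :=
  forall a, P@_a != 0 -> mon_weight (wtPhi omega) a = d.

Definition graph (R : realType) (n k : nat)
    (Phi : 'I_k -> {mpoly R[i][n + n + k]}) : set ('I_(n + k) -> R[i]) :=
  [set Z | forall l,
     (complex.Im (Z (rshift n l)))%:C = (Phi l).@[Phi_args Z]].

(** * Tangent vectors

   The complexified tangent vector [\sum_j a_j d/dZ_j + b_j d/dZbar_j] of
   C^(n+k) is given by the pair [(a, b)].  It is of type (1,0) if [b = 0], of
   type (0,1) if [a = 0], and real if [b] is the conjugate of [a]. *)

(* The values of [dz], [dzbar] and [du = (dw + dwbar)/2] at [(a, b)]. *)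
Definition dPhi_args (R : realType) (n k : nat) (a b : 'I_(n + k) -> R[i])
    (i : 'I_(n + n + k)) : R[i] :=
  match fintype.split i with
  | inl j => match fintype.split j with
             | inl c => a (lshift k c)
             | inr c => b (lshift k c)
             end
  | inr l => (a (rshift n l) + b (rshift n l)) / 2
  end.

(* C \otimes T_Z M: the kernel of the differentials of [v_l - Phi_l], where
   [dv = (dw - dwbar)/2i]. *)
Definition ctangent (R : realType) (n k : nat)
    (Phi : 'I_k -> {mpoly R[i][n + n + k]}) (Z : 'I_(n + k) -> R[i])
    (a b : 'I_(n + k) -> R[i]) : Prop :=
  forall l : 'I_k,
    (a (rshift n l) - b (rshift n l)) / (2 * 'i)
    = \sum_(i < n + n + k) (Phi l)^`M(i).@[Phi_args Z] * dPhi_args a b i.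

Definition vconj (R : realType) (m : nat) (a : 'I_m -> R[i]) : 'I_m -> R[i] :=
  fun j => (a j)^*.

Definition rtangent (R : realType) (n k : nat)
    (Phi : 'I_k -> {mpoly R[i][n + n + k]}) (Z : 'I_(n + k) -> R[i])
    (a : 'I_(n + k) -> R[i]) : Prop :=
  ctangent Phi Z a (vconj a).

(* T_p M + i T_p M = T_p C^(n+k) at each point. *)
Definition cr_generic (R : realType) (n k : nat)
    (Phi : 'I_k -> {mpoly R[i][n + n + k]}) : Prop :=
  forall p, graph Phi p -> forall x : 'I_(n + k) -> R[i],
    exists a b : 'I_(n + k) -> R[i],
      [/\ rtangent Phi p a, rtangent Phi p b
        & forall j, x j = a j + 'i * b j].

(** * Holomorphic vector fields *)

Definition hvf_at (R : realType) (N : nat) (X : vf R N)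
    (p Z : 'I_N -> R[i]) : 'I_N -> R[i] :=
  fun j => ps_eval (X j) (fun i => Z i - p i).

Definition holomorphically_nondegenerate (R : realType) (n k : nat)
    (Phi : 'I_k -> {mpoly R[i][n + n + k]}) : Prop :=
  forall p, graph Phi p -> forall X : vf R (n + k), vf_convergent X ->
    (exists2 eps : R, 0 < eps & forall Z, polydisc p eps Z -> graph Phi Z ->
       ctangent Phi Z (hvf_at X p Z) (fun=> 0)) ->
    X = 0.

(* Germs at the origin of holomorphic [X] such that [(X + Xbar)/2] is tangent
   to the graph. *)
Definition aut_CR (R : realType) (n k : nat)
    (Phi : 'I_k -> {mpoly R[i][n + n + k]}) : set (vf R (n + k)) :=
  [set X | vf_convergent X /\
     exists2 eps : R, 0 < eps &
       forall Z, polydisc (fun=> 0) eps Z -> graph Phi Z ->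
         rtangent Phi Z (fun j => hvf_at X (fun=> 0) Z j / 2)].

Definition vf_weighted_homogeneous (R : realType) (n k : nat)
    (omega : 'I_k -> nat) (t : int) (X : vf R (n + k)) : Prop :=
  forall (j : 'I_(n + k)) (a : 'X_{1..n + k}), X j a != 0 ->
    (mon_weight (wt omega) a)%:Z - (wt omega j)%:Z = t.

Definition aut_CR_weight (R : realType) (n k : nat) (omega : 'I_k -> nat)
    (Phi : 'I_k -> {mpoly R[i][n + n + k]}) (t : int) : set (vf R (n + k)) :=
  [set X | aut_CR Phi X /\ vf_weighted_homogeneous omega t X].

(** * Finite type

   Germs at [p] of complex vector fields with real analytic coefficients are
   elements of [vf R (N + N)] with [N = n + k]: the series are in
   [Z - p] and its conjugate, treated as independent variables; the components
   are those along [d/dZ_j] ([lshift]) and [d/dZbar_j] ([rshift]). *)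

Definition with_conj (R : realType) (N : nat) (Z : 'I_N -> R[i])
    (i : 'I_(N + N)) : R[i] :=
  match fintype.split i with inl j => Z j | inr j => (Z j)^* end.

Definition cvf_dZ (R : realType) (N : nat) (X : vf R (N + N))
    (p Z : 'I_N -> R[i]) : 'I_N -> R[i] :=
  fun j => ps_eval (X (lshift N j)) (with_conj (fun i => Z i - p i)).

Definition cvf_dZbar (R : realType) (N : nat) (X : vf R (N + N))
    (p Z : 'I_N -> R[i]) : 'I_N -> R[i] :=
  fun j => ps_eval (X (rshift N j)) (with_conj (fun i => Z i - p i)).

Definition tangent_cvf (R : realType) (n k : nat)
    (Phi : 'I_k -> {mpoly R[i][n + n + k]}) (p : 'I_(n + k) -> R[i])
    (X : vf R (n + k + (n + k))) : Prop :=
  vf_convergent X /\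
  exists2 eps : R, 0 < eps & forall Z, polydisc p eps Z -> graph Phi Z ->
    ctangent Phi Z (cvf_dZ X p Z) (cvf_dZbar X p Z).

Inductive cr_generated (R : realType) (n k : nat)
    (Phi : 'I_k -> {mpoly R[i][n + n + k]}) (p : 'I_(n + k) -> R[i]) :
    vf R (n + k + (n + k)) -> Prop :=
| cr_generated10 (X : vf R (n + k + (n + k))) :
    tangent_cvf Phi p X -> (forall j, X (rshift (n + k) j) = 0) ->
    cr_generated Phi p X
| cr_generated01 (X : vf R (n + k + (n + k))) :
    tangent_cvf Phi p X -> (forall j, X (lshift (n + k) j) = 0) ->
    cr_generated Phi p X
| cr_generated_bracket (X Y : vf R (n + k + (n + k))) :
    cr_generated Phi p X -> cr_generated Phi p Y ->
    cr_generated Phi p (vf_bracket X Y).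

Definition finite_type (R : realType) (n k : nat)
    (Phi : 'I_k -> {mpoly R[i][n + n + k]}) : Prop :=
  forall p, graph Phi p -> forall a b : 'I_(n + k) -> R[i],
    ctangent Phi p a b ->
    exists (r : nat) (c : 'I_r -> R[i]) (X : 'I_r -> vf R (n + k + (n + k))),
      [/\ forall s, cr_generated Phi p (X s),
          forall j, a j = \sum_(s < r) c s * cvf_dZ (X s) p p j
        & forall j, b j = \sum_(s < r) c s * cvf_dZbar (X s) p p j].

(** * Graded Lie algebras in the sense of Tanaka *)

Definition real_subspace (R : realType) (V : lmodType R[i]) (E : set V) : Prop :=
  E 0 /\ forall (c : R) (x y : V), E x -> E y -> E (c%:C *: x + y).

Definition real_lie_algebra (R : realType) (V : lmodType R[i])
    (br : V -> V -> V) (g : set V) : Prop :=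
  [/\ real_subspace g /\ (forall x y, g x -> g y -> g (br x y)),
      (forall (c : R) x y z, g x -> g y -> g z ->
         br (c%:C *: x + y) z = c%:C *: br x z + br y z),
      (forall (c : R) x y z, g x -> g y -> g z ->
         br z (c%:C *: x + y) = c%:C *: br z x + br z y),
      (forall x, g x -> br x x = 0)
    & (forall x y z, g x -> g y -> g z ->
         br x (br y z) + br y (br z x) + br z (br x y) = 0)].

(* [\sum_(- rho <= t <= varrho) Y t] *)
Definition graded_sum (V : zmodType) (rho varrho : nat) (Y : int -> V) : V :=
  \sum_(i < (rho + varrho).+1) Y (i%:Z - rho%:Z).

(* [g] is a real Lie algebra and the direct sum of the [g_ t], for
   [- rho <= t <= varrho]; the [g_ t] vanish for the other [t]. *)
Definition tanaka_graded (R : realType) (V : lmodType R[i])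
    (br : V -> V -> V) (g : set V) (g_ : int -> set V) (rho varrho : nat) :
    Prop :=
  [/\ real_lie_algebra br g,
      (forall t, real_subspace (g_ t)) /\
      (forall t, ~~ (- rho%:Z <= t <= varrho%:Z) -> g_ t = [set 0]),
      g = [set graded_sum rho varrho Y | Y in [set Y | forall t, g_ t (Y t)]],
      (forall Y, (forall t, g_ t (Y t)) -> graded_sum rho varrho Y = 0 ->
         forall t, Y t = 0)
    & (forall s t x y, g_ s x -> g_ t y -> g_ (s + t) (br x y))].

(* Main.v *)
(** The dilations [(z_j, w_l) -> (lam z_j, lam^[w_l] w_l)] preserve [M], so, comparing
asymptotic expansions as [lam] tends to [0], every weighted component of an
infinitesimal automorphism is again one.  Such a component [X] is a polynomial
field, and it corresponds to a derivation of the polynomial ring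
[A = C[z, zbar, u]] of functions on [M].  It suffices to bound the weight of [X],
and since the order of vanishing of [X] at [0] grows with its weight, to show that
[X] vanishes if it vanishes to a sufficiently high order at [0].

By nondegeneracy, differentiating the equation of tangency along the (0,1) fields
and Cramer's rule give [D * X_j = \sum (derivatives of the conj(X_i))] in [A], for
some [D <> 0]; likewise with [X] and [conj(X)] exchanged.  Now [X] is annihilated
by the (0,1) fields and [conj(X)] by the (1,0) fields: so moving along the flow of
a field of one type preserves the order of vanishing of one of [X], [conj(X)], and
the above relations preserve that of the other one up to a constant.  Hence [X]
vanishes along all composites of boundedly many such flows.  By finite type these
fill an open set: the functions that vanish along the composites for a word [w]
form a prime ideal [P_w] of [A]; a descending chain of such ideals has length at
most [dim A]; and a minimal [P_w] is stable under the (1,0) and (0,1) fields,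
hence under their brackets, which span the tangent space at [0], so [P_w = 0]. *)

From HB Require Import structures.
Require Import Defs.
From mathcomp Require Import all_boot all_order all_algebra.
From mathcomp Require Import mpoly complex ring lra zify.
From mathcomp Require Import boolp classical_sets functions reals topology.
From mathcomp Require Import normedtype sequences.

Set Implicit Arguments.
Unset Strict Implicit.
Unset Printing Implicit Defensive.

Import Order.TTheory GRing.Theory Num.Theory numFieldNormedType.Exports.

Local Open Scope ring_scope.
Local Open Scope complex_scope.

(** * Polynomial vector fields and the order of vanishing along flows *)

(** The points [(z, conj z, u)] are Zariski dense, so tangency at all points of [M] is an identity
    in [A], with [zbar] an independent variable. Flows are not integrated: the pullback of [f] along
    the flow of [d] has the coefficients [d^a f / a!] in the time, so vanishing to order [s] at the
    origin for all times is a condition on iterated derivatives. This order is additive on products,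
    which makes the ideals [P_w] prime and bounds the loss in dividing by [D].

    The order that determines [X] must not depend on [X]. Finite type provides one word [w] with
    [P_w = 0], and each of its letters costs a fixed number of orders: the number of derivatives in
    the relations, plus the orders of [D] and [conj(D)] along the word.

    Genericity matters because the weights allow linear terms in [u] in [Phi]: [v_1 = u_2],
    [v_2 = - u_1] is the complex hyperplane [w_2 = - i w_1]. At the origin it makes [z, zbar, w]
    generators of [A]. The fields in the definition of finite type are mere convergent series; they
    are replaced by polynomial fields with the same jet at [0]. *)

Section Derivations.
Variable F : numFieldType.

Lemma mpoly_alg_ind (m : nat) (P : {mpoly F[m]} -> Prop) :
  (forall c, P c%:MP) -> (forall i, P 'X_i) ->
  (forall p q, P p -> P q -> P (p + q)) ->
  (forall p q, P p -> P q -> P (p * q)) -> forall p, P p.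
Proof.
move=> PC PX PD PM; elim/mpolyind => [|c a p _ _ Pp].
  by rewrite -mpolyC0.
apply: PD => //; rewrite -mul_mpolyC; apply: (PM) => //.
have P1 : P 1 by rewrite -mpolyC1.
rewrite mpolyXE_id; apply: (big_ind P) => [//|p1 p2|i _]; first exact: PM.
by elim: (a i) => [|e IH]; rewrite ?expr0 // exprS; apply: (PM).
Qed.

Definition psub (m m' : nat) (h : 'I_m -> {mpoly F[m']}) :
  {mpoly F[m]} -> {mpoly F[m']} := mmap (@mpolyC m' F) h.

Section Psub.
Variables (m m' : nat) (h : 'I_m -> {mpoly F[m']}).

HB.instance Definition _ := GRing.RMorphism.copy (psub h) (mmap (@mpolyC m' F) h).

Lemma psubC c : psub h c%:MP = c%:MP.
Proof. exact: mmapC. Qed.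

Lemma psubX i : psub h 'X_i = h i.
Proof. by rewrite /psub mmapX mmap1U. Qed.

Lemma psubZ c p : psub h (c *: p) = c *: psub h p.
Proof. by rewrite -!mul_mpolyC rmorphM /= psubC. Qed.

Lemma meval_psub (v : 'I_m' -> F) p :
  (psub h p).@[v] = p.@[fun i => (h i).@[v]].
Proof.
elim/mpoly_alg_ind: p => [c|i|p q IHp IHq|p q IHp IHq].
- by rewrite psubC !mevalC.
- by rewrite psubX !mevalXU.
- by rewrite rmorphD !mevalD /= IHp IHq.
- by rewrite rmorphM !mevalM /= IHp IHq.
Qed.

End Psub.

Lemma eq_psub m m' (h h' : 'I_m -> {mpoly F[m']}) p :
  h =1 h' -> psub h p = psub h' p.
Proof. by move=> /funext ->. Qed.

Lemma psub_comp m m' m'' (h : 'I_m -> {mpoly F[m']})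
    (h' : 'I_m' -> {mpoly F[m'']}) p :
  psub h' (psub h p) = psub (fun i => psub h' (h i)) p.
Proof.
elim/mpoly_alg_ind: p => [c|i|p q IHp IHq|p q IHp IHq].
- by rewrite !psubC.
- by rewrite !psubX.
- by rewrite !rmorphD /= IHp IHq.
- by rewrite !rmorphM /= IHp IHq.
Qed.

Lemma psub_id m (p : {mpoly F[m]}) : psub (fun i => 'X_i) p = p.
Proof.
elim/mpoly_alg_ind: p => [c|i|p q IHp IHq|p q IHp IHq].
- by rewrite psubC.
- by rewrite psubX.
- by rewrite rmorphD /= IHp IHq.
- by rewrite rmorphM /= IHp IHq.
Qed.

Lemma mderivXU m (i j : 'I_m) : ('X_j : {mpoly F[m]})^`M(i) = (i == j)%:R.
Proof.
rewrite mderivX mnm1E eq_sym; case: eqP => [->|_]; last by rewrite scale0r.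
rewrite scale1r (_ : (U_(j) - U_(j))%MM = 0%MM) ?mpolyX0 //.
by apply/mnmP => l; rewrite mnmBE subnn mnm0E.
Qed.

Definition vder (m : nat) (d : 'I_m -> {mpoly F[m]}) (f : {mpoly F[m]}) :
  {mpoly F[m]} := \sum_i d i * f^`M(i).

Section Vder.
Variables (m : nat) (d : 'I_m -> {mpoly F[m]}).

Lemma vder_is_linear : linear (vder d).
Proof.
move=> c f g; rewrite /vder scaler_sumr -big_split; apply: eq_bigr => i _.
by rewrite linearP mulrDr /= -scalerAr.
Qed.

HB.instance Definition _ :=
  GRing.isLinear.Build F {mpoly F[m]} {mpoly F[m]} _ (vder d) vder_is_linear.

Lemma vderC c : vder d c%:MP = 0.
Proof. by rewrite /vder big1 // => i _; rewrite mderivC mulr0. Qed.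

Lemma vderX i : vder d 'X_i = d i.
Proof.
rewrite /vder (bigD1 i) //= mderivXU eqxx mulr1 big1 ?addr0 // => j /negPf ji.
by rewrite mderivXU ji mulr0.
Qed.

Lemma vderM f g : vder d (f * g) = vder d f * g + f * vder d g.
Proof.
rewrite /vder mulr_suml mulr_sumr -big_split; apply: eq_bigr => i _ /=.
by rewrite mderivM; ring.
Qed.

Lemma iter_vder_linear a : linear (iter a (vder d)).
Proof. by elim: a => [//|a IH] c f g /=; rewrite IH linearP. Qed.

Lemma iter_vder0 a : iter a (vder d) 0 = 0.
Proof. by elim: a => //= a ->; rewrite linear0. Qed.

Lemma iter_vderD a f g :
  iter a (vder d) (f + g) = iter a (vder d) f + iter a (vder d) g.
Proof. by have := iter_vder_linear a 1 f g; rewrite !scale1r. Qed.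

Lemma iter_vderZ a c f : iter a (vder d) (c *: f) = c *: iter a (vder d) f.
Proof. by have := iter_vder_linear a c f 0; rewrite iter_vder0 !addr0. Qed.

Lemma iter_vderM a f g :
  iter a (vder d) (f * g) =
  \sum_(i < a.+1) (iter (a - i) (vder d) f * iter i (vder d) g) *+ 'C(a, i).
Proof.
elim: a => [|a IH]; first by rewrite big_ord_recl big_ord0 /= bin0 addr0.
rewrite iterS IH linear_sum /=.
under eq_bigr => i _ do rewrite linearMn /= vderM mulrnDl.
rewrite big_split /= [RHS]big_ord_recl [X in X + _]big_ord_recl /= !bin0 !subn0.
rewrite -!addrA; congr (_ + _).
under [RHS]eq_bigr => i _ do rewrite /bump /= add1n binS mulrnDr subSS.
rewrite big_split /=; congr (_ + _).
rewrite [RHS]big_ord_recr /= bin_small // mulr0n addr0.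
apply: eq_bigr => i _; rewrite /bump /= add1n -iterS.
by congr (_ * _ *+ _); rewrite -[in RHS]subnSK.
Qed.

End Vder.

Lemma vder_psub m m' (h : 'I_m -> {mpoly F[m']}) (d : 'I_m' -> {mpoly F[m']}) p :
  vder d (psub h p) = \sum_i psub h p^`M(i) * vder d (h i).
Proof.
elim/mpoly_alg_ind: p => [c|i|p q IHp IHq|p q IHp IHq].
- by rewrite psubC vderC big1 // => i _; rewrite mderivC rmorph0 mul0r.
- rewrite psubX (bigD1 i) //= mderivXU eqxx rmorph1 mul1r big1 ?addr0 //.
  by move=> j /negPf ji; rewrite mderivXU ji rmorph0 mul0r.
- rewrite rmorphD linearD /= IHp IHq -big_split; apply: eq_bigr => i _ /=.
  by rewrite mderivD rmorphD mulrDl.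
- rewrite rmorphM vderM /= IHp IHq mulr_suml mulr_sumr -big_split.
  apply: eq_bigr => i _ /=; rewrite mderivM rmorphD !rmorphM /=; ring.
Qed.

(** The hypothesis says that [d] and [e] are related along the polynomial map [h]; it is enough to
    check this on the coordinates. *)
Lemma vder_psub_rel m m' (h : 'I_m -> {mpoly F[m']}) (e : 'I_m -> {mpoly F[m]})
    (d : 'I_m' -> {mpoly F[m']}) p :
  (forall i, vder d (h i) = psub h (e i)) ->
  vder d (psub h p) = psub h (vder e p).
Proof.
move=> dh; rewrite vder_psub [vder e _]/vder rmorph_sum; apply: eq_bigr => i _.
by rewrite dh rmorphM mulrC.
Qed.

Definition vbr m (d e : 'I_m -> {mpoly F[m]}) : 'I_m -> {mpoly F[m]} :=
  fun j => vder d (e j) - vder e (d j).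

Lemma vder_vbr m (d e : 'I_m -> {mpoly F[m]}) f :
  vder (vbr d e) f = vder d (vder e f) - vder e (vder d f).
Proof.
elim/mpoly_alg_ind: f => [c|i|p q IHp IHq|p q IHp IHq].
- by rewrite !vderC !linear0 addr0.
- by rewrite !vderX.
- by rewrite !linearD /= IHp IHq; ring.
- by rewrite !vderM !linearD /= !vderM IHp IHq; ring.
Qed.

Lemma vbr_jacobi m (d e f : 'I_m -> {mpoly F[m]}) j :
  vbr d (vbr e f) j + vbr e (vbr f d) j + vbr f (vbr d e) j = 0.
Proof.
have E (x y z : 'I_m -> {mpoly F[m]}) : vbr x (vbr y z) j =
    vder x (vder y (z j)) - vder x (vder z (y j)) -
    (vder y (vder z (x j)) - vder z (vder y (x j))).
  by rewrite {1}/vbr vder_vbr linearB.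
by rewrite !E; ring.
Qed.

Lemma vderDl m (d e : 'I_m -> {mpoly F[m]}) f :
  vder (fun i => d i + e i) f = vder d f + vder e f.
Proof. by rewrite /vder -big_split; apply: eq_bigr => i _; rewrite mulrDl. Qed.

Lemma vderZl m c (d : 'I_m -> {mpoly F[m]}) f :
  vder (fun i => c *: d i) f = c *: vder d f.
Proof. by rewrite /vder scaler_sumr; apply: eq_bigr => i _; rewrite scalerAl. Qed.

Lemma eq_vder m (d e : 'I_m -> {mpoly F[m]}) f : d =1 e -> vder d f = vder e f.
Proof. by move=> /funext ->. Qed.

End Derivations.

(** * The order of vanishing along a word of derivations *)

Section OrderFiltration.
Variables (F : numFieldType) (m : nat).
Local Notation A := {mpoly F[m]}.
Implicit Types (f g : A) (d e : 'I_m -> A) (w : seq ('I_m -> A)).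

Definition ordge (s : nat) f : Prop := forall a, f@_a != 0 -> (s <= mdeg a)%N.

Lemma ordge1 f : ordge 1 f <-> f@_0%MM = 0.
Proof.
split=> [h|f0 a].
  by apply/eqP; apply/negPn/negP => /h; rewrite mdeg0.
by rewrite lt0n mdeg_eq0; apply: contraNneq => ->; rewrite f0.
Qed.

Lemma ordge_eq0 f : (forall s, ordge s f) -> f = 0.
Proof.
move=> h; apply/mpolyP => a; rewrite mcoeff0; apply/eqP/negPn/negP => fa.
by have := h (mdeg a).+1 _ fa; rewrite ltnn.
Qed.

(* [f] lies in the [s]-th power of the maximal ideal at the origin after any
   application of [d_r^a_r ... d_1^a_1], for [w = [:: d_1; ...; d_r]]; that is,
   the pullback of [f] by the composite of the flows of the [d_i] vanishes to
   order [s] at the origin, for all values of the times. *)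
Fixpoint ordw w (s : nat) f : Prop :=
  if w is d :: w' then forall a, ordw w' s (iter a (vder d) f) else ordge s f.

Lemma ordw_ordge w s f : ordw w s f -> ordge s f.
Proof. by elim: w f => [//|d w IH] f /= /(_ 0%N)/IH. Qed.

Lemma ordw_le w s s' f : (s' <= s)%N -> ordw w s f -> ordw w s' f.
Proof.
move=> ss'; elim: w f => [|d w IH] f /=.
  by move=> h a /h; apply: leq_trans.
by move=> h a; apply: IH.
Qed.

Lemma ordw0 w f : ordw w 0 f.
Proof. by elim: w f => [|d w IH] f /= *; [|apply: IH]. Qed.

Lemma ordwD w s f g : ordw w s f -> ordw w s g -> ordw w s (f + g).
Proof.
elim: w f g => [|d w IH] f g /= hf hg a; last by rewrite iter_vderD; apply: IH.
rewrite mcoeffD; have [->|] := eqVneq f@_a 0; first by rewrite add0r => /hg.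
by move=> /hf.
Qed.

Lemma ordwZ w s c f : ordw w s f -> ordw w s (c *: f).
Proof.
elim: w f => [|d w IH] f /= hf a; last by rewrite iter_vderZ; apply: IH.
by rewrite mcoeffZ mulf_eq0 negb_or => /andP[_ /hf].
Qed.

Lemma ordwz w s : ordw w s 0.
Proof.
by rewrite -(scale0r 0); elim: w => [|d w IH] /= a;
  rewrite scale0r ?mcoeff0 ?eqxx // iter_vder0 -(scale0r 0).
Qed.

Lemma ordw_sum w s (I : Type) (r : seq I) (P : pred I) (G : I -> A) :
  (forall i, P i -> ordw w s (G i)) -> ordw w s (\sum_(i <- r | P i) G i).
Proof.
by move=> h; apply: big_ind => //; [exact: ordwz|move=> *; exact: ordwD].
Qed.

Lemma ordwMn w s f k : ordw w s f -> ordw w s (f *+ k).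
Proof. by rewrite -scaler_nat; apply: ordwZ. Qed.

Lemma ordwN w s f : ordw w s f -> ordw w s (- f).
Proof. by rewrite -scaleN1r; apply: ordwZ. Qed.

Lemma ordwM w s s' f g :
  ordw w s f -> ordw w s' g -> ordw w (s + s') (f * g).
Proof.
elim: w f g => [|d w IH] f g /= hf hg a; last first.
  by rewrite iter_vderM; apply: ordw_sum => i _; apply: ordwMn; apply: IH.
apply: contraNT => lt; rewrite mcoeffM big1 // => -[k1 k2] /= /eqP E.
have {lt} : ~~ (s + s' <= mdeg k1 + mdeg k2)%N by rewrite -mdegD -E.
have [->|/hf h1] := eqVneq f@_k1 0; first by rewrite mul0r.
have [->|/hg h2] := eqVneq g@_k2 0; first by rewrite mulr0.
by rewrite leq_add.
Qed.

Lemma ordwMl w s f g : ordw w s g -> ordw w s (f * g).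
Proof. by move=> h; rewrite -(add0n s); apply: ordwM => //; apply: ordw0. Qed.

(** The monomial order refines the degree, so the least monomial of [f] has the least degree. *)
Lemma ordge_mlast s f : ordge s f -> ~ ordge s.+1 f ->
  f != 0 /\ mdeg (mlast f) = s.
Proof.
move=> h nh; have f0 : f != 0.
  by apply/eqP => f0; apply: nh => a; rewrite f0 mcoeff0 eqxx.
split=> //; apply/eqP; rewrite eqn_leq h ?andbT -?mcoeff_msupp ?mlast_supp //.
rewrite leqNgt; apply/negP => lt; apply: nh => a; rewrite -mcoeff_msupp => ha.
by apply: leq_trans lt _; apply: lemc_mdeg; apply: mlast_lemc.
Qed.

(** At the sum of the two least monomials the coefficient of the product is a single product of
    coefficients, so nothing cancels. *)
Lemma ordge_mul s s' f g : ordge s f -> ~ ordge s.+1 f ->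
  ordge s' g -> ~ ordge s'.+1 g -> ~ ordge (s + s').+1 (f * g).
Proof.
move=> hf nf hg ng; have [f0 df] := ordge_mlast hf nf.
have [g0 dg] := ordge_mlast hg ng.
move=> /(_ (mlast f + mlast g)%MM); rewrite mdegD df dg ltnn => H.
suff E : (f * g)@_(mlast f + mlast g) = f@_(mlast f) * g@_(mlast g).
  suff : false by []. apply: H; rewrite E mulf_neq0 // -mcoeff_msupp; exact: mlast_supp.
have h1 : (mdeg (mlast f) < (mdeg (mlast f + mlast g)).+1)%N.
  by rewrite mdegD ltnS leq_addr.
have h2 : (mdeg (mlast g) < (mdeg (mlast f + mlast g)).+1)%N.
  by rewrite mdegD ltnS leq_addl.
rewrite mcoeffM (bigD1 (BMultinom h1, BMultinom h2)) //= big1 ?addr0 //.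
move=> -[k1 k2] /andP[/= /eqP E ne].
have [->|n1] := eqVneq f@_k1 0; first by rewrite mul0r.
have [->|n2] := eqVneq g@_k2 0; first by rewrite mulr0.
have l1 : (mlast f <= k1)%O by apply: mlast_lemc; rewrite mcoeff_msupp.
have l2 : (mlast g <= k2)%O by apply: mlast_lemc; rewrite mcoeff_msupp.
have e1 : mlast f = k1.
  apply/eqP; move: l1; rewrite le_eqVlt => /orP[//|lt].
  by have := ltmc_le_add lt l2; rewrite -E ltxx.
have e2 : mlast g = k2 by apply: (@addmI _ (mlast f)); apply: (etrans E); congr mnm_add.
case/negP: ne; apply/eqP; congr pair; apply/val_inj => /=; rewrite ?e1 ?e2 //.
Qed.

(** The argument of Gauss's lemma, for power series in the time of the first flow. If [a] and [b]
    are the first exponents at which [f] and [g] have exact order, all terms of the Leibniz formula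
    for [a + b] have higher order except the one with [d^a f * d^b g], whose binomial coefficient is
    invertible in characteristic [0]. *)
Lemma ordw_mul w s s' f g : ordw w s f -> ~ ordw w s.+1 f ->
  ordw w s' g -> ~ ordw w s'.+1 g -> ~ ordw w (s + s').+1 (f * g).
Proof.
elim: w f g => [|d w IH] f g; first exact: ordge_mul.
move=> hf nf hg ng.
have first_der t h : ~ ordw (d :: w) t.+1 h -> exists2 a,
    ~ ordw w t.+1 (iter a (vder d) h) &
    forall b, (b < a)%N -> ordw w t.+1 (iter b (vder d) h).
  move=> /existsNP ex; have ex' : exists a, `[< ~ ordw w t.+1 (iter a (vder d) h) >].
    by case: ex => a ha; exists a; apply/asboolP.
  case: (ex_minnP ex') => a /asboolP ha amin; exists a => // b lt.
  by apply: contrapT => /asboolP/amin; rewrite leqNgt lt.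
have [a na mina] := first_der _ _ nf; have [b nb minb] := first_der _ _ ng.
move=> /= /(_ (a + b)%N); rewrite iter_vderM.
have ltb : (b < (a + b).+1)%N by rewrite ltnS leq_addl.
rewrite (bigD1 (Ordinal ltb)) //= addnK.
set S := \sum_(i < _ | _) _; move=> hS.
have oS : ordw w (s + s').+1 S.
  apply: ordw_sum => i ne; apply: ordwMn.
  (* For [i < b] the factor of [g] gains an order by minimality of [b]; for [i > b] one has
     [a + b - i < a], and the factor of [f] gains it. *)
  have [lt|le] := ltnP i b.
    by rewrite -addnS; apply: ordwM; [apply: hf|apply: minb].
  rewrite -addSn; apply: ordwM; last exact: hg.
  apply: mina; have : (b < i)%N.
    by rewrite ltn_neqAle le andbT; apply: contraNneq ne => E; apply/eqP/val_inj.
  move=> lt; have := ltn_ord i; rewrite ltnS => lti.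
  move: (nat_of_ord i) lt lti => j lt lti.
  by rewrite ltn_subLR // (addnC j) ltn_add2l.
set h := _ * _ in hS; have : ordw w (s + s').+1 (h *+ 'C(a + b, b)).
  by have := ordwD hS (ordwN oS); rewrite addrK.
move=> /(ordwZ ('C(a + b, b)%:R^-1)).
rewrite -[h *+ _]scaler_nat scalerA mulVf ?scale1r; first exact: IH.
by rewrite pnatr_eq0 -lt0n bin_gt0 leq_addl.
Qed.

Lemma ordw_exact w f : f != 0 -> exists s, ordw w s f /\ ~ ordw w s.+1 f.
Proof.
move=> f0; have ex : exists s, `[< ~ ordw w s f >].
  apply: contrapT => h; move/eqP: f0; apply; apply: ordge_eq0 => s.
  by apply: (@ordw_ordge w); apply: contrapT => hs; apply: h; exists s; apply/asboolP.
case: (ex_minnP ex) => -[|s] /asboolP ns mins; first by case: ns; exact: ordw0.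
exists s; split => //; apply: contrapT => /asboolP/mins; by rewrite ltnn.
Qed.

(** By additivity, [r] is the order of [f] along [w]. It is the same for all [g] and [s], so the
    loss is uniform over all automorphisms. *)
Lemma ordw_cancel w f : f != 0 ->
  exists r : nat, forall s g, ordw w (s + r) (f * g) -> ordw w s g.
Proof.
move=> /(ordw_exact w)[r [he ne]]; exists r => s g hfg; apply: contrapT => ng.
have g0 : g != 0 by apply/eqP => g0; apply: ng; rewrite g0; exact: ordwz.
have [t [ht nt]] := ordw_exact w g0.
have ts : (t < s)%N.
  by rewrite ltnNge; apply/negP => st; apply: ng; apply: ordw_le ht.
apply: (ordw_mul he ne ht nt); apply: ordw_le hfg.
by rewrite addnC -addSn leq_add2r.
Qed.

Lemma ordge_mderiv i s f : ordge s.+1 f -> ordge s f^`M(i).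
Proof.
move=> hf a; rewrite mcoeff_deriv => /negP h.
have /hf : f@_(a + U_(i)) != 0 by apply/eqP => E; apply: h; rewrite E mul0rn.
by rewrite mdegD mdeg1 addn1.
Qed.

(** Moving [e] past [d] produces the commutator of [d] and [e], again a derivation; hence the
    inductions run over all [e] at once. *)
Lemma ordw_vder w e s f : ordw w s.+1 f -> ordw w s (vder e f).
Proof.
elim: w e f => [|d w IH] e f.
  move=> hf; apply: (@ordw_sum [::]) => i _; apply: (@ordwMl [::]).
  exact: ordge_mderiv.
move=> /= hf a; elim: a e f hf => [|a IHa] e f hf; first exact: IH (hf 0%N).
rewrite iterSr -[vder d (vder e f)](subrK (vder e (vder d f))) -vder_vbr.
rewrite iter_vderD; apply: ordwD; first exact: IHa.
by apply: IHa => b; rewrite -iterSr.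
Qed.

End OrderFiltration.

(** * Orbits of bracket-generating fields *)

Section AlgebraicDependence.
Variable F : numFieldType.

Definition degle (m : nat) (B : nat) (p : {mpoly F[m]}) : Prop :=
  forall a, p@_a != 0 -> (mdeg a <= B)%N.

Lemma degleM m B B' (p q : {mpoly F[m]}) :
  degle B p -> degle B' q -> degle (B + B') (p * q).
Proof.
move=> hp hq a; apply: contraNT; rewrite -ltnNge => lt; apply/eqP.
rewrite mcoeffM big1 // => -[k1 k2] /= /eqP E.
have {lt} : (B + B' < mdeg k1 + mdeg k2)%N by rewrite -mdegD -E.
have [->|/hp h1] := eqVneq p@_k1 0; first by rewrite mul0r.
have [->|/hq h2] := eqVneq q@_k2 0; first by rewrite mulr0.
by rewrite ltnNge leq_add.
Qed.

Lemma degle_mmap1 m r (f : 'I_r -> {mpoly F[m]}) D q (a : 'X_{1..r}) :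
  (forall i, degle D (f i)) -> (forall i, (a i <= q)%N) ->
  degle (r * (q * D)) (mmap1 f a).
Proof.
move=> hf ha; rewrite /mmap1.
have h1 B : degle B (1 : {mpoly F[m]}).
  move=> b; rewrite mcoeff1; case: (b =P 0%MM) => [->|_]; last by rewrite eqxx.
  by rewrite mdeg0.
have hX i e : degle (e * D) (f i ^+ e).
  by elim: e => [|e IH]; [exact: h1|rewrite exprS mulSn; apply: degleM].
have hX' i : degle (q * D) (f i ^+ a i).
  by move=> b /hX /leq_trans; apply; rewrite leq_mul2r ha orbT.
elim: r f a hf ha hX hX' => [|r IH] f a hf ha hX hX'.
  by rewrite big_ord0; apply: h1.
rewrite big_ord_recl mulSn; apply: degleM => //.
pose b : 'X_{1..r} := [multinom a (lift ord0 i) | i < r].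
have -> : \prod_(i < r) f (lift ord0 i) ^+ a (lift ord0 i) =
  \prod_(i < r) f (lift ord0 i) ^+ b i.
  by apply: eq_bigr => i _; rewrite mnmE.
apply: (IH (fun i => f (lift ord0 i)) b) => [i|i|i e|i]; rewrite ?mnmE //.
Qed.

Lemma leq_expl x y e : (x <= y)%N -> (x ^ e <= y ^ e)%N.
Proof. by move=> xy; elim: e => // e IH; rewrite !expnS leq_mul. Qed.

(* Count the monomials of degree [< q] in each of the [m + 1] variables: there
   are [q^(m+1)] of them, mapped into a space of dimension [O(q^m)]. *)
Lemma mpoly_alg_dependent m (f : 'I_m.+1 -> {mpoly F[m]}) :
  exists2 G : {mpoly F[m.+1]}, G != 0 & psub f G = 0.
Proof.
pose D := \max_i msize (f i).
have hf i : degle D (f i).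
  move=> a; rewrite -mcoeff_msupp => /msize_mdeg_lt/ltnW/leq_trans; apply.
  exact: (leq_bigmax (F := fun i => msize (f i))).
(* [B] bounds the degrees of the images. As [B + 1 <= q * ((m+1) D + 1)], the inequality
   [(B + 1)^m < q^(m+1)] follows once [q] exceeds [((m+1) D + 1)^m]. *)
pose q := ((m.+1 * D).+1 ^ m).+1; pose B := (m.+1 * (q * D))%N.
pose S := {ffun 'I_m.+1 -> 'I_q}; pose T := {ffun 'I_m -> 'I_B.+1}.
pose ms (a : S) : 'X_{1..m.+1} := [multinom (a i : nat) | i < m.+1].
pose mt (b : T) : 'X_{1..m} := [multinom (b i : nat) | i < m].
pose M := \matrix_(i < #|S|, j < #|T|) (mmap1 f (ms (enum_val i)))@_(mt (enum_val j)).
have cardST : (#|T| < #|S|)%N.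
  rewrite !card_ffun !card_ord expnS.
  apply: (@leq_trans (q ^ m * (m.+1 * D).+1 ^ m).+1).
    rewrite ltnS -expnMn; apply: leq_expl.
    by rewrite /B mulnCA mulnS -add1n leq_add2r.
  rewrite mulnC ltn_pmul2r ?ltnSn // expn_gt0 //.
have /rowV0Pn[v /sub_kermxP vM v0] : kermx M != 0.
  rewrite kermx_eq0 /row_free; apply: contraTneq cardST => <-.
  by rewrite -leqNgt; exact: rank_leq_col.
have msI : injective ms.
  move=> a a' E; apply/ffunP => i; apply/val_inj.
  by have /mnmP/(_ i) := E; rewrite !mnmE.
exists (\sum_i v 0 i *: 'X_[ms (enum_val i)]).
  apply: contraNneq v0 => /mpolyP G0; apply/eqP/rowP => i; rewrite mxE.
  have := G0 (ms (enum_val i)); rewrite mcoeff0 raddf_sum (bigD1 i) //=.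
  rewrite mcoeffZ mcoeffX eqxx mulr1 big1 ?addr0 // => j ne.
  rewrite mcoeffZ mcoeffX; case: eqP => [/msI/enum_val_inj E|_]; last by rewrite mulr0.
  by rewrite E eqxx in ne.
apply/mpolyP => b; rewrite mcoeff0 rmorph_sum /= raddf_sum /=.
under eq_bigr => i _ do rewrite psubZ mcoeffZ /psub mmapX.
have [bB|bB] := boolP [forall i, (b i < B.+1)%N].
  pose b' : T := [ffun i => inord (b i)].
  have Eb : mt b' = b.
    by apply/mnmP => i; rewrite mnmE ffunE inordK //; apply: (forallP bB).
  have := congr1 (fun A : 'rV_#|T| => A 0 (enum_rank b')) vM.
  rewrite !mxE => E; rewrite -[RHS]E; apply: eq_bigr => i _.
  by rewrite mxE enum_rankK Eb.
rewrite big1 // => i _; case: (eqVneq (mmap1 f (ms (enum_val i)))@_b 0) => [->|].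
  by rewrite mulr0.
move=> /(@degle_mmap1 _ _ f D q _ hf) h; case/negP: bB; apply/forallP => l.
rewrite ltnS; apply: (@leq_trans (mdeg b)).
  by rewrite mdegE (bigD1 l) //= leq_addr.
by apply: h => j; rewrite mnmE ltnW.
Qed.

Lemma psub_muni m r (f : nat -> {mpoly F[m]}) (G : {mpoly F[r.+1]}) :
  psub (fun i : 'I_r.+1 => f i) G =
  (map_poly (psub (fun i : 'I_r => f i)) (muni G)).[f r].
Proof.
elim/mpoly_alg_ind: G => [c|i|p q IHp IHq|p q IHp IHq].
- by rewrite muniC map_polyC /= hornerC !psubC.
- rewrite psubX /muni mmapX mmap1U; case: splitP => j /= E.
    by rewrite map_polyC /= hornerC psubX E.
  by rewrite map_polyX hornerX E (ord1 j) addn0.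
- by rewrite rmorphD muniD rmorphD hornerD /= IHp IHq.
- by rewrite rmorphM muniM rmorphM hornerM /= IHp IHq.
Qed.

Lemma muni_eq0 r (G : {mpoly F[r.+1]}) : muni G = 0 -> G = 0.
Proof.
move=> G0; pose f (i : nat) : {mpoly F[r.+1]} := 'X_(inord i).
have := psub_muni f G; rewrite G0 rmorph0 horner0 => <-.
rewrite -[LHS]psub_id; apply: eq_psub => i; rewrite /f inord_val //.
Qed.

(** Let [G] be read as a polynomial in its last variable, evaluated at [f r]. Modulo [P r] only its
    constant term remains, which is [0] by induction; then the factor [f r], not in the prime
    [P r.+1], can be cancelled. *)
Lemma prime_chain_alg_independent m (P : nat -> {mpoly F[m]} -> Prop)
    (f : nat -> {mpoly F[m]}) :
  (forall i g, P i.+1 g -> P i g) ->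
  (forall i g h, P i (g * h) -> P i g \/ P i h) ->
  (forall i g h, P i g -> P i h -> P i (g - h)) ->
  (forall i g h, P i h -> P i (g * h)) ->
  (forall i, ~ P i 1) ->
  (forall i, P i (f i) /\ ~ P i.+1 (f i)) ->
  forall r (G : {mpoly F[r]}), P r (psub (fun i : 'I_r => f i) G) -> G = 0.
Proof.
move=> dec prime sub mul ne1 hf; elim=> [|r IH] G.
  rewrite (nvar0_mpolyC G) psubC => h; apply: contrapT => G0; apply: (ne1 0%N).
  set c := G@_0 in h G0; have c0 : c != 0 by apply: contra_notN G0 => /eqP ->; rewrite mpolyC0.
  by rewrite -(mpolyC1 m F) -(mulVf c0) mpolyCM; apply: mul.
rewrite psub_muni => h; apply: muni_eq0; elim/poly_ind: (muni G) h => [//|p c IHp].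
rewrite rmorphD rmorphM /= map_polyX map_polyC /= hornerMXaddC => h.
have c0 : c = 0.
  apply: IH; have := sub _ _ _ (dec _ _ h) (mul _ (map_poly (psub (fun i : 'I_r => f i)) p).[f r] _ (hf r).1).
  by rewrite addrC addKr.
move: h; rewrite c0 rmorph0 addr0 => /prime [/IHp ->|/(hf r).2 //].
by rewrite mul0r add0r.
Qed.

(** The first [m.+1] of the [f i] would be algebraically independent in a polynomial ring in [m]
    variables. *)
Lemma no_prime_chain m (P : nat -> {mpoly F[m]} -> Prop)
    (f : nat -> {mpoly F[m]}) :
  (forall i g, P i.+1 g -> P i g) ->
  (forall i g h, P i (g * h) -> P i g \/ P i h) ->
  (forall i g h, P i g -> P i h -> P i (g - h)) ->
  (forall i g h, P i h -> P i (g * h)) ->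
  (forall i, ~ P i 1) ->
  ~ (forall i, P i (f i) /\ ~ P i.+1 (f i)).
Proof.
move=> dec prime sub mul ne1 hf.
have [G /eqP G0 fG] := mpoly_alg_dependent (fun i : 'I_m.+1 => f i).
apply: G0; apply: (prime_chain_alg_independent dec prime sub mul ne1 hf).
by rewrite fG -(subrr (f m.+1)); apply: sub; apply: (hf _).1.
Qed.

End AlgebraicDependence.

Section Orbits.
Variables (F : numFieldType) (m : nat).
Local Notation A := {mpoly F[m]}.
Implicit Types (f g : A) (d e : 'I_m -> A) (w : seq ('I_m -> A)).

Inductive lie_closure (S : ('I_m -> A) -> Prop) : ('I_m -> A) -> Prop :=
| lie_closure_incl d : S d -> lie_closure S d
| lie_closure_vbr d e :
    lie_closure S d -> lie_closure S e -> lie_closure S (vbr d e).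

Definition spans_at0 (L : ('I_m -> A) -> Prop) : Prop :=
  forall i, exists (r : nat) (c : 'I_r -> F) (D : 'I_r -> 'I_m -> A),
    (forall s, L (D s)) /\
    forall l, \sum_s c s * (D s l)@_0%MM = (i == l)%:R.

Lemma ordgeS s f : ordge 1 f -> (forall i, ordge s f^`M(i)) -> ordge s.+1 f.
Proof.
move=> f0 hf a fa.
have : (0 < mdeg a)%N by exact: f0 fa.
rewrite lt0n mdeg_eq0 => /eqP a0.
have [i ai] : exists i, (a i != 0)%N.
  apply: contrapT => h; apply: a0; apply/mnmP => i; rewrite mnm0E; apply/eqP.
  by apply: contrapT => /negP ?; apply: h; exists i.
have Ea : (a - U_(i) + U_(i))%MM = a by rewrite submK // lep1mP.
suff : (s <= mdeg (a - U_(i)))%N by move=> sa; rewrite -[in X in (_ <= X)%N]Ea mdegD mdeg1 addn1 ltnS.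
apply: (hf i); rewrite mcoeff_deriv Ea -mulr_natr mulf_neq0 // pnatr_eq0 //.
Qed.

(** By induction on [s], all [f] in [P] vanish to order [s]: up to a field vanishing at the origin,
    each [d/dx_i] is a constant combination of fields of [L], which preserve [P]. *)
Lemma stable_spanning_eq0 (L : ('I_m -> A) -> Prop) (P : A -> Prop) :
  spans_at0 L -> (forall f, P f -> ordge 1 f) ->
  (forall d f, L d -> P f -> P (vder d f)) -> forall f, P f -> f = 0.
Proof.
move=> span P1 stable f Pf; apply: ordge_eq0 => s.
elim: s f Pf => [|s IH] f Pf; first by [].
apply: ordgeS => [|i]; first exact: P1.
have [r [c [D [LD cD]]]] := span i.
(* The components of [d/dx_i] minus the combination. They vanish at the origin, which makes up for
   the order lost by differentiating [f]. *)
pose g l : A := (i == l)%:R%:MP - \sum_s c s *: D s l.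
have -> : f^`M(i) = \sum_s c s *: vder (D s) f + \sum_l g l * f^`M(l).
  rewrite [X in _ + X](_ : _ = f^`M(i) - \sum_s c s *: vder (D s) f).
    by rewrite addrC subrK.
  under eq_bigr => l _ do rewrite /g mulrBl.
  rewrite sumrB; congr (_ - _).
    rewrite (bigD1 i) //= eqxx mpolyC1 mul1r big1 ?addr0 // => l ne.
    by rewrite eq_sym (negPf ne) mpolyC0 mul0r.
  under eq_bigr => l _ do rewrite mulr_suml.
  rewrite exchange_big; apply: eq_bigr => t _ /=.
  by rewrite /vder scaler_sumr; apply: eq_bigr => l _; rewrite scalerAl.
apply: (@ordwD _ _ [::]); apply: (@ordw_sum _ _ [::]) => l _.
  by apply: (@ordwZ _ _ [::]); apply: IH; apply: stable.
case: s IH => [|s] IH; first exact: (@ordw0 _ _ [::]).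
apply: (@ordwM _ _ [::] 1 s); last by apply: ordge_mderiv; apply: IH.
apply/ordge1; rewrite mcoeffB mcoeffC eqxx mulr1 raddf_sum /= -(cD l).
by under eq_bigr => t _ do rewrite mcoeffZ; rewrite subrr.
Qed.

Lemma ordw1_prime w f g : ordw w 1 (f * g) -> ordw w 1 f \/ ordw w 1 g.
Proof.
move=> h; apply: contrapT => /not_orP[nf ng].
exact: (ordw_mul (ordw0 w f) nf (ordw0 w g) ng).
Qed.

Lemma ordw1_neq1 w : ~ ordw w 1 1.
Proof. by move=> /ordw_ordge/ordge1/eqP; rewrite mcoeff1 eqxx oner_eq0. Qed.

Lemma ordw_trivial (S : ('I_m -> A) -> Prop) :
  spans_at0 (lie_closure S) ->
  exists w, (forall d, List.In d w -> S d) /\ forall f, ordw w 1 f -> f = 0.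
Proof.
move=> span.
pose W := {w : seq ('I_m -> A) | forall d, List.In d w -> S d}.
(* A word whose ideal does not shrink when a letter of [S] is put in front. Its ideal is stable
   under [S], by the first iterate of the new letter; without such a word, adding letters gives an
   infinite strict chain of primes. *)
suff [[w Sw] hw] : exists w : W, forall d f, S d ->
    ordw (sval w) 1 f -> ordw (d :: sval w) 1 f.
  exists w; split=> //; apply: (stable_spanning_eq0 span) => [f /ordw_ordge//|].
  move=> d f Ld; elim: {d} Ld f => [d Sd|d e _ IHd _ IHe] f hf.
    exact: (hw d f Sd hf 1%N).
  by rewrite vder_vbr; apply: ordwD; [|apply: ordwN]; auto.
apply: contrapT => /forallNP h.
have next (w : W) : exists x : ('I_m -> A) * A,
    [/\ S x.1, ordw (sval w) 1 x.2 & ~ ordw (x.1 :: sval w) 1 x.2].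
  apply: contrapT => h'; apply: (h w) => d f Sd hf; apply: contrapT => nf.
  by apply: h'; exists (d, f).
have [x hx] := choice next.
have Sx (w : W) d : List.In d ((x w).1 :: sval w) -> S d.
  by move=> [<-|]; [case: (hx w)|apply: (svalP w)].
have S0 d : List.In d [::] -> S d by [].
pose W_ i : W := iter i (fun v : W => exist _ _ (Sx v) : W) (exist _ [::] S0).
apply: (@no_prime_chain F m (fun i => ordw (sval (W_ i)) 1) (fun i => (x (W_ i)).2)).
- by move=> i g /(_ 0%N).
- by move=> i g h'; apply: ordw1_prime.
- by move=> i g h' hg hh; apply: ordwD => //; apply: ordwN.
- by move=> i g h'; apply: ordwMl.
- by move=> i; apply: ordw1_neq1.
- by move=> i; case: (hx (W_ i)) => Sxi hi ni; split.
Qed.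

End Orbits.

(** * Kernels, substitutions and Jacobians *)

Section LinearAlgebra.
Variable A : idomainType.

(* Take a nonzero minor of maximal size, on the rows [f] and the columns [g];
   the cofactors of the minors that extend it by the column [j] and an arbitrary
   row provide a kernel vector. *)
Lemma full_minor_or_kernel (I : Type) (N : nat) (M : I -> 'I_N -> A) :
  (exists (f : 'I_N -> I) (g : 'I_N -> 'I_N),
     \det (\matrix_(a, b) M (f a) (g b)) != 0) \/
  (exists2 x : 'I_N -> A, exists j, x j != 0 &
     forall i, \sum_j x j * M i j = 0).
Proof.
pose minor r := exists (f : 'I_r -> I) (g : 'I_r -> 'I_N),
  \det (\matrix_(a, b) M (f a) (g b)) != 0.
have [PN|nPN] := pselect (minor N); [by left|right].
have [r rN [Pr nPr]] : exists2 r, (r < N)%N & minor r /\ ~ minor r.+1.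
  have P0 : minor 0%N.
    have f0 (T : Type) (i : 'I_0) : T by case: i.
    by exists (f0 I), (f0 _); rewrite det_mx00 oner_eq0.
  apply: contrapT => h; apply: nPN.
  suff : forall r, (r <= N)%N -> minor r by apply.
  elim=> // r IH rN; apply: contrapT => nP; apply: h; exists r => //.
  by split=> //; apply: IH; apply: ltnW.
have [f [g fg]] := Pr.
have [j jg] : exists j, forall a, g a != j.
  apply: contrapT => /forallNP h.
  have /subset_leq_card : 'I_N \subset codom g.
    apply/fintype.subsetP => j _; have /existsNP[a /negP/negPn/eqP <-] := h j.
    exact: codom_f.
  move=> /leq_trans/(_ (leq_image_card g _)).
  by rewrite !card_ord leqNgt rN.
pose g' (b : 'I_r.+1) := if unlift ord0 b is Some b' then g b' else j.
pose Mi i := \matrix_(a < r.+1, b < r.+1)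
  M (if unlift ord0 a is Some a' then f a' else i) (g' b).
have cofE i i' b : cofactor (Mi i) 0 b = cofactor (Mi i') 0 b.
  by rewrite /cofactor; congr (_ * \det _); apply/matrixP => a c;
    rewrite !mxE liftK.
(* The cofactors below are read off a matrix with a chosen extra row [i0]; without rows, every
   vector lies in the kernel. *)
have [i0|noI] := pselect (exists i : I, True); last first.
  exists (fun l => (l == j)%:R); first by exists j; rewrite eqxx oner_neq0.
  by move=> i; case: noI; exists i.
have {i0} [i0 _] := i0.
exists (fun l => \sum_(b | g' b == l) cofactor (Mi i0) 0 b).
  exists j; rewrite (big_pred1 ord0) => [|b].
    rewrite /cofactor mulf_neq0 ?signr_eq0 //.
    rewrite (_ : row' 0 (col' 0 (Mi i0)) = \matrix_(a, b) M (f a) (g b)) //.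
    by apply/matrixP => a b; rewrite !mxE !/g' !liftK.
  rewrite /g' -[pred1 ord0 b]/(b == ord0); case: unliftP => [b' ->|->].
    by rewrite (negPf (jg b')).
  by rewrite !eqxx.
move=> i.
have : \det (Mi i) = 0.
  apply: contrapT => /eqP ne; apply: nPr; eexists; eexists; exact: ne.
rewrite (expand_det_row _ 0) => E; rewrite -[RHS]E.
under eq_bigr => l _ do rewrite mulr_suml.
rewrite (exchange_big_dep predT) //=; apply: eq_bigr => b _.
rewrite (big_pred1 (g' b)) => [|l]; last by rewrite eq_sym.
by rewrite (cofE i0 i) mulrC mxE unlift_none.
Qed.

End LinearAlgebra.

Section Substitutions.
Variable F : numFieldType.

Lemma ordge_psub m m' (h : 'I_m -> {mpoly F[m']}) s p :
  (forall i, ordge 1 (h i)) -> ordge s p -> ordge s (psub h p).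
Proof.
move=> h1 hp; rewrite /psub /mmap big_seq; apply: (@ordw_sum _ _ [::]) => a.
rewrite mcoeff_msupp => /hp sa; apply: (@ordwMl _ _ [::]).
apply: (@ordw_le _ _ [::] _ _ _ sa); rewrite /mmap1 mdegE.
rewrite -[ordw _ _ _]/(ordge _ _).
elim/big_rec2: _ => [|i q e _ hq]; first exact: (@ordw0 _ _ [::] _).
apply: (@ordwM _ _ [::] (a i) e) => //.
elim: (a i) => [|r IH]; first by move=> b.
by rewrite exprS; apply: (@ordwM _ _ [::] 1 r); [apply: h1|].
Qed.

Lemma mpoly_eq_const m (f : {mpoly F[m]}) :
  (forall i, f^`M(i) = 0) -> f = (f@_0%MM)%:MP.
Proof.
move=> hf; apply/mpolyP => a; rewrite mcoeffC.
have [->|a0] := eqVneq a 0%MM; first by rewrite mulr1.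
rewrite mulr0; have [i ai] : exists i, (a i != 0)%N.
  apply: contrapT => h; move/eqP: a0; apply; apply/mnmP => i; rewrite mnm0E.
  by apply/eqP; apply: contrapT => /negP ?; apply: h; exists i.
have : (f^`M(i))@_(a - U_(i)) = 0 by rewrite hf mcoeff0.
rewrite mcoeff_deriv submK ?lep1mP // => /eqP.
by rewrite -mulr_natr mulf_eq0 pnatr_eq0 orbF => /eqP.
Qed.

Lemma msize_mderiv m (f : {mpoly F[m]}) i : f != 0 ->
  (msize f^`M(i) < msize f)%N.
Proof.
move=> f0; rewrite (mpolySpred _ f0) ltnS /mmeasure; apply/bigmax_leqP_seq => a.
rewrite mcoeff_msupp mcoeff_deriv -mulr_natr mulf_eq0 negb_or => /andP[].
rewrite -mcoeff_msupp => /(msize_mdeg_lt) h _ _.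
have := h; rewrite mdegD mdeg1 addn1 (mpolySpred _ f0) ltnS //.
Qed.

(* The rows of the adjugate of the Jacobian matrix of [h] are derivations dual
   to the [h j], up to the factor [det]. *)
Definition jac m (h : 'I_m -> {mpoly F[m]}) : 'M[{mpoly F[m]}]_m :=
  \matrix_(i, j) (h j)^`M(i).

Definition nab m (h : 'I_m -> {mpoly F[m]}) (i : 'I_m) : 'I_m -> {mpoly F[m]} :=
  fun l => (\adj (jac h)) i l.

Lemma nabE m (h : 'I_m -> {mpoly F[m]}) i j :
  vder (nab h i) (h j) = \det (jac h) *+ (i == j).
Proof.
have := congr1 (fun M : 'M__ => M i j) (mul_adj_mx (jac h)).
by rewrite !mxE => <-; apply: eq_bigr => l _; rewrite [jac h l j]mxE.
Qed.

Lemma nab_psub m (h : 'I_m -> {mpoly F[m]}) i p :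
  vder (nab h i) (psub h p) = \det (jac h) * psub h p^`M(i).
Proof.
rewrite vder_psub (bigD1 i) //= nabE eqxx mulr1n mulrC big1 ?addr0 // => j ne.
by rewrite nabE eq_sym (negPf ne) mulr0n mulr0.
Qed.

(** By the chain rule [nab_psub], the kernel is stable under partial derivatives; by induction on
    the degree these vanish, and [p] is constant. *)
Lemma psub_inj m (h : 'I_m -> {mpoly F[m]}) :
  \det (jac h) != 0 -> forall p, psub h p = 0 -> p = 0.
Proof.
move=> d0 p; have [r] := ubnP (msize p); elim: r p => [//|r IH] p.
rewrite ltnS => pr hp; have [//|p0] := eqVneq p 0.
have cp : p = (p@_0%MM)%:MP.
  apply: mpoly_eq_const => i; apply: IH.
    by apply: leq_trans pr; apply: msize_mderiv.
  by apply/eqP; have := nab_psub h i p; rewrite hp linear0 => /esym/eqP;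
    rewrite mulf_eq0 (negPf d0).
by move: hp; rewrite cp psubC => ->.
Qed.

Lemma psub_free m (h : 'I_m -> {mpoly F[m]}) (P : pred 'I_m) f :
  (forall i, ~~ P i -> f^`M(i) = 0) -> (forall i, P i -> h i = 'X_i) ->
  psub h f = f.
Proof.
move=> f0 hP; rewrite -[RHS]psub_id /psub /mmap; apply: eq_big_seq => a.
rewrite mcoeff_msupp => fa; congr (_ * _); apply: eq_bigr => i _.
have [/hP ->//|/f0 fi] := boolP (P i).
suff -> : a i = 0%N by rewrite !expr0.
apply: contraNeq fa => ai; have : (f^`M(i))@_(a - U_(i)) = 0 by rewrite fi mcoeff0.
rewrite mcoeff_deriv submK ?lep1mP // => /eqP.
by rewrite -mulr_natr mulf_eq0 pnatr_eq0 orbF.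
Qed.

End Substitutions.

(** * The graph in the coordinates (z, zbar, u) *)

Section Weights.
Variables (m : nat) (c : 'I_m -> nat).
Implicit Types a b : 'X_{1..m}.

Lemma mon_weight0 : mon_weight c 0%MM = 0%N.
Proof. by rewrite /mon_weight big1 // => i _; rewrite mnm0E muln0. Qed.

Lemma mon_weightD a b :
  mon_weight c (a + b)%MM = (mon_weight c a + mon_weight c b)%N.
Proof.
by rewrite /mon_weight -big_split; apply: eq_bigr => i _; rewrite mnmDE mulnDr.
Qed.

Lemma mon_weightU i : mon_weight c U_(i)%MM = c i.
Proof.
rewrite /mon_weight (bigD1 i) //= mnm1E eqxx muln1 big1 ?addn0 // => j ne.
by rewrite mnm1E eq_sym (negPf ne) muln0.
Qed.

Lemma mdeg_le_mon_weight a : (forall i, (0 < c i)%N) -> (mdeg a <= mon_weight c a)%N.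
Proof.
by move=> c0; rewrite mdegE; apply: leq_sum => i _; rewrite leq_pmull.
Qed.

Lemma mon_weight_le_mdeg a M : (forall i, (c i <= M)%N) ->
  (mon_weight c a <= M * mdeg a)%N.
Proof.
by move=> cM; rewrite mdegE big_distrr; apply: leq_sum => i _; rewrite leq_mul2r cM orbT.
Qed.

Lemma mon_weight_eq0 a : (forall i, (0 < c i)%N) ->
  (mon_weight c a == 0%N) = (a == 0%MM).
Proof.
move=> c0; apply/idP/eqP => [|->]; last by rewrite mon_weight0.
by rewrite -leqn0 => /(leq_trans (mdeg_le_mon_weight a c0)); rewrite leqn0 mdeg_eq0 => /eqP.
Qed.

Lemma mon_weight_eqU a i : (forall i, (0 < c i)%N) -> a i != 0%N ->
  (mon_weight c a <= c i)%N -> a = U_(i)%MM.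
Proof.
move=> c0 ai le; have Ea : (a - U_(i) + U_(i))%MM = a by rewrite submK // lep1mP.
suff /eqP : mon_weight c (a - U_(i))%MM == 0%N.
  by move/eqP; rewrite mon_weight_eq0 // => /eqP E; rewrite -Ea E add0m.
by move: le; rewrite -{1}Ea mon_weightD mon_weightU -{2}(add0n (c i)) leq_add2r leqn0.
Qed.

End Weights.

Section Coordinates.
Variables (n k : nat).

(* The indices of the variables [z], [zbar] and [u] of [Phi]. *)
Definition zi (a : 'I_n) : 'I_(n + n + k) := lshift k (lshift n a).
Definition ci (a : 'I_n) : 'I_(n + n + k) := lshift k (rshift n a).
Definition ui (l : 'I_k) : 'I_(n + n + k) := rshift (n + n) l.

Definition tri (T : Type) (x y : 'I_n -> T) (u : 'I_k -> T)
    (i : 'I_(n + n + k)) : T :=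
  match fintype.split i with
  | inl j => match fintype.split j with inl a => x a | inr a => y a end
  | inr l => u l
  end.

Definition duo (T : Type) (x : 'I_n -> T) (u : 'I_k -> T) (i : 'I_(n + k)) : T :=
  match fintype.split i with inl a => x a | inr l => u l end.

Lemma split_lshift p q (a : 'I_p) : fintype.split (lshift q a) = inl a.
Proof. exact: (unsplitK (inl a)). Qed.

Lemma split_rshift p q (a : 'I_q) : fintype.split (rshift p a) = inr a.
Proof. exact: (unsplitK (inr a)). Qed.

Lemma triz T (x y : 'I_n -> T) u a : tri x y u (zi a) = x a.
Proof. by rewrite /tri /zi !split_lshift. Qed.

Lemma tric T (x y : 'I_n -> T) u a : tri x y u (ci a) = y a.
Proof. by rewrite /tri /ci split_lshift split_rshift. Qed.

Lemma triu T (x y : 'I_n -> T) u l : tri x y u (ui l) = u l.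
Proof. by rewrite /tri /ui split_rshift. Qed.

Definition triE := (triz, tric, triu).

Lemma duoz T (x : 'I_n -> T) u a : duo x u (lshift k a) = x a.
Proof. by rewrite /duo split_lshift. Qed.

Lemma duow T (x : 'I_n -> T) u l : duo x u (rshift n l) = u l.
Proof. by rewrite /duo split_rshift. Qed.

Definition duoE := (duoz, duow).

Lemma ord3_ind (P : 'I_(n + n + k) -> Prop) :
  (forall a, P (zi a)) -> (forall a, P (ci a)) -> (forall l, P (ui l)) ->
  forall i, P i.
Proof.
move=> Pz Pc Pu i; rewrite -(splitK i); case: fintype.split => [j|l] /=; last exact: Pu.
by rewrite -(splitK j); case: fintype.split => a /=; [exact: Pz|exact: Pc].
Qed.

Lemma ord2_ind (P : 'I_(n + k) -> Prop) :
  (forall a, P (lshift k a)) -> (forall l, P (rshift n l)) -> forall i, P i.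
Proof.
by move=> Pz Pu i; rewrite -(splitK i); case: fintype.split => a /=; [exact: Pz|exact: Pu].
Qed.

Lemma sum_ord3 (V : nmodType) (G : 'I_(n + n + k) -> V) :
  \sum_i G i = \sum_a G (zi a) + \sum_a G (ci a) + \sum_l G (ui l).
Proof. by rewrite big_split_ord big_split_ord. Qed.

Lemma ui_inj : injective ui. Proof. exact: rshift_inj. Qed.

Lemma eq_uz l a : (ui l == zi a) = false.
Proof. by rewrite /ui /zi eq_rlshift. Qed.
Lemma eq_uc l a : (ui l == ci a) = false.
Proof. by rewrite /ui /ci eq_rlshift. Qed.
Lemma eq_cz a b : (ci a == zi b) = false.
Proof. by rewrite /ci /zi eq_lshift eq_rlshift. Qed.

End Coordinates.

Section Graph.
Variables (C : numFieldType) (ii : C) (n k : nat).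
Hypothesis ii_neq0 : ii != 0.
Variable Phi : 'I_k -> {mpoly C[n + n + k]}.
Local Notation A := {mpoly C[n + n + k]}.
Local Notation ui := (@ui n k).
Local Notation zi := (@zi n k).
Local Notation ci := (@ci n k).
Implicit Types (x y : 'I_(n + k) -> A) (Q : 'I_(n + k) -> {mpoly C[n + k]}).

(* The restrictions to [M] of the coordinates [(z, w)] and [(zbar, wbar)]. *)
Definition hol : 'I_(n + k) -> A :=
  duo (fun a => 'X_(zi a)) (fun l => 'X_(ui l) + ii *: Phi l).

Definition aho : 'I_(n + k) -> A :=
  duo (fun a => 'X_(ci a)) (fun l => 'X_(ui l) - ii *: Phi l).

(* The derivation with components [x] along [d/dZ] and [y] along [d/dZbar]. *)
Definition vE x y : 'I_(n + n + k) -> A :=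
  tri (fun a => x (lshift k a)) (fun a => y (lshift k a))
    (fun l => 2^-1 *: (x (rshift n l) + y (rshift n l))).

(* [ctangent] at the generic point of [M]: [vE x y] maps [w] to [x] and [wbar] to
   [y], so that it is the restriction to [M] of the field with components [x], [y]. *)
Definition ptan x y : Prop := forall l,
  (2 * ii)^-1 *: (x (rshift n l) - y (rshift n l)) = vder (vE x y) (Phi l).

Lemma iiM2V : ii * (2 * ii)^-1 = 2^-1.
Proof. by rewrite invfM mulrCA divff ?mulr1 // ii_neq0. Qed.

Lemma two_neq0 : (2 : C) != 0.
Proof. by rewrite pnatr_eq0. Qed.

Lemma half2 (p : A) : 2^-1 *: (p + p) = p.
Proof.
by rewrite -mulr2n -[p *+ 2]scaler_nat scalerA mulVf ?scale1r // two_neq0.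
Qed.

Lemma halfD (p q : A) : 2^-1 *: (p + q) + 2^-1 *: (p - q) = p.
Proof. by rewrite -scalerDr addrACA subrr addr0 half2. Qed.

Lemma halfB (p q : A) : 2^-1 *: (p + q) - 2^-1 *: (p - q) = q.
Proof. by rewrite -scalerN opprB (addrC p) halfD. Qed.

Lemma ptan_hol x y : ptan x y -> forall j, vder (vE x y) (hol j) = x j.
Proof.
move=> h; elim/ord2_ind => [a|l]; rewrite /hol duoE ?vderX /vE ?triE //.
by rewrite linearD linearZ /= vderX triE -h scalerA iiM2V halfD.
Qed.

Lemma ptan_aho x y : ptan x y -> forall j, vder (vE x y) (aho j) = y j.
Proof.
move=> h; elim/ord2_ind => [a|l]; rewrite /aho duoE ?vderX /vE ?triE //.
by rewrite linearB linearZ /= vderX triE -h scalerA iiM2V halfB.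
Qed.

Lemma vE_vder (d : 'I_(n + n + k) -> A) :
  vE (fun j => vder d (hol j)) (fun j => vder d (aho j)) = d.
Proof.
apply/funext; elim/ord3_ind => [a|a|l]; rewrite /vE triE /hol /aho !duoE ?vderX //.
by rewrite -linearD /= addrACA subrr addr0 -linearZ /= half2 vderX.
Qed.

(** [A] is the coordinate ring of [M], so its derivations are the tangent fields of [M]. With
    [vE_vder] this reduces brackets of tangent fields to commutators of derivations. *)
Lemma ptan_vder (d : 'I_(n + n + k) -> A) :
  ptan (fun j => vder d (hol j)) (fun j => vder d (aho j)).
Proof.
move=> l; rewrite vE_vder /hol /aho !duoE -linearB /= opprB addrC subrKA -scalerDr.
by rewrite -linearZ /= scalerA invfM -mulrA mulVf // mulr1 half2.
Qed.

Lemma ptanD x y x' y' : ptan x y -> ptan x' y' ->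
  ptan (fun j => x j + x' j) (fun j => y j + y' j).
Proof.
move=> h h' l; rewrite opprD addrACA scalerDr h h' -vderDl; apply: eq_vder.
elim/ord3_ind => [a|a|m]; rewrite /vE !triE //.
by rewrite -scalerDr addrACA.
Qed.

Lemma ptan_sum (I : Type) (r : seq I) (P : pred I) (x y : I -> 'I_(n + k) -> A) :
  (forall s, P s -> ptan (x s) (y s)) ->
  ptan (fun j => \sum_(s <- r | P s) x s j) (fun j => \sum_(s <- r | P s) y s j).
Proof.
move=> h; elim: r => [|s r IH].
  move=> l; rewrite !big_nil subr0 scaler0 (eq_vder (e := fun=> 0)).
    by rewrite /vder big1 // => i _; rewrite mul0r.
  by elim/ord3_ind => [a|a|m]; rewrite /vE !triE big_nil ?big_nil ?addr0 ?scaler0.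
have := IH; have [Ps /(ptanD (h s Ps))|Ps] := boolP (P s).
  by move=> + l => /(_ l); rewrite !big_cons Ps => ->; apply: eq_vder;
    elim/ord3_ind => [a|a|m]; rewrite /vE !triE ?big_cons ?Ps.
move=> + l => /(_ l); rewrite !big_cons (negPf Ps) => ->; apply: eq_vder.
by elim/ord3_ind => [a|a|m]; rewrite /vE !triE ?big_cons ?(negPf Ps).
Qed.

Lemma ptanZ (c : C) x y : ptan x y ->
  ptan (fun j => c *: x j) (fun j => c *: y j).
Proof.
move=> h l; rewrite -scalerBr scalerA mulrC -scalerA h -vderZl; apply: eq_vder.
elim/ord3_ind => [a|a|m]; rewrite /vE !triE //.
by rewrite -scalerDr !scalerA mulrC.
Qed.

Lemma ptan_vbr x y x' y' : ptan x y -> ptan x' y' ->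
  ptan (fun j => vder (vE x y) (x' j) - vder (vE x' y') (x j))
       (fun j => vder (vE x y) (y' j) - vder (vE x' y') (y j)).
Proof.
move=> h h'.
have E f : vder (vbr (vE x y) (vE x' y')) f =
    vder (vE x y) (vder (vE x' y') f) - vder (vE x' y') (vder (vE x y) f).
  exact: vder_vbr.
have := ptan_vder (vbr (vE x y) (vE x' y')).
under [X in ptan X]eq_fun => j do rewrite E ptan_hol // ptan_hol //.
by under [X in ptan _ X]eq_fun => j do rewrite E ptan_aho // ptan_aho //.
Qed.

End Graph.

(** * Conjugation, the equations of tangency, and the coordinates [(z, zbar, w)] *)

Section GraphAlgebra.
Variables (C : numFieldType) (ii : C) (n k : nat) (omega : 'I_k -> nat).
Hypothesis ii_neq0 : ii != 0.
Variable cc : {rmorphism C -> C}.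
Hypothesis ccK : involutive cc.
Hypothesis cc_ii : cc ii = - ii.
Variable Phi : 'I_k -> {mpoly C[n + n + k]}.
Local Notation A := {mpoly C[n + n + k]}.
Local Notation ui := (@ui n k).
Local Notation zi := (@zi n k).
Local Notation ci := (@ci n k).
Local Notation hol := (hol ii Phi).
Local Notation aho := (aho ii Phi).
Local Notation ptan := (ptan ii Phi).
Implicit Types (x y : 'I_(n + k) -> A) (Q : 'I_(n + k) -> {mpoly C[n + k]}).

Definition iota Q : 'I_(n + k) -> A := fun j => psub hol (Q j).

Definition swap : 'I_(n + n + k) -> A :=
  tri (fun a => 'X_(ci a)) (fun a => 'X_(zi a)) (fun l => 'X_(ui l)).

(* The complex conjugation of polynomials in [(z, zbar, u)]. *)
Definition cj : A -> A := psub swap \o map_mpoly cc.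

HB.instance Definition _ := GRing.RMorphism.copy cj (psub swap \o map_mpoly cc).

Arguments cj : simpl never.

Lemma cjC c : cj c%:MP = (cc c)%:MP.
Proof. by rewrite /cj /= map_mpolyC psubC. Qed.

Lemma cjX i : cj 'X_i = swap i.
Proof. by rewrite /cj /= map_mpolyX psubX. Qed.

Lemma cjZ c p : cj (c *: p) = cc c *: cj p.
Proof. by rewrite -!mul_mpolyC rmorphM /= cjC. Qed.

Lemma cj_swap i : cj (swap i) = 'X_i.
Proof. by elim/ord3_ind: i => [a|a|l]; rewrite /swap triE cjX /swap triE. Qed.

Lemma cjK : involutive cj.
Proof.
elim/mpoly_alg_ind => [c|i|p q IHp IHq|p q IHp IHq].
- by rewrite !cjC ccK.
- by rewrite cjX cj_swap.
- by rewrite !rmorphD /= IHp IHq.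
- by rewrite !rmorphM /= IHp IHq.
Qed.

Lemma cj_eq0 p : (cj p == 0) = (p == 0).
Proof.
apply/eqP/eqP => [h|->]; last exact: rmorph0.
by rewrite -[p]cjK h; apply: rmorph0.
Qed.

Lemma ordge1X m (i : 'I_m) : ordge 1 ('X_i : {mpoly C[m]}).
Proof. by apply/ordge1; rewrite mcoeffX mnm1_eq0. Qed.

Lemma cj_ordge s p : ordge s p -> ordge s (cj p).
Proof.
move=> hp; apply: ordge_psub => [i|a].
  by elim/ord3_ind: i => [a|a|l]; rewrite /swap triE; apply: ordge1X.
rewrite mcoeff_map_mpoly => h; apply: hp.
by apply: contraNneq h => E; rewrite E raddf0.
Qed.

Lemma vder_cj (d d' : 'I_(n + n + k) -> A) p :
  (forall i, vder d' (swap i) = cj (d i)) -> vder d' (cj p) = cj (vder d p).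
Proof.
move=> h; elim/mpoly_alg_ind: p => [c|i|p q IHp IHq|p q IHp IHq].
- by rewrite cjC !vderC rmorph0.
- by rewrite cjX h vderX.
- by rewrite rmorphD !linearD rmorphD /= IHp IHq.
- by rewrite rmorphM !vderM rmorphD !rmorphM /= IHp IHq.
Qed.

(** The conjugate derivation, [cj \o vder d \o cj]; it interchanges the types (1,0) and (0,1). *)
Definition cder (d : 'I_(n + n + k) -> A) : 'I_(n + n + k) -> A :=
  tri (fun a => cj (d (ci a))) (fun a => cj (d (zi a))) (fun l => cj (d (ui l))).

Lemma cderE d p : vder (cder d) (cj p) = cj (vder d p).
Proof.
apply: vder_cj; elim/ord3_ind => [a|a|l];
  by rewrite /swap triE vderX /cder triE.
Qed.

Hypothesis cjPhi : forall l, cj (Phi l) = Phi l.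

Lemma cj_hol j : cj (hol j) = aho j.
Proof.
elim/ord2_ind: j => [a|l]; rewrite /hol /aho !duoE ?cjX ?/swap ?triE //.
by rewrite rmorphD /= cjX cjZ cjPhi cc_ii scaleNr /swap triE.
Qed.

Lemma vder_vE_cj x p :
  vder (vE x (cj \o x)) (cj p) = cj (vder (vE x (cj \o x)) p).
Proof.
apply: vder_cj; elim/ord3_ind => [a|a|l];
  rewrite /swap triE vderX /vE triE /= ?cjK ?triE ?cjK //.
by rewrite cjZ rmorphD /= cjK fmorphV rmorph_nat addrC.
Qed.

Lemma iota_vbr Q Q' j :
  iota (vbr Q Q') j = psub hol (vder Q (Q' j)) - psub hol (vder Q' (Q j)).
Proof. exact: rmorphB. Qed.

Lemma ptan_iota_vbr Q Q' :
  ptan (iota Q) (cj \o iota Q) -> ptan (iota Q') (cj \o iota Q') ->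
  ptan (iota (vbr Q Q')) (cj \o iota (vbr Q Q')).
Proof.
move=> h h'; have := ptan_vbr ii_neq0 h h'.
have E Q1 (h1 : ptan (iota Q1) (cj \o iota Q1)) p :
    vder (vE (iota Q1) (cj \o iota Q1)) (psub hol p) = psub hol (vder Q1 p).
  by apply: vder_psub_rel => j; rewrite (ptan_hol ii_neq0 h1).
rewrite (_ : (fun j => _) = iota (vbr Q Q')); last first.
  by apply/funext => j; rewrite iota_vbr -!E.
rewrite [X in ptan _ X](_ : _ = cj \o iota (vbr Q Q')) //.
have E' Q1 (h1 : ptan (iota Q1) (cj \o iota Q1)) p :
    vder (vE (iota Q1) (cj \o iota Q1)) (cj (psub hol p)) = cj (psub hol (vder Q1 p)).
  by rewrite vder_vE_cj E.
apply/funext => j; apply: (etrans (congr2 _ (E' _ h _) (congr1 _ (E' _ h' _)))).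
by rewrite -[RHS]/(cj (iota _ j)) iota_vbr rmorphB.
Qed.

(** The (1,0) part of the differential of [v_l - Phi_l]; [rho'] is the opposite of its (0,1)
    part. *)
Definition rho l : 'I_(n + k) -> A :=
  duo (fun a => - (Phi l)^`M(zi a))
    (fun m => ((l == m)%:R / (2 * ii))%:MP - 2^-1 *: (Phi l)^`M(ui m)).

Definition rho' l : 'I_(n + k) -> A :=
  duo (fun a => (Phi l)^`M(ci a))
    (fun m => ((l == m)%:R / (2 * ii))%:MP + 2^-1 *: (Phi l)^`M(ui m)).

Lemma sum_delta (l : 'I_k) (x : 'I_k -> A) (c : C) :
  \sum_m x m * ((l == m)%:R * c)%:MP = c *: x l.
Proof.
rewrite (bigD1 l) //= eqxx mul1r mulrC mul_mpolyC big1 ?addr0 // => m /negPf ne.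
by rewrite eq_sym ne mul0r mpolyC0 mulr0.
Qed.

Lemma ptanE x y : ptan x y <-> forall l, \sum_j x j * rho l j = \sum_j y j * rho' l j.
Proof.
have E l : (\sum_j x j * rho l j == \sum_j y j * rho' l j) =
    ((2 * ii)^-1 *: (x (rshift n l) - y (rshift n l)) == vder (vE x y) (Phi l)).
  rewrite /vder sum_ord3 !big_split_ord /= /rho /rho' /vE.
  under eq_bigr => a _ do rewrite duoz mulrN.
  under [\sum_(i < k) x _ * _]eq_bigr => m _ do rewrite duow mulrBr -scalerAr.
  under [\sum_(i < n) y _ * _]eq_bigr => a _ do rewrite duoz.
  under [\sum_(i < k) y _ * _]eq_bigr => m _ do rewrite duow mulrDr -scalerAr.
  under [X in _ = (_ == X + _ + _)]eq_bigr => a _ do rewrite triE.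
  under [X in _ = (_ == _ + X + _)]eq_bigr => a _ do rewrite triE.
  under [X in _ = (_ == _ + X)]eq_bigr => m _ do rewrite triE -scalerAl mulrDl scalerDr.
  rewrite !big_split /= sumrN !sumrN (sum_delta l (fun m => x (rshift n m))).
  rewrite (sum_delta l (fun m => y (rshift n m))) scalerBr.
  set a1 := \sum_(i < n) _; set a2 := \sum_(i < n) _.
  set b1 := \sum_(i < k) _; set b2 := \sum_(i < k) _.
  set X := _ *: x _; set Y := _ *: y _.
  rewrite -subr_eq0 -[RHS]subr_eq0; congr (_ == _); ring.
split=> h l; first by apply/eqP; rewrite E; apply/eqP; apply: h.
by apply/eqP; rewrite -E; apply/eqP; apply: h.
Qed.

Hypothesis homega1 : forall l, (1 < omega l)%N.
Hypothesis hhom : forall l a, (Phi l)@_a != 0 ->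
  mon_weight (wtPhi omega) a = omega l.

Lemma wtPhi_zi a : wtPhi omega (zi a) = 1%N.
Proof. by rewrite /wtPhi /zi split_lshift. Qed.

Lemma wtPhi_ci a : wtPhi omega (ci a) = 1%N.
Proof. by rewrite /wtPhi /ci split_lshift. Qed.

Lemma wtPhi_ui l : wtPhi omega (ui l) = omega l.
Proof. by rewrite /wtPhi /ui split_rshift. Qed.

Definition wtPhiE := (wtPhi_zi, wtPhi_ci, wtPhi_ui).

Lemma wtPhi_gt0 (i : 'I_(n + n + k)) : (0 < wtPhi omega i)%N.
Proof. by elim/(@ord3_ind n k): i => [a|a|l]; rewrite wtPhiE // ltnW. Qed.

Lemma Phi_coef0 l : (Phi l)@_0%MM = 0.
Proof.
apply/eqP/negPn/negP => /hhom; rewrite mon_weight0 => E.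
by have := homega1 l; rewrite -E.
Qed.

Lemma Phi_coefU l (i : 'I_(n + n + k)) : wtPhi omega i != omega l -> (Phi l)@_U_(i) = 0.
Proof.
by move=> ne; apply/eqP/negPn/negP => /hhom; rewrite mon_weightU; apply/eqP.
Qed.

Lemma hol_ordge1 j : ordge 1 (hol j).
Proof.
elim/ord2_ind: j => [a|l]; rewrite /hol duoE; first exact: ordge1X.
by apply/ordge1; rewrite mcoeffD mcoeffZ Phi_coef0 mulr0 addr0; apply/ordge1/ordge1X.
Qed.

Lemma iota_ordge s Q j : ordge s (Q j) -> ordge s (iota Q j).
Proof. by apply: ordge_psub; exact: hol_ordge1. Qed.

(** The change of variables from [u] to [w]. In the coordinates [(z, zbar, w)] the restrictions of
    holomorphic polynomials are the polynomials free of [zbar], and the (0,1) fields are spanned by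
    the [d/dzbar_a]. *)
Definition theta : 'I_(n + n + k) -> A :=
  tri (fun a => 'X_(zi a)) (fun a => 'X_(ci a)) (fun l => 'X_(ui l) + ii *: Phi l).

(** The part linear in [u] of the restriction of [w] to [M]. By weights, [u_m] can occur linearly in
    [Phi l] only if [omega m = omega l]. *)
Definition Bmx : 'M[C]_k :=
  \matrix_(l, m) ((l == m)%:R + ii * (Phi l)@_U_(ui m)).

Hypothesis Bunit : Bmx \in unitmx.

Lemma mcoeff0_mderiv m (p : {mpoly C[m]}) i : (p^`M(i))@_0%MM = p@_U_(i).
Proof. by rewrite mcoeff_deriv add0m mnm0E. Qed.

(** At the origin the Jacobian matrix is block triangular, with the identity on [(z, zbar)] and the
    transpose of [Bmx] on [u]. *)
Lemma det_jac_theta_neq0 : \det (jac theta) != 0.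
Proof.
suff : (\det (jac theta))@_0%MM != 0 by apply: contraNneq => ->; rewrite mcoeff0.
rewrite -[_@__]/((mcoeff 0%MM : {rmorphism A -> C}) _) -det_map_mx.
apply/det0P => -[v v0 /rowP vM]; case/eqP: v0; apply/rowP.
have vz : forall i, (forall l, i != ui l) -> v 0 i = 0.
  elim/ord3_ind => [a|a|l] h; last by have := h l; rewrite eqxx.
    have := vM (zi a); rewrite !mxE => <-; rewrite (bigD1 (zi a)) //= big1 => [|i ne].
      by rewrite !mxE /theta triE mderivXU eqxx mcoeff1 eqxx mulr1 addr0.
    by rewrite !mxE /theta triE mderivXU (negPf ne) mcoeff0 mulr0.
  have := vM (ci a); rewrite !mxE => <-; rewrite (bigD1 (ci a)) //= big1 => [|i ne].
    by rewrite !mxE /theta triE mderivXU eqxx mcoeff1 eqxx mulr1 addr0.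
  by rewrite !mxE /theta triE mderivXU (negPf ne) mcoeff0 mulr0.
have vu : \col_l v 0 (ui l) = 0.
  rewrite -(mulKmx Bunit (\col_l _)) [X in _ *m X](_ : _ = 0) ?mulmx0 //.
  apply/colP => l; have := vM (ui l); rewrite !mxE sum_ord3 => E; rewrite -[RHS]E.
  rewrite [X in _ = X + _ + _]big1 => [|a _]; last first.
    by rewrite vz ?mul0r // => m; rewrite eq_sym eq_uz.
  rewrite add0r [X in _ = X + _]big1 => [|a _]; last first.
    by rewrite vz ?mul0r // => m; rewrite eq_sym eq_uc.
  rewrite add0r.
  apply: eq_bigr => m _; rewrite !mxE /theta triE linearD linearZ /= mcoeffD mcoeffZ.
  rewrite mderivXU !mcoeff0_mderiv -mpolyC_nat mcoeffC eqxx mulr1 mulrC.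
  by rewrite (inj_eq (@ui_inj n k)) eq_sym.
elim/ord3_ind => [a|a|l]; rewrite [RHS]mxE.
- by apply: vz => l; rewrite eq_sym eq_uz.
- by apply: vz => l; rewrite eq_sym eq_uc.
- by have /colP/(_ l) := vu; rewrite !mxE.
Qed.

Lemma theta_inj p : psub theta p = 0 -> p = 0.
Proof. exact: psub_inj det_jac_theta_neq0 p. Qed.

Lemma psub_hol_theta (p : {mpoly C[n + k]}) : psub hol p =
  psub theta (psub (duo (fun a => 'X_(zi a)) (fun l => 'X_(ui l))) p).
Proof.
rewrite psub_comp; apply: eq_psub; elim/ord2_ind => [a|l];
  by rewrite /hol /theta !duoE psubX triE.
Qed.

Lemma iota_inj Q j : iota Q j = 0 -> Q j = 0.
Proof.
rewrite /iota psub_hol_theta => /theta_inj h.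
pose g : 'I_(n + n + k) -> {mpoly C[n + k]} :=
  tri (fun a => 'X_(lshift k a)) (fun a => 0) (fun l => 'X_(rshift n l)).
have := congr1 (psub g) h; rewrite rmorph0 psub_comp => <-.
rewrite -[LHS]psub_id; apply: eq_psub.
by elim/ord2_ind => [a|l]; rewrite duoE psubX /g triE.
Qed.

Lemma Bmx_weight l m : Bmx l m != 0 -> omega l = omega m.
Proof.
rewrite mxE; have [->//|lm] := eqVneq l m; rewrite add0r mulf_eq0 negb_or => /andP[_].
by have [//|ne] := eqVneq (omega l) (omega m); rewrite Phi_coefU ?wtPhiE ?eqxx // eq_sym.
Qed.

Lemma invBmx_weight l m : invmx Bmx l m != 0 -> omega l = omega m.
Proof.
pose D : 'M[C]_k := diag_mx (\row_l (omega l)%:R).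
(* Being block diagonal for the weights amounts to commuting with their diagonal matrix, and this
   passes to the inverse. *)
have DB : D *m Bmx = Bmx *m D.
  apply/matrixP => a b; rewrite mul_diag_mx mul_mx_diag !mxE mulrC.
  have [E|/Bmx_weight ->//] := eqVneq (Bmx a b) 0.
  by move: E; rewrite mxE => ->; rewrite !mul0r.
have : invmx Bmx *m D = D *m invmx Bmx.
  by rewrite -[D in LHS](mulmxK Bunit) DB !mulmxA mulVmx // mul1mx.
move=> /matrixP/(_ l m); rewrite mul_diag_mx mul_mx_diag !mxE => /eqP.
rewrite mulrC -subr_eq0 -mulrBl mulf_eq0 subr_eq0 eqr_nat.
by move=> /orP[/eqP ->//|/eqP ->]; rewrite eqxx.
Qed.

(* By induction on the weight: the components of weight [d] of [w] are those of
   [B u], up to polynomials in [z], [zbar] and the [u_m] of weight [< d]. *)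
Lemma theta_surj p : exists q, psub theta q = p.
Proof.
pose im p := exists q, psub theta q = p.
have imD p1 p2 : im p1 -> im p2 -> im (p1 + p2).
  by move=> [q1 <-] [q2 <-]; exists (q1 + q2); rewrite rmorphD.
have imM p1 p2 : im p1 -> im p2 -> im (p1 * p2).
  by move=> [q1 <-] [q2 <-]; exists (q1 * q2); rewrite rmorphM.
have imC c : im c%:MP by exists c%:MP; rewrite psubC.
have imZ c p1 : im p1 -> im (c *: p1).
  by move=> h; rewrite -mul_mpolyC; apply: imM.
have im_sum (I : eqType) (r : seq I) (G : I -> A) :
    (forall s, s \in r -> im (G s)) -> im (\sum_(s <- r) G s).
  move=> h; rewrite big_seq; apply: (big_ind im) => //.
  by rewrite -mpolyC0.
have imz a : im 'X_(zi a) by exists 'X_(zi a); rewrite psubX /theta triE.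
have imc a : im 'X_(ci a) by exists 'X_(ci a); rewrite psubX /theta triE.
suff imu d l : (omega l <= d)%N -> im 'X_(ui l).
  elim/mpoly_alg_ind: p => // i.
  by elim/ord3_ind: i => // l; apply: (imu (omega l)).
elim: d l => [|d IH] l ld; first by have := leq_trans (homega1 l) ld.
(* Without its terms linear in [u], [Phi m] involves only those [u_b] with [omega b < omega m], so
   the induction hypothesis applies. *)
pose Rm m : A := Phi m - \sum_b (Phi m)@_U_(ui b) *: 'X_(ui b).
have imR m : (omega m <= d.+1)%N -> im (Rm m).
  move=> md; rewrite [Rm m]mpolyE; apply: im_sum => a; rewrite mcoeff_msupp => ha.
  apply: imZ; rewrite mpolyXE_id.
  have RU b : (Rm m)@_U_(ui b) = 0.
    rewrite mcoeffB raddf_sum /= (bigD1 b) //= mcoeffZ mcoeffX eqxx mulr1.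
    rewrite big1 ?addr0 ?subrr // => b' ne.
    by rewrite mcoeffZ mcoeffX eq_mnm1 (inj_eq (@ui_inj n k)) (negPf ne) mulr0.
  have aU b : a != U_(ui b)%MM by apply: contraNneq ha => ->; rewrite RU.
  have wa : mon_weight (wtPhi omega) a = omega m.
    apply: hhom; move: ha; rewrite mcoeffB raddf_sum /= big1 ?subr0 // => b _.
    by rewrite mcoeffZ mcoeffX eq_sym (negPf (aU b)) mulr0.
  apply: (big_ind im) => [|p1 p2|i _]; [by rewrite -mpolyC1|exact: imM|].
  have [->|ai] := eqVneq (a i) 0%N; first by rewrite expr0 -mpolyC1.
  suff imi : im 'X_i.
    by elim: (a i) => [|e]; [rewrite expr0 -mpolyC1|rewrite exprS; apply: imM].
  elim/ord3_ind: i ai => // b ai; apply: IH; rewrite leqNgt; apply/negP => db.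
  case/eqP: (aU b); apply: (mon_weight_eqU wtPhi_gt0 ai).
  by rewrite wa wtPhiE (leq_trans md).
have imB m : (omega m <= d.+1)%N -> im (\sum_b Bmx m b *: 'X_(ui b)).
  move=> md; have -> : \sum_b Bmx m b *: 'X_(ui b) = psub theta 'X_(ui m) - ii *: Rm m.
    rewrite psubX /theta triE /Rm scalerBr opprB addrA addrAC addrK.
    under eq_bigr => b _ do rewrite mxE scalerDl.
    rewrite big_split /=; congr (_ + _); last first.
      by rewrite scaler_sumr; apply: eq_bigr => b _; rewrite scalerA.
    rewrite (bigD1 m) //= eqxx scale1r big1 ?addr0 // => b ne.
    by rewrite eq_sym (negPf ne) scale0r.
  apply: (imD); first by exists 'X_(ui m).
  by rewrite -scaleNr; apply: (imZ); apply: imR.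
have -> : 'X_(ui l) = \sum_m invmx Bmx l m *: \sum_b Bmx m b *: 'X_(ui b) :> A.
  under eq_bigr => m _ do rewrite scaler_sumr.
  rewrite exchange_big /= (bigD1 l) //= [X in _ + X]big1 ?addr0 => [|b ne].
    under eq_bigr => m _ do rewrite scalerA.
    rewrite -scaler_suml; have /matrixP/(_ l l) := mulVmx Bunit.
    by rewrite !mxE eqxx => ->; rewrite scale1r.
  under eq_bigr => m _ do rewrite scalerA.
  rewrite -scaler_suml; have /matrixP/(_ l b) := mulVmx Bunit.
  by rewrite !mxE eq_sym (negPf ne) => ->; rewrite scale0r.
apply: im_sum => m _; have [->|/invBmx_weight E] := eqVneq (invmx Bmx l m) 0.
  by rewrite scale0r -mpolyC0.
by apply: (imZ); apply: imB; rewrite -E.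
Qed.

End GraphAlgebra.

(** * Finite determination *)

Section FiniteDetermination.
Variables (C : numFieldType) (ii : C) (n k : nat) (omega : 'I_k -> nat).
Variable cc : {rmorphism C -> C}.
Hypothesis ccK : involutive cc.
Hypothesis cc_ii : cc ii = - ii.
Variable Phi : 'I_k -> {mpoly C[n + n + k]}.
Local Notation A := {mpoly C[n + n + k]}.
Local Notation ui := (@ui n k).
Local Notation zi := (@zi n k).
Local Notation ci := (@ci n k).
Local Notation hol := (hol ii Phi).
Local Notation aho := (aho ii Phi).
Local Notation ptan := (ptan ii Phi).
Local Notation iota := (iota ii Phi).
Local Notation theta := (theta ii Phi).
Local Notation rho := (rho ii Phi).
Local Notation rho' := (rho' ii Phi).
Local Notation cj := (cj cc).
Hypothesis cjPhi : forall l, cj (Phi l) = Phi l.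
Hypothesis homega1 : forall l, (1 < omega l)%N.
Hypothesis hhom : forall l a, (Phi l)@_a != 0 ->
  mon_weight (wtPhi omega) a = omega l.
Hypothesis Bunit : Bmx ii Phi \in unitmx.
Hypothesis nondeg : forall Q : 'I_(n + k) -> {mpoly C[n + k]},
  ptan (iota Q) (fun=> 0) -> forall j, Q j = 0.
Implicit Types (x y : 'I_(n + k) -> A) (Q : 'I_(n + k) -> {mpoly C[n + k]}).

(* A multiple of the (0,1) field of [M] with component [1] along [d/dzbar_a]. *)
Definition lbar (a : 'I_n) : 'I_(n + n + k) -> A := nab theta (ci a).

Lemma lbar_hol a j : vder (lbar a) (hol j) = 0.
Proof.
elim/ord2_ind: j => [b|l].
  have -> : hol (lshift k b) = theta (zi b) by rewrite /hol /theta duoE triE.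
  by rewrite nabE eq_cz.
have -> : hol (rshift n l) = theta (ui l) by rewrite /hol /theta duoE triE.
by rewrite nabE eq_sym eq_uc.
Qed.

Lemma vder_psub_hol d p : (forall j, vder d (hol j) = 0) -> vder d (psub hol p) = 0.
Proof. by move=> h; rewrite vder_psub big1 // => j _; rewrite h mulr0. Qed.

Definition lbars (s : seq 'I_n) (p : A) : A := foldr (fun a => vder (lbar a)) p s.

Lemma lbars_sum s (I : Type) (r : seq I) (G : I -> A) :
  lbars s (\sum_(i <- r) G i) = \sum_(i <- r) lbars s (G i).
Proof. by elim: s => //= a s ->; rewrite linear_sum. Qed.

Lemma lbarsM s p q : (forall a, vder (lbar a) p = 0) ->
  lbars s (p * q) = p * lbars s q.
Proof. by move=> h; elim: s => //= a s ->; rewrite vderM h mul0r add0r. Qed.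

Lemma lbars_ordw W s t p : ordw W (t + size s) p -> ordw W t (lbars s p).
Proof.
elim: s t => [|a s IH] t /=; first by rewrite addn0.
by rewrite addnS -addSn => /IH/ordw_vder.
Qed.

Lemma cj_lbars_ordw W s t p : ordw W (t + size s) (cj p) -> ordw W t (cj (lbars s p)).
Proof.
elim: s t => [|a s IH] t /=; first by rewrite addn0.
by rewrite addnS -addSn => /IH; rewrite -cderE; apply: ordw_vder.
Qed.

(* A solution [x] of minimal degree in the coordinates [(z, zbar, w)] is
   annihilated by the [d/dzbar], since the space of solutions is stable under
   them, so that [x] is holomorphic. *)
Lemma nondeg_lbars x :
  (forall s l, \sum_j x j * lbars s (rho l j) = 0) -> forall j, x j = 0.
Proof.
have [G Gx] := choice (fun j => theta_surj homega1 hhom Bunit (x j)).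
move=> H; suff G0 : forall j, G j = 0 by move=> j; rewrite -Gx G0 rmorph0.
have {}H s l : \sum_j psub theta (G j) * lbars s (rho l j) = 0.
  by rewrite -[RHS](H s l); apply: eq_bigr => j _; rewrite Gx.
move: G H {x Gx} => G; have [r] := ubnP (\sum_j msize (G j)).
elim: r G => // r IH G; rewrite ltnS => Gr H.
have [//|/existsNP[j0 /eqP Gj0]] := pselect (forall j, G j = 0).
have dG0 a j : (G j)^`M(ci a) = 0.
  (* Applying [lbar a] to the relation for [s] gives [det] times the relation for the derivatives of
     [G], plus the relation for [a :: s], which holds by assumption. *)
  apply: (IH (fun j => (G j)^`M(ci a))) => [|s l].
    apply: leq_trans Gr; rewrite (bigD1 j0) //= [X in (_ < X)%N](bigD1 j0) //=.
    rewrite -addSn leq_add ?msize_mderiv //; apply: leq_sum => i _.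
    by have [->|/msize_mderiv h] := eqVneq (G i) 0; rewrite ?mderiv0 // ltnW.
  have := congr1 (vder (lbar a)) (H s l); rewrite linear0 linear_sum /=.
  under eq_bigr => i _ do rewrite vderM nab_psub -mulrA.
  rewrite big_split /= (H (a :: s) l) addr0 -mulr_sumr => /eqP.
  by rewrite mulf_eq0 (negPf (det_jac_theta_neq0 Bunit)) => /eqP.
pose g : 'I_(n + n + k) -> {mpoly C[n + k]} :=
  tri (fun a => 'X_(lshift k a)) (fun a => 0) (fun l => 'X_(rshift n l)).
pose Q j := psub g (G j).
have QG j : iota Q j = psub theta (G j).
  rewrite /iota psub_hol_theta; congr psub; rewrite /Q psub_comp.
  apply: (@psub_free _ _ _ (fun i => [forall a, i != ci a])) => [i|].
    by move=> /forallPn[a /negPn/eqP ->].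
  elim/ord3_ind => [a _|a /forallP/(_ a)|l _]; rewrite ?eqxx //.
    by rewrite /g triE psubX duoE.
  by rewrite /g triE psubX duoE.
have Q0 : forall j, Q j = 0.
  apply: nondeg; apply/ptanE => l; rewrite [RHS]big1 => [|j _]; last by rewrite mul0r.
  by rewrite -[RHS](H [::] l); apply: eq_bigr => j _; rewrite QG.
move=> j; apply: (theta_inj Bunit); rewrite -QG.
by rewrite /iota Q0 rmorph0.
Qed.

(* Differentiating the equation of tangency along the [(0,1)] fields, which
   annihilate [iota Q], and Cramer's rule. *)
Lemma reflection : exists2 D : A, D != 0 & exists m : nat,
  forall Q, ptan (iota Q) (cj \o iota Q) -> forall W s,
    ((forall j, ordw W (s + m) (cj (iota Q j))) ->
       forall j, ordw W s (D * iota Q j)) /\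
    ((forall j, ordw W (s + m) (iota Q j)) ->
       forall j, ordw W s (cj D * cj (iota Q j))).
Proof.
pose M (q : seq 'I_n * 'I_k) j := lbars q.1 (rho q.2 j).
have [[f [g fg]]|[x [j0 xj0] xM]] := full_minor_or_kernel M; last first.
  case/eqP: xj0; apply: nondeg_lbars => s l; exact: (xM (s, l)).
pose X := \matrix_(a, b) M (f a) (g b).
(* A repeated column would make the minor vanish; so [g] is a permutation and the system determines
   all components of [iota Q]. *)
have g_inj : injective g.
  move=> a b gab; apply/eqP/negPn/negP => ab; case/eqP: fg.
  rewrite -det_tr; apply: (determinant_alternate ab) => c.
  by rewrite !mxE gab.
(* The rows of the minor come from the equation of tangency differentiated [size (f a).1] times, and
   each derivative costs one order. *)
exists (\det X) => //; exists (\max_a size (f a).1) => Q tQ W s.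
pose r a := lbars (f a).1 (\sum_j cj (iota Q j) * rho' (f a).2 j).
have E b : \det X * iota Q (g b) = \sum_a (\adj X) b a * r a.
  have Er a : r a = \sum_c X a c * iota Q (g c).
    rewrite /r; have /ptanE/(_ (f a).2) <- := tQ; rewrite lbars_sum.
    rewrite (reindex_inj g_inj) /=; apply: eq_bigr => c _.
    by rewrite lbarsM 1?mulrC ?mxE // => a'; apply/vder_psub_hol/lbar_hol.
  under eq_bigr => a _ do rewrite Er mulr_sumr.
  rewrite exchange_big /=; under eq_bigr => c _ do
    (under eq_bigr => a _ do rewrite mulrA; rewrite -mulr_suml).
  have adjE c : \sum_a (\adj X) b a * X a c = \det X *+ (b == c).
    by have := congr1 (fun M : 'M_ _ => M b c) (mul_adj_mx X); rewrite !mxE.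
  under eq_bigr => c _ do rewrite adjE.
  rewrite (bigD1 b) //= eqxx mulr1n big1 ?addr0 // => c cb.
  by rewrite eq_sym (negPf cb) mul0r.
have gK : bijective g by exact: injF_bij.
have [g' gg' g'g] := gK.
have sz a : (s + size (f a).1 <= s + \max_a size (f a).1)%N.
  by rewrite leq_add2l (leq_bigmax (F := fun a => size (f a).1)).
split=> h j; rewrite -(g'g j).
  rewrite E; apply: ordw_sum => a _; apply: ordwMl; apply: lbars_ordw.
  apply: ordw_sum => i _; rewrite mulrC; apply: ordwMl.
  exact: ordw_le (sz a) (h i).
rewrite -rmorphM E rmorph_sum; apply: ordw_sum => a _; rewrite rmorphM.
apply: ordwMl; apply: cj_lbars_ordw; rewrite rmorph_sum; apply: ordw_sum => i _.
by rewrite rmorphM mulrC /= cjK //; apply: ordwMl; exact: ordw_le (sz a) (h i).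
Qed.

(** Type (0,1) is expressed as annihilating the holomorphic coordinates, and type (1,0) as
    annihilating their conjugates. *)
Definition crder (d : 'I_(n + n + k) -> A) : Prop :=
  (forall j, vder d (hol j) = 0) \/ (forall j, vder d (aho j) = 0).

Lemma ordw_cons_const W (d : 'I_(n + n + k) -> A) s (p : A) : vder d p = 0 -> ordw W s p -> ordw (d :: W) s p.
Proof.
by move=> dp hp [//|a]; rewrite iterSr dp iter_vder0; apply: ordwz.
Qed.

(** Both orders are carried along. A new letter annihilates one of [iota Q] and its conjugate, whose
    order persists; [reflection] and [ordw_cancel] transfer it to the other at a cost that does not
    depend on [Q]. *)
Lemma ordw_orbit W : (forall d, List.In d W -> crder d) ->
  exists r : nat, forall Q s, ptan (iota Q) (cj \o iota Q) ->
    (forall j, ordge (s + r) (Q j)) ->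
    forall j, ordw W s (iota Q j) /\ ordw W s (cj (iota Q j)).
Proof.
have [D D0 [m refl]] := reflection.
elim: W => [|d W IH] hW.
  exists 0%N => Q s _ hQ j; rewrite addn0 in hQ.
  have h : ordge s (iota Q j) by apply: (iota_ordge homega1 hhom).
  by split=> //; apply: cj_ordge.
have [|r hr] := IH; first by move=> e eW; apply: hW; right.
have cD0 : cj D != 0 by rewrite cj_eq0.
have [e1 he1] := ordw_cancel (d :: W) D0; have [e2 he2] := ordw_cancel (d :: W) cD0.
(* Besides the loss [r] for [W]: [m] for the derivatives in the relations, [e1] or [e2] for
   cancelling [D] or [cj D], according to the type of [d]. *)
exists (e1 + e2 + m + r)%N => Q s tQ hQ j.
have le1 : (s <= s + (e1 + e2 + m))%N by rewrite leq_addr.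
have H i := hr Q (s + (e1 + e2 + m))%N tQ (fun j => ltac:(by rewrite -addnA; apply: hQ)) i.
case: (hW d (or_introl erefl)) => hd.
  have hi i : ordw (d :: W) (s + (e1 + e2 + m)) (iota Q i).
    by apply: ordw_cons_const (H i).1; apply: vder_psub_hol.
  split; first exact: ordw_le le1 (hi j).
  apply: he2; apply: (refl Q tQ (d :: W) (s + e2)%N).2 => i; apply: ordw_le (hi i).
  by rewrite -!addnA leq_add2l leq_addl.
have hi i : ordw (d :: W) (s + (e1 + e2 + m)) (cj (iota Q i)).
  apply: ordw_cons_const (H i).2.
  have -> : cj (iota Q i) = psub aho (map_mpoly cc (Q i)).
    rewrite /iota; elim/mpoly_alg_ind: (Q i) => [c|a|p q Ip Iq|p q Ip Iq].
    - by rewrite psubC cjC map_mpolyC psubC.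
    - by rewrite psubX map_mpolyX psubX cj_hol.
    - by rewrite !rmorphD /= Ip Iq.
    - by rewrite !rmorphM /= Ip Iq.
  by rewrite vder_psub big1 // => a _; rewrite hd mulr0.
split; last exact: ordw_le le1 (hi j).
apply: he1; apply: (refl Q tQ (d :: W) (s + e1)%N).1 => i; apply: ordw_le (hi i).
by rewrite -!addnA leq_add2l leq_add2l leq_addl.
Qed.

Lemma finite_determination : spans_at0 (lie_closure crder) ->
  exists r : nat, forall Q, ptan (iota Q) (cj \o iota Q) ->
    (forall j, ordge r (Q j)) -> forall j, Q j = 0.
Proof.
move=> /ordw_trivial[W [hW W0]]; have [r hr] := ordw_orbit hW.
exists r.+1 => Q tQ hQ j; apply: (iota_inj Bunit); apply: W0.
by have [] := hr Q 1%N tQ hQ j.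
Qed.

End FiniteDetermination.

(** * Evaluation at the points of the graph *)

Section Evaluation.

Lemma poly_nat_roots (C : numFieldType) (p : {poly C}) :
  (forall q : nat, p.[q%:R] = 0) -> p = 0.
Proof.
move=> h; apply/eqP/negPn/negP => p0.
pose rs : seq C := [seq q%:R | q <- seq.iota 0 (size p)].
have : (size rs < size p)%N.
  apply: max_poly_roots => //.
    by apply/allP => _ /mapP[q _ ->]; rewrite rootE h.
  by rewrite map_inj_uniq ?iota_uniq // => a b /eqP; rewrite eqr_nat => /eqP.
by rewrite size_map size_iota ltnn.
Qed.

(** Natural parameters are infinitely many, hence determine [p] on the line; they are also fixed by
    conjugation, so lines of points [(z, conj z, u)] qualify. *)
Lemma mpoly_deriv_line (C : numFieldType) m (p : {mpoly C[m]}) (v d : 'I_m -> C) :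
  (forall q : nat, p.@[fun i => v i + q%:R * d i] = 0) ->
  \sum_i d i * p^`M(i).@[v] = 0.
Proof.
pose L : {mpoly C[m]} -> {poly C} := mmap polyC (fun i => (v i)%:P + d i *: 'X).
have Lhorner f t : (L f).[t] = f.@[fun i => v i + t * d i].
  elim/mpoly_alg_ind: f => [c|i|f g IHf IHg|f g IHf IHg].
  - by rewrite /L mmapC hornerC mevalC.
  - by rewrite /L mmapX mmap1U mevalXU hornerD hornerC hornerZ hornerX mulrC.
  - by rewrite /L mmapD hornerD mevalD IHf IHg.
  - by rewrite /L rmorphM hornerM mevalM IHf IHg.
have Lderiv f : (L f)^`() = \sum_i d i *: L f^`M(i).
  elim/mpoly_alg_ind: f => [c|i|f g IHf IHg|f g IHf IHg].
  - rewrite /L mmapC derivC big1 // => i _.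
    by rewrite mderivC mmap0 scaler0.
  - rewrite /L mmapX mmap1U derivD derivC derivZ derivX add0r.
    rewrite (bigD1 i) //= big1 ?addr0 => [|j ne]; last first.
      by rewrite mderivXU (negPf ne) mmap0 scaler0.
    by rewrite mderivXU eqxx -mpolyC1 mmapC.
  - rewrite /L mmapD derivD -/(L f) -/(L g) IHf IHg -big_split.
    by apply: eq_bigr => i _; rewrite mderivD /L mmapD scalerDr.
  - rewrite /L rmorphM derivM -/(L f) -/(L g) IHf IHg mulr_suml mulr_sumr -big_split.
    apply: eq_bigr => i _; rewrite /= mderivM /L mmapD !rmorphM /=.
    by rewrite -scalerAl -scalerAr -scalerDr.
move=> h; have L0 : L p = 0.
  by apply: poly_nat_roots => q; rewrite Lhorner.
have := congr1 (fun f => f.[0]) (Lderiv p).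
rewrite L0 deriv0 horner0 horner_sum => /esym E; rewrite -[RHS]E.
apply: eq_bigr => i _; rewrite hornerZ Lhorner; congr (_ * _).
by apply: meval_eq => j; rewrite mul0r addr0.
Qed.

Lemma meval_vder (C : numFieldType) m (d : 'I_m -> {mpoly C[m]}) p (v : 'I_m -> C) :
  (vder d p).@[v] = \sum_i (d i).@[v] * p^`M(i).@[v].
Proof. by rewrite /vder rmorph_sum /=; apply: eq_bigr => i _; rewrite mevalM. Qed.

Lemma meval_cj (C : numFieldType) (n k : nat) (cc : {rmorphism C -> C})
    (p : {mpoly C[n + n + k]}) v :
  (forall i, (@swap C n k i).@[v] = cc (v i)) -> (cj cc p).@[v] = cc p.@[v].
Proof.
move=> h; elim/mpoly_alg_ind: p => [c|i|p q IHp IHq|p q IHp IHq].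
- by rewrite cjC !mevalC.
- by rewrite cjX h mevalXU.
- by rewrite rmorphD !mevalD IHp IHq rmorphD.
- by rewrite rmorphM !mevalM IHp IHq rmorphM.
Qed.

End Evaluation.

(** * Density of the points [(z, conj z, u)], and tangency at the points of [M] *)

Section RealPoints.
Variables (R : realType) (n k : nat).
Local Notation C := R[i].
Local Notation A := {mpoly C[n + n + k]}.
Local Notation ui := (@ui n k).
Local Notation zi := (@zi n k).
Local Notation ci := (@ci n k).
Local Notation ii := ('i%C : C).

Definition ccj : {rmorphism C -> C} := [the {rmorphism C -> C} of @conjc R].

Definition pt (z : 'I_n -> C) (u : 'I_k -> R) : 'I_(n + n + k) -> C :=
  tri z (fun a => conjc (z a)) (fun l => (u l)%:C).

Lemma Phi_args_pt (Z : 'I_(n + k) -> C) :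
  Phi_args Z = pt (fun a => Z (lshift k a)) (fun l => complex.Re (Z (rshift n l))).
Proof. by []. Qed.

Lemma iiN0 : ii != 0.
Proof. by rewrite eq_complex /= oner_eq0 andbF. Qed.

Lemma ccj_ii : ccj ii = - ii.
Proof. by apply/eqP; rewrite eq_complex /= oppr0 !eqxx. Qed.

Lemma ccjK : involutive ccj. Proof. exact: conjcK. Qed.

Lemma pt_line z u (zeta : 'I_n -> C) (v : 'I_k -> R) (q : nat) :
  pt (fun a => z a + q%:R * zeta a) (fun l => u l + q%:R * v l) =1
  (fun i => pt z u i + q%:R * pt zeta v i).
Proof.
elim/ord3_ind => [a|a|l]; rewrite /pt !triE //.
  by rewrite rmorphD rmorphM /= conjc_nat.
by rewrite rmorphD rmorphM /= rmorph_nat.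
Qed.

(** Induction on the degree: the derivatives along real directions vanish at these points, and the
    directions [1] and [i] in [z_a] separate [d/dz_a] from [d/dzbar_a]. *)
Lemma mpoly_eq0_pt (p : A) : (forall z u, p.@[pt z u] = 0) -> p = 0.
Proof.
have [r] := ubnP (msize p); elim: r p => // r IH p; rewrite ltnS => pr hp.
have [//|p0] := eqVneq p 0.
have dir zeta v z u : \sum_i pt zeta v i * p^`M(i).@[pt z u] = 0.
  apply: mpoly_deriv_line => q; rewrite -[RHS](hp (fun a => z a + q%:R * zeta a)
    (fun l => u l + q%:R * v l)).
  by apply: meval_eq => i; rewrite pt_line.
pose dl (T : nzRingType) N (a b : 'I_N) : T := (a == b)%:R.
have dirz (c : C) a z u :
    c * p^`M(zi a).@[pt z u] + conjc c * p^`M(ci a).@[pt z u] = 0.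
  rewrite -[RHS](dir (fun b => c * dl C n a b) (fun=> 0) z u) sum_ord3.
  rewrite [X in _ = _ + X]big1 ?addr0 => [|l _]; last by rewrite /pt triE mul0r.
  congr (_ + _); rewrite (bigD1 a) //= big1 ?addr0 => [|b ne];
    rewrite /pt triE /dl ?eqxx ?mulr1 // eq_sym (negPf ne) mulr0 ?conjc0 mul0r //.
have dz a : p^`M(zi a) = 0 /\ p^`M(ci a) = 0.
  have sr : (msize p^`M(zi a) < r)%N /\ (msize p^`M(ci a) < r)%N.
    by split; apply: leq_trans pr; apply: msize_mderiv.
  have E z u : p^`M(zi a).@[pt z u] = 0 /\ p^`M(ci a).@[pt z u] = 0.
    have := dirz 1 a z u; have := dirz ii a z u.
    set x := p^`M(zi a).@[_]; set y := p^`M(ci a).@[_].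
    rewrite conjc1 !mul1r -[conjc ii]/(ccj ii) ccj_ii mulNr -mulrBr => /eqP.
    rewrite mulf_eq0 (negPf iiN0) subr_eq0 => /eqP -> /eqP.
    by rewrite -mulr2n -mulr_natl mulf_eq0 pnatr_eq0 => /eqP ->.
  by split; [apply: IH sr.1 _|apply: IH sr.2 _] => z u; case: (E z u).
have du l : p^`M(ui l) = 0.
  apply: IH => [|z u]; first by apply: leq_trans pr; apply: msize_mderiv.
  rewrite -[RHS](dir (fun=> 0) (fun m => dl R k l m) z u) sum_ord3.
  rewrite [X in _ = X + _ + _]big1 ?add0r => [|a _]; last by rewrite /pt triE mul0r.
  rewrite [X in _ = X + _]big1 ?add0r => [|a _]; last by rewrite /pt triE conjc0 mul0r.
  rewrite (bigD1 l) //= big1 ?addr0 => [|b ne]; rewrite /pt triE /dl ?eqxx ?mul1r //.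
  by rewrite eq_sym (negPf ne) mul0r.
have cp : p = (p@_0%MM)%:MP.
  by apply: mpoly_eq_const; elim/ord3_ind => [a|a|l]; rewrite ?(dz a).1 ?(dz a).2 ?du.
have := hp (fun=> 0) (fun=> 0); rewrite cp mevalC => ->.
by rewrite mpolyC0.
Qed.

Lemma meval_cj_pt (p : A) z u : (cj ccj p).@[pt z u] = conjc p.@[pt z u].
Proof.
apply: (@meval_cj _ n k ccj) => i.
elim/ord3_ind: i => [a|a|l]; rewrite /swap triE mevalXU /pt !triE //.
  exact/esym/conjcK.
exact/esym/conjc_real.
Qed.

Variable Phi : 'I_k -> {mpoly R[i][n + n + k]}.
Hypothesis hreal : forall l, real_valued (Phi l).

Lemma Phi_pt_real l z u : conjc ((Phi l).@[pt z u]) = (Phi l).@[pt z u].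
Proof.
pose Z : 'I_(n + k) -> C := duo z (fun l => (u l)%:C).
have -> : (Phi l).@[pt z u] = (Phi l).@[Phi_args Z].
  apply: meval_eq; rewrite Phi_args_pt; elim/ord3_ind => [a|a|m];
    by rewrite /pt !triE /Z duoE.
have := hreal l Z; case: (_.@[_]) => a b /= ->.
by rewrite oppr0.
Qed.

Lemma cjPhi_real l : cj ccj (Phi l) = Phi l.
Proof.
apply/eqP; rewrite -subr_eq0; apply/eqP/mpoly_eq0_pt => z u.
by rewrite mevalB meval_cj_pt Phi_pt_real subrr.
Qed.

Lemma meval_hol Z j : graph Phi Z -> (hol ii Phi j).@[Phi_args Z] = Z j.
Proof.
move=> gZ; elim/ord2_ind: j => [a|l]; rewrite /hol duoE ?mevalD mevalXU Phi_args_pt /pt triE //.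
have := gZ l; rewrite Phi_args_pt mevalZ => <-.
by rewrite -complexE.
Qed.

Lemma meval_aho Z j : graph Phi Z -> (aho ii Phi j).@[Phi_args Z] = conjc (Z j).
Proof.
move=> gZ; rewrite -(cj_hol ccj_ii cjPhi_real) Phi_args_pt meval_cj_pt -Phi_args_pt.
by rewrite meval_hol.
Qed.

Lemma graph_pt z u : exists Z, graph Phi Z /\ Phi_args Z = pt z u.
Proof.
pose Z j := (hol ii Phi j).@[pt z u].
have Zz a : Z (lshift k a) = z a by rewrite /Z /hol duoE mevalXU /pt triE.
have Zw l : Z (rshift n l) = (u l)%:C + ii * (Phi l).@[pt z u].
  by rewrite /Z /hol duoE mevalD mevalXU mevalZ {1}/pt triE.
have Er l : (complex.Im (Z (rshift n l)))%:C = (Phi l).@[pt z u] /\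
    complex.Re (Z (rshift n l)) = u l.
  rewrite Zw; have := Phi_pt_real l z u; case: (_.@[_]) => a b /= [] /esym/eqP.
  rewrite -addr_eq0 -mulr2n -mulr_natl mulf_eq0 pnatr_eq0 /= => /eqP ->.
  by rewrite !mul0r !mulr0 !mul1r subr0 !addr0 !add0r.
have EZ : Phi_args Z = pt z u.
  rewrite Phi_args_pt; apply/funext; elim/ord3_ind => [a|a|l]; rewrite /pt !triE ?Zz //.
  by rewrite (Er l).2.
by exists Z; split=> // l; rewrite EZ (Er l).1.
Qed.

Lemma ctangent_meval Z (x y : 'I_(n + k) -> A) :
  ctangent Phi Z (fun j => (x j).@[Phi_args Z]) (fun j => (y j).@[Phi_args Z]) <->
  forall l, ((2 * ii)^-1 *: (x (rshift n l) - y (rshift n l)) -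
     vder (vE x y) (Phi l)).@[Phi_args Z] = 0.
Proof.
have E l : ((2 * ii)^-1 *: (x (rshift n l) - y (rshift n l)) -
     vder (vE x y) (Phi l)).@[Phi_args Z] =
   ((x (rshift n l)).@[Phi_args Z] - (y (rshift n l)).@[Phi_args Z]) / (2 * ii) -
   \sum_(i < n + n + k) (Phi l)^`M(i).@[Phi_args Z] *
     dPhi_args (fun j => (x j).@[Phi_args Z]) (fun j => (y j).@[Phi_args Z]) i.
  rewrite mevalB mevalZ mevalB meval_vder mulrC; congr (_ - _); apply: eq_bigr => i _.
  rewrite mulrC; congr (_ * _); elim/ord3_ind: i => [a|a|m]; rewrite /vE triE.
  - by rewrite [RHS]/dPhi_args /zi !split_lshift.
  - by rewrite [RHS]/dPhi_args /ci split_lshift split_rshift.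
  - by rewrite [RHS]/dPhi_args /ui split_rshift mevalZ mevalD mulrC.
split=> h l; first by rewrite E h subrr.
by apply/eqP; rewrite -subr_eq0 -E h.
Qed.

Lemma ptan_ctangent (x y : 'I_(n + k) -> A) :
  ptan ii Phi x y <-> forall Z, graph Phi Z ->
    ctangent Phi Z (fun j => (x j).@[Phi_args Z]) (fun j => (y j).@[Phi_args Z]).
Proof.
split=> h.
  by move=> Z _; apply/ctangent_meval => l; rewrite h subrr meval0.
move=> l; apply/eqP; rewrite -subr_eq0; apply/eqP/mpoly_eq0_pt => z u.
have [Z [gZ <-]] := graph_pt z u.
by have /ctangent_meval := h Z gZ; apply.
Qed.

Lemma meval_iota Q Z j : graph Phi Z ->
  (iota ii Phi Q j).@[Phi_args Z] = (Q j).@[Z].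
Proof. by move=> gZ; rewrite meval_psub; apply: meval_eq => i; rewrite meval_hol. Qed.

Lemma meval_cj_iota Q Z j : graph Phi Z ->
  (cj ccj (iota ii Phi Q j)).@[Phi_args Z] = conjc ((Q j).@[Z]).
Proof. by move=> gZ; rewrite Phi_args_pt meval_cj_pt -Phi_args_pt meval_iota. Qed.

End RealPoints.

(** * Asymptotic expansions along dilations *)

Section BoundedSums.
Variables (m : nat).

Lemma bmnm_sum_widen (V : nmodType) (D D' : nat) (P : pred 'X_{1..m}) (G : 'X_{1..m} -> V) :
  (D <= D')%N -> (forall a, P a -> (mdeg a < D)%N) ->
  \sum_(a : 'X_{1..m < D'} | P a) G a = \sum_(a : 'X_{1..m < D} | P a) G a.
Proof.
move=> DD' PD.
have E d : \sum_(a : 'X_{1..m < d} | P a) G a =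
    \sum_(a <- [seq (val b : 'X_{1..m}) | b <- index_enum ('X_{1..m < d} : finType) & P (val b)]) G a.
  by rewrite big_map big_filter.
rewrite !E; apply: perm_big; apply: uniq_perm.
- by rewrite map_inj_uniq ?filter_uniq ?index_enum_uniq //; apply: val_inj.
- by rewrite map_inj_uniq ?filter_uniq ?index_enum_uniq //; apply: val_inj.
move=> a; apply/mapP/mapP => -[b]; rewrite mem_filter => /andP[Pb _] ->.
  by exists (BMultinom (PD _ Pb)) => //; rewrite mem_filter Pb mem_index_enum.
have h : (mdeg (val b) < D')%N by apply: leq_trans (PD _ Pb) DD'.
by exists (BMultinom h) => //; rewrite mem_filter Pb mem_index_enum.
Qed.

Lemma bmnm_sumB (V : zmodType) (D D' : nat) (G : 'X_{1..m} -> V) : (D <= D')%N ->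
  \sum_(a : 'X_{1..m < D'}) G a - \sum_(a : 'X_{1..m < D}) G a =
  \sum_(a : 'X_{1..m < D'} | (D <= mdeg a)%N) G a.
Proof.
move=> DD'; rewrite (bigID (fun a : 'X_{1..m < D'} => (mdeg a < D)%N)) /=.
rewrite (@bmnm_sum_widen _ D D' (fun a => mdeg a < D)%N) // addrAC.
rewrite [X in _ - X](eq_bigl (fun a : 'X_{1..m < D} => mdeg a < D)%N) => [|a]; last first.
  by rewrite bmdeg.
by rewrite subrr add0r; apply: eq_bigl => a; rewrite -leqNgt.
Qed.

End BoundedSums.

Section Asymptotics.
Variable R : realType.
Local Notation C := R[i].
Local Notation nrm := (@Normc.normc R).
Implicit Types (g h : R -> C) (P : nat -> C).

Lemma nrm_ge0 (x : C) : 0 <= nrm x.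
Proof. by case: x => a b; apply: sqrtr_ge0. Qed.

Lemma nrm_real (x : R) : nrm x%:C = `|x|.
Proof. by rewrite /= expr0n addr0 sqrtr_sqr. Qed.

Lemma nrm_Re (x : C) : `|complex.Re x| <= nrm x.
Proof.
case: x => a b /=; rewrite -sqrtr_sqr ler_wsqrtr // lerDl sqr_ge0 //.
Qed.

Lemma nrm_Im (x : C) : `|complex.Im x| <= nrm x.
Proof.
case: x => a b /=; rewrite -sqrtr_sqr ler_wsqrtr // lerDr sqr_ge0 //.
Qed.

Lemma nrm_le_ReIm (x : C) : nrm x <= `|complex.Re x| + `|complex.Im x|.
Proof.
case: x => a b /=; rewrite -[leRHS]ger0_norm ?addr_ge0 // -sqrtr_sqr ler_wsqrtr //.
rewrite sqrrD addrAC !real_normK ?num_real // lerDl mulrn_wge0 //.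
by rewrite mulr_ge0.
Qed.

Lemma nrm_conj (x : C) : nrm (conjc x) = nrm x.
Proof. by case: x => a b /=; rewrite sqrrN. Qed.

Lemma nrm_sum (I : Type) (r : seq I) (Q : pred I) (G : I -> C) :
  nrm (\sum_(i <- r | Q i) G i) <= \sum_(i <- r | Q i) nrm (G i).
Proof.
elim/big_rec2: _ => [|i y x _ le]; first by rewrite Normc.normc0.
by apply: le_trans (le_normcD _ _) _; rewrite lerD2l.
Qed.

(** The remainder of [g] after the first [d] terms of the asymptotic expansion with coefficients
    [P]. *)
Definition expansion g P (d : nat) (lam : R) : C :=
  g lam - \sum_(e < d) P e * (lam ^+ e)%:C.

Definition asymd g P (d : nat) : Prop := exists K lam0 : R, 0 < lam0 /\
  forall lam, 0 < lam < lam0 -> nrm (expansion g P d lam) <= K * lam ^+ d.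

Definition asym g P : Prop := forall d, asymd g P d.

Lemma asymd_pred g P d : asymd g P d.+1 -> asymd g P d.
Proof.
move=> [K [l [l0 h]]]; exists (`|K| + nrm (P d)), (Num.min l 1).
rewrite lt_min l0 ltr01; split=> // lam /andP[lam0]; rewrite lt_min => /andP[laml lam1].
have -> : expansion g P d lam = expansion g P d.+1 lam + P d * (lam ^+ d)%:C.
  by rewrite /expansion big_ord_recr /= opprD addrA subrK.
apply: le_trans (le_normcD _ _) _; rewrite mulrDl lerD //; last first.
  by rewrite Normc.normcM nrm_real ger0_norm ?lexx // exprn_ge0 // ltW.
apply: le_trans (h lam _) _; first by rewrite lam0.
apply: le_trans (_ : `|K| * lam ^+ d.+1 <= _).
  by rewrite ler_wpM2r ?ler_norm // exprn_ge0 // ltW.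
by rewrite ler_wpM2l // exprS ler_piMl ?exprn_ge0 // ltW.
Qed.

Lemma asymd_le g P d d' : (d <= d')%N -> asymd g P d' -> asymd g P d.
Proof.
by move=> /subnK <-; elim: (d' - d)%N => // r IH /asymd_pred.
Qed.

Lemma asymD g h P Q : asym g P -> asym h Q ->
  asym (fun lam => g lam + h lam) (fun e => P e + Q e).
Proof.
move=> hg hh d; have [K [l [l0 hK]]] := hg d; have [K' [l' [l0' hK']]] := hh d.
exists (K + K'), (Num.min l l'); rewrite lt_min l0 l0'; split=> // lam.
move=> /andP[lam0]; rewrite lt_min => /andP[h1 h2].
have -> : expansion (fun lam => g lam + h lam) (fun e => P e + Q e) d lam =
    expansion g P d lam + expansion h Q d lam.
  rewrite /expansion addrACA -opprD -big_split; congr (_ - _).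
  by apply: eq_bigr => e _; rewrite mulrDl.
apply: le_trans (le_normcD _ _) _; rewrite mulrDl lerD //.
  by apply: hK; rewrite lam0.
by apply: hK'; rewrite lam0.
Qed.

Lemma asymZ (c : C) g P : asym g P ->
  asym (fun lam => c * g lam) (fun e => c * P e).
Proof.
move=> hg d; have [K [l [l0 hK]]] := hg d; exists (nrm c * K), l; split=> // lam hl.
have -> : expansion (fun lam => c * g lam) (fun e => c * P e) d lam =
    c * expansion g P d lam.
  by rewrite /expansion mulrBr mulr_sumr; under eq_bigr do rewrite -mulrA.
by rewrite Normc.normcM -mulrA ler_wpM2l ?nrm_ge0 // hK.
Qed.

Lemma asym0 : asym (fun=> 0) (fun=> 0).
Proof.
move=> d; exists 0, 1; split=> // lam _.
by rewrite /expansion big1 ?subr0 ?Normc.normc0 ?mul0r // => e _; rewrite mul0r.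
Qed.

Lemma asym_ext g h P Q : g =1 h -> P =1 Q -> asym h Q -> asym g P.
Proof. by move=> /funext -> /funext ->. Qed.

Lemma asym_sum (I : Type) (r : seq I) (g : I -> R -> C) (P : I -> nat -> C) :
  (forall i, asym (g i) (P i)) ->
  asym (fun lam => \sum_(i <- r) g i lam) (fun e => \sum_(i <- r) P i e).
Proof.
move=> h; elim: r => [|i r IH].
  by apply: asym_ext asym0 => ?; rewrite big_nil.
by apply: asym_ext (asymD (h i) IH) => ?; rewrite big_cons.
Qed.

Lemma asym_conj g P : asym g P ->
  asym (fun lam => conjc (g lam)) (fun e => conjc (P e)).
Proof.
move=> hg d; have [K [l [l0 hK]]] := hg d; exists K, l; split=> // lam hl.
have -> : expansion (fun lam => conjc (g lam)) (fun e => conjc (P e)) d lam =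
    conjc (expansion g P d lam).
  rewrite /expansion rmorphB rmorph_sum; congr (_ - _).
  by apply: eq_bigr => e _; rewrite rmorphM; congr (_ * _); exact/esym/conjc_real.
by rewrite nrm_conj hK.
Qed.

Definition shift (w : nat) P (e : nat) : C := if (w <= e)%N then P (e - w)%N else 0.

Lemma asym_shift w g P : asym g P ->
  asym (fun lam => (lam ^+ w)%:C * g lam) (shift w P).
Proof.
move=> hg d; apply: (asymd_le (leq_addl w d)).
have [K [l [l0 hK]]] := hg d; exists K, l; split=> // lam hl.
have -> : expansion (fun lam => (lam ^+ w)%:C * g lam) (shift w P) (w + d) lam =
    (lam ^+ w)%:C * expansion g P d lam.
  rewrite /expansion mulrBr big_split_ord /= big1 ?add0r => [|e _]; last first.
    by rewrite /shift leqNgt ltn_ord mul0r.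
  congr (_ - _); rewrite mulr_sumr; apply: eq_bigr => e _.
  by rewrite /shift leq_addr addKn mulrCA exprD rmorphM.
have lam0 : 0 <= lam by case/andP: hl => /ltW.
rewrite Normc.normcM nrm_real ger0_norm ?exprn_ge0 // exprD mulrCA.
by rewrite ler_wpM2l ?exprn_ge0 // hK.
Qed.

Lemma small_eq0 (x K l : R) : 0 <= x -> 0 < l ->
  (forall lam, 0 < lam < l -> x <= K * lam) -> x = 0.
Proof.
move=> x0 l0 h; apply/eqP; rewrite eq_le x0 andbT leNgt; apply/negP => xp.
have K1 : 0 < `|K| + 1 by rewrite ltr_wpDl.
pose lam := Num.min (l / 2) (x / (2 * (`|K| + 1))).
have lam0 : 0 < lam by rewrite lt_min !divr_gt0 ?mulr_gt0.
have laml : lam < l.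
  by apply: le_lt_trans (_ : l / 2 < l); [rewrite ge_min lexx|rewrite ltr_pdivrMr ?ltr_pMr // ltr1n].
have := h lam; rewrite lam0 laml => /(_ isT); apply/negP; rewrite -ltNge.
apply: (@le_lt_trans _ _ ((`|K| + 1) * lam)).
  by apply: (ler_wpM2r (ltW lam0)); rewrite (le_trans (ler_norm _)) // lerDl.
apply: (@le_lt_trans _ _ ((`|K| + 1) * (x / (2 * (`|K| + 1))))).
  by apply: (ler_wpM2l (ltW K1)); rewrite ge_min lexx orbT.
have -> : (`|K| + 1) * (x / (2 * (`|K| + 1))) = x / 2.
  by field; rewrite gt_eqF.
by rewrite ltr_pdivrMr // ltr_pMr // ltr1n.
Qed.

Lemma asym_eq0 g P l : asym g P -> 0 < l ->
  (forall lam, 0 < lam < l -> g lam = 0) -> forall e, P e = 0.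
Proof.
move=> hg l0 g0 e; have [r] := ubnP e; elim: r e => // r IH e; rewrite ltnS => er.
have [K [l' [l0' hK]]] := hg e.+1.
apply/Normc.eq0_normc/(@small_eq0 _ K (Num.min l l')).
- exact: nrm_ge0.
- by rewrite lt_min l0.
move=> lam /andP[lam0]; rewrite lt_min => /andP[h1 h2].
have := hK lam; rewrite lam0 h2 => /(_ isT).
rewrite /expansion g0 ?lam0 // sub0r normcN big_ord_recr /= big1 ?add0r => [|i _]; last first.
  by rewrite IH ?mul0r // (leq_trans (ltn_ord i)).
rewrite Normc.normcM nrm_real ger0_norm; last by rewrite exprn_ge0 // ltW.
by rewrite exprS mulrA ler_pM2r // exprn_gt0.
Qed.

End Asymptotics.

(** * Expansion of convergent series along dilations *)

Section PowerSeries.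
Variables (R : realType) (m : nat).
Local Notation C := R[i].
Local Notation nrm := (@Normc.normc R).
Implicit Types (f : ps R m) (x : 'I_m -> C).

(** [N + a] is nondecreasing and bounded, and [a = (N + a) - N]. *)
Lemma cvg_dominated (a N : nat -> R) : cvgn N ->
  (forall D D', (D <= D')%N -> `|a D' - a D| <= N D' - N D) -> cvgn a.
Proof.
move=> cN h.
have Nle D D' : (D <= D')%N -> N D <= N D'.
  by move=> /h H; rewrite -subr_ge0; apply: le_trans H.
have cNa : cvgn (N + a).
  apply: nondecreasing_is_cvgn => [D D' DD'|].
    have := h _ _ DD'; rewrite ler_norml => /andP[h1 _].
    by rewrite /= !fctE -subr_ge0 opprD addrACA -lerBlDl sub0r.
  exists (2 * limn N - N 0%N + a 0%N) => _ [D _ <-]; rewrite !fctE.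
  have hD := nondecreasing_cvgn_le Nle cN D.
  have := h _ _ (leq0n D); rewrite ler_norml => /andP[_]; lra.
have -> : a = (N + a) - N by apply/funext => D; rewrite !fctE addrC addKr.
exact: is_cvgB.
Qed.

Definition hcomp (c : 'I_m -> nat) (e : nat) f : {mpoly C[m]} :=
  \sum_(a : 'X_{1..m < e.+1} | mon_weight c a == e) f a *: 'X_[a].

Lemma mcoeff_hcomp c e f b : (forall i, (0 < c i)%N) ->
  (hcomp c e f)@_b = if mon_weight c b == e then f b else 0.
Proof.
move=> c0; rewrite /hcomp raddf_sum /=; case: ifP => [/eqP be|be].
  have h : (mdeg b < e.+1)%N by rewrite ltnS -be mdeg_le_mon_weight.
  rewrite (bigD1 (BMultinom h)) ?be //= big1 ?addr0 => [|a /andP[_ ne]].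
    by rewrite mcoeffZ mcoeffX eqxx mulr1.
  rewrite mcoeffZ mcoeffX; case: eqP => [E|_]; last by rewrite mulr0.
  by case/eqP: ne; apply/val_inj.
rewrite big1 // => a /eqP ae; rewrite mcoeffZ mcoeffX; case: eqP => [E|_].
  by rewrite -E ae eqxx in be.
by rewrite mulr0.
Qed.

Lemma mmap1_dilate (c : 'I_m -> nat) (lam : R) x (a : 'X_{1..m}) :
  mmap1 (fun i => (lam ^+ c i)%:C * x i) a = (lam ^+ mon_weight c a)%:C * mmap1 x a.
Proof.
rewrite /mmap1 /mon_weight; under eq_bigr => i _ do rewrite exprMn -rmorphXn -exprM.
by rewrite big_split /= -rmorph_prod prodrXr.
Qed.

(** For [0 < lam < 1], each term of weight at least [d] is at most [lam^d] times its norm at [x],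
    and these norms are summable. *)
Lemma asym_ps_eval (c : 'I_m -> nat) f x : (forall i, (0 < c i)%N) ->
  ps_summable f x ->
  asym (fun lam => ps_eval f (fun i => (lam ^+ c i)%:C * x i))
       (fun e => (hcomp c e f).@[x]).
Proof.
move=> c0 sx d.
pose N D : R := \sum_(a : 'X_{1..m < D}) nrm (f a * mmap1 x a).
have cN : cvgn N by exact: sx.
have Nle : {homo N : D D' / (D <= D')%N >-> D <= D'}.
  move=> D D' DD'; rewrite -subr_ge0 /N (bmnm_sumB (fun a => nrm (f a * mmap1 x a))) //.
  by apply: sumr_ge0 => a _; apply: nrm_ge0.
have NS D : N D <= limn N by apply: nondecreasing_cvgn_le.
exists (limn N + limn N), 1; split=> // lam /andP[lam0 lam1].
have lam_pow e : 0 <= lam ^+ e by rewrite exprn_ge0 ?ltW.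
pose y i := (lam ^+ c i)%:C * x i.
pose t a : C := f a * mmap1 y a.
have nt a e : (e <= mon_weight c a)%N -> nrm (t a) <= lam ^+ e * nrm (f a * mmap1 x a).
  move=> le; rewrite /t mmap1_dilate mulrCA Normc.normcM nrm_real ger0_norm //.
  by rewrite ler_wpM2r ?nrm_ge0 // ler_wiXn2l // ltW.
pose u D := ps_partial f y D.
have uE D : u D = \sum_(a : 'X_{1..m < D}) t a by [].
have du D D' : (D <= D')%N -> nrm (u D' - u D) <= N D' - N D.
  move=> DD'; rewrite !uE (bmnm_sumB t) // /N (bmnm_sumB (fun a => nrm (f a * mmap1 x a))) //.
  apply: le_trans (nrm_sum _ _ _) _; apply: ler_sum => a _.
  by apply: le_trans (nt a 0%N _) _; rewrite // expr0 mul1r.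
have cRe : cvgn (fun D => complex.Re (u D) : R).
  apply: (cvg_dominated cN) => D D' /du; apply: le_trans.
  by apply: le_trans (nrm_Re _); rewrite raddfB.
have cIm : cvgn (fun D => complex.Im (u D) : R).
  apply: (cvg_dominated cN) => D D' /du; apply: le_trans.
  by apply: le_trans (nrm_Im _); rewrite raddfB.
pose T : C := \sum_(e < d) (hcomp c e f).@[x] * (lam ^+ e)%:C.
(* With positive weights the degree is at most the weight, so a partial sum of degree [< D], where
   [D >= d], contains all terms of weight [< d]. *)
have TE D : (d <= D)%N -> T = \sum_(a : 'X_{1..m < D} | (mon_weight c a < d)%N) t a.
  move=> dD; transitivity (\sum_(e < d) \sum_(a : 'X_{1..m < D} | mon_weight c a == e) t a).
    apply: eq_bigr => e _; rewrite /hcomp raddf_sum /= mulr_suml.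
    rewrite -(@bmnm_sum_widen m _ e.+1 D (fun a => mon_weight c a == e)
      (fun a => (f a *: 'X_[a]).@[x] * (lam ^+ e)%:C)); first last.
    - by move=> a /eqP <-; rewrite ltnS mdeg_le_mon_weight.
    - by apply: leq_trans dD.
    apply: eq_bigr => a /eqP ae.
    by rewrite mevalZ mevalX /t mmap1_dilate ae mulrAC -mulrA.
  rewrite (exchange_big_dep predT) //= [RHS]big_mkcond; apply: eq_bigr => a _.
  case: ifP => ad.
    by rewrite (big_pred1 (Ordinal ad)) // => e; rewrite /= -val_eqE eq_sym.
  by rewrite big_pred0 // => e; apply/negP => /eqP ae; rewrite ae ltn_ord in ad.
have uT D : (d <= D)%N -> nrm (u D - T) <= limn N * lam ^+ d.
  move=> dD; rewrite uE (TE _ dD) (bigID (fun a : 'X_{1..m < D} => mon_weight c a < d)%N) /=.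
  rewrite addrAC subrr add0r; apply: le_trans (nrm_sum _ _ _) _.
  apply: (@le_trans _ _ (\sum_(a : 'X_{1..m < D}) lam ^+ d * nrm (f a * mmap1 x a))).
    rewrite [leRHS](bigID (fun a : 'X_{1..m < D} => mon_weight c a < d)%N) /=.
    rewrite -[leLHS]add0r lerD //.
      by apply: sumr_ge0 => a _; rewrite mulr_ge0 ?nrm_ge0.
    by apply: ler_sum => a; rewrite -leqNgt; apply: nt.
  by rewrite -mulr_sumr mulrC ler_wpM2r // NS.
have lim_bound (v : nat -> R) w B : cvgn v -> (forall D, (d <= D)%N -> `|v D - w| <= B) ->
    `|limn v - w| <= B.
  move=> cv hB; rewrite ler_norml lerBrDr lerBlDr; apply/andP; split.
    apply: limr_ge => //; exists d => // D /= /hB.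
    by rewrite ler_norml lerBrDr => /andP[].
  apply: limr_le => //; exists d => // D /= /hB.
  by rewrite ler_norml lerBlDr => /andP[].
rewrite /expansion -/T mulrDl; apply: le_trans (nrm_le_ReIm _) _.
rewrite !raddfB /=; apply: lerD; apply: lim_bound => // D /uT; apply: le_trans.
  by apply: le_trans (nrm_Re _); rewrite raddfB.
by apply: le_trans (nrm_Im _); rewrite raddfB.
Qed.

Definition ps_of (p : {mpoly C[m]}) : ps R m := fun a => p@_a.

Lemma ps_partial_of p x D : (msize p <= D)%N -> ps_partial (ps_of p) x D = p.@[x].
Proof.
move=> pD; rewrite [in RHS](mpolywE pD) raddf_sum; apply: eq_bigr => a _.
by rewrite /= mevalZ mevalX.
Qed.

Lemma ps_eval_of p x : ps_eval (ps_of p) x = p.@[x].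
Proof.
rewrite /ps_eval [RHS](complexE) [in RHS]mulrC.
have E (h : C -> R) : limn (fun d => h (ps_partial (ps_of p) x d)) = h p.@[x].
  apply: norm_lim_near_cst; exists (msize p) => // D /= pD.
  by rewrite ps_partial_of.
by rewrite !E; case: (p.@[x]) => a b; apply/eqP; rewrite eq_complex /= !mul0r !mulr0 !mulr1 !subr0 !addr0 !add0r !eqxx.
Qed.

Lemma ps_convergent_of p : ps_convergent (ps_of p).
Proof.
exists 1 => // x _; rewrite /ps_summable.
apply: (is_cvg_near_cst (\sum_(a : 'X_{1..m < msize p}) nrm (ps_of p a * mmap1 x a))).
exists (msize p) => // D /= pD; apply/eqP; rewrite -subr_eq0.
rewrite (bmnm_sumB (fun a => nrm (ps_of p a * mmap1 x a))) // big1 // => a /msize_mdeg_ge.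
by rewrite mcoeff_msupp negbK /ps_of => /eqP ->; rewrite mul0r Normc.normc0.
Qed.

Lemma ps_eval0 f : ps_eval f (fun=> 0) = f 0%MM.
Proof.
have E D : (0 < D)%N -> ps_partial f (fun=> 0) D = f 0%MM.
  case: D => // D _; have h0 : (mdeg (0%MM : 'X_{1..m}) < D.+1)%N by rewrite mdeg0.
  rewrite /ps_partial (bigD1 (BMultinom h0)) //= big1 ?addr0 => [|a ne].
    by rewrite mmap11 mulr1.
  have [i ai] : exists i, (val a i != 0)%N.
    apply: contrapT => h; case/eqP: ne; apply/val_inj/mnmP => i; rewrite mnm0E.
    by apply/eqP; apply: contrapT => /negP ?; apply: h; exists i.
  by rewrite /mmap1 (bigD1 i) //= expr0n (negPf ai) mul0r mulr0.
have L (h : C -> R) : limn (fun d => h (ps_partial f (fun=> 0) d)) = h (f 0%MM).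
  by apply: norm_lim_near_cst; exists 1%N => // D /= D0; rewrite E.
by rewrite /ps_eval !L; case: (f _).
Qed.

End PowerSeries.

Section WeightedEvaluation.

(** The weight of [p] is [d - w], possibly negative, as for the derivative of a polynomial of weight
    [d] along a variable of weight [w]. *)
Lemma meval_dilate (C : numFieldType) m (c : 'I_m -> nat) (w d : nat)
    (p : {mpoly C[m]}) (lam : C) v :
  (forall a, p@_a != 0 -> (mon_weight c a + w)%N = d) ->
  lam ^+ w * p.@[fun i => lam ^+ c i * v i] = lam ^+ d * p.@[v].
Proof.
move=> hp; rewrite !mevalE !mulr_sumr; apply: eq_big_seq => a.
rewrite mcoeff_msupp => /hp <-; rewrite exprD.
under eq_bigr => i _ do rewrite exprMn -exprM.
rewrite big_split /= prodrXr /mon_weight; ring.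
Qed.

Lemma meval_fun0 (C : numFieldType) m (p : {mpoly C[m]}) (v : 'I_m -> C) :
  (forall i, v i = 0) -> p.@[v] = p@_0%MM.
Proof.
move=> v0; elim/mpoly_alg_ind: p => [c|i|p q IHp IHq|p q IHp IHq].
- by rewrite mevalC mcoeffC eqxx mulr1.
- by rewrite mevalXU v0 mcoeffX mnm1_eq0.
- by rewrite mevalD mcoeffD IHp IHq.
- by rewrite mevalM rmorphM /= IHp IHq.
Qed.

End WeightedEvaluation.

(** * Weighted dilations and tangency *)

Section Dilations.
Variables (R : realType) (n k : nat) (omega : 'I_k -> nat).
Local Notation C := R[i].
Local Notation ii := ('i%C : C).
Variable Phi : 'I_k -> {mpoly R[i][n + n + k]}.
Hypothesis hhom : forall l a, (Phi l)@_a != 0 ->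
  mon_weight (wtPhi omega) a = omega l.
Hypothesis homega1 : forall l, (1 < omega l)%N.

Local Notation wt := (@wt n k omega).

(** The successor makes this a positive bound for all weights, including the weight [1] of [z],
    whatever [k] is. *)
Definition maxw : nat := (\max_l omega l).+1.

Lemma omega_le_maxw l : (omega l <= maxw)%N.
Proof. by rewrite ltnW // ltnS (leq_bigmax l). Qed.

Lemma wt_zi a : wt (lshift k a) = 1%N.
Proof. by rewrite /wt split_lshift. Qed.

Lemma wt_ui l : wt (rshift n l) = omega l.
Proof. by rewrite /wt split_rshift. Qed.

Lemma wt_le_maxw j : (wt j <= maxw)%N.
Proof. by elim/ord2_ind: j => [a|l]; rewrite ?wt_zi ?wt_ui ?omega_le_maxw. Qed.

Lemma wt_gt0 j : (0 < wt j)%N.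
Proof. by elim/ord2_ind: j => [a|l]; rewrite ?wt_zi ?wt_ui // ltnW. Qed.

Lemma wtPhi_le_maxw (i : 'I_(n + n + k)) : (wtPhi omega i <= maxw)%N.
Proof. by elim/ord3_ind: i => [a|a|l]; rewrite wtPhiE ?omega_le_maxw. Qed.

Definition dil (lam : R) (Z : 'I_(n + k) -> C) : 'I_(n + k) -> C :=
  fun j => (lam ^+ wt j)%:C * Z j.

Lemma Phi_args_dil lam Z (i : 'I_(n + n + k)) :
  Phi_args (dil lam Z) i = lam%:C ^+ wtPhi omega i * Phi_args Z i.
Proof.
rewrite !Phi_args_pt; elim/ord3_ind: i => [a|a|l]; rewrite /pt !triE wtPhiE /dil.
- by rewrite wt_zi rmorphXn.
- rewrite wt_zi !expr1; apply: (etrans (rmorphM (@ccj R) _ _)).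
  by congr (_ * _); exact: conjc_real.
- rewrite wt_ui -rmorphXn -rmorphM; congr (_%:C).
  by case: (Z _) => x y /=; rewrite mul0r subr0.
Qed.

Lemma meval_dil lam Z (p : {mpoly C[n + n + k]}) w d :
  (forall a, p@_a != 0 -> (mon_weight (wtPhi omega) a + w)%N = d) ->
  lam%:C ^+ w * p.@[Phi_args (dil lam Z)] = lam%:C ^+ d * p.@[Phi_args Z].
Proof.
move=> hp; rewrite -(meval_dilate _ _ hp); congr (_ * _).
by apply: meval_eq => i; rewrite Phi_args_dil.
Qed.

Lemma graph_dil lam Z : graph Phi Z -> graph Phi (dil lam Z).
Proof.
move=> gZ l; have := @meval_dil lam Z (Phi l) 0%N (omega l).
rewrite expr0 mul1r => -> => [|a]; last by rewrite addn0; apply: hhom.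
rewrite -(gZ l) /dil wt_ui -rmorphXn -rmorphM; congr (_%:C).
by case: (Z _) => x y /=; rewrite mul0r addr0.
Qed.

Lemma Phi_args0 (i : 'I_(n + n + k)) : Phi_args (fun _ : 'I_(n + k) => 0 : C) i = 0.
Proof.
by rewrite Phi_args_pt; elim/ord3_ind: i => [a|a|l]; rewrite /pt triE // conjc0.
Qed.

Lemma graph0 : graph Phi (fun=> 0).
Proof.
by move=> l; rewrite meval_fun0 ?(Phi_coef0 homega1 hhom) //; exact: Phi_args0.
Qed.

Lemma dPhi_argsE (a b : 'I_(n + k) -> C) i : dPhi_args a b i =
  tri (fun c => a (lshift k c)) (fun c => b (lshift k c))
    (fun l => (a (rshift n l) + b (rshift n l)) / 2) i.
Proof. by []. Qed.

Lemma dPhi_args_scale (c : 'I_(n + k) -> C) (f : 'I_(n + n + k) -> C)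
    (a b : 'I_(n + k) -> C) i :
  (forall j, f (zi k j) = c (lshift k j)) -> (forall j, f (ci k j) = c (lshift k j)) ->
  (forall l, f (ui n l) = c (rshift n l)) ->
  dPhi_args (fun j => c j * a j) (fun j => c j * b j) i = f i * dPhi_args a b i.
Proof.
move=> fz fc fu; rewrite !dPhi_argsE; elim/ord3_ind: i => [j|j|l]; rewrite !triE.
- by rewrite fz.
- by rewrite fc.
- by rewrite fu -mulrDr mulrA.
Qed.

Lemma ctangentZ (c : C) Z (a b : 'I_(n + k) -> C) :
  ctangent Phi Z a b -> ctangent Phi Z (fun j => c * a j) (fun j => c * b j).
Proof.
move=> h l; rewrite -mulrBr -mulrA h mulr_sumr; apply: eq_bigr => i _.
by rewrite (@dPhi_args_scale (fun=> c) (fun=> c)) // mulrCA.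
Qed.

(** The inverse dilation multiplies the component [j] by [lam^(- wt j)]; the common factor
    [lam^maxw] keeps the exponents natural. *)
Lemma ctangent_dil lam Z (a b : 'I_(n + k) -> C) : lam != 0 ->
  ctangent Phi (dil lam Z) a b ->
  ctangent Phi Z (fun j => (lam ^+ (maxw - wt j))%:C * a j)
    (fun j => (lam ^+ (maxw - wt j))%:C * b j).
Proof.
move=> lam0 h l; rewrite wt_ui -mulrBr -mulrA h mulr_sumr; apply: eq_bigr => i _.
have -> : dPhi_args (fun j => (lam ^+ (maxw - wt j))%:C * a j)
    (fun j => (lam ^+ (maxw - wt j))%:C * b j) i =
    (lam ^+ (maxw - wtPhi omega i))%:C * dPhi_args a b i.
  apply: (@dPhi_args_scale (fun j => (lam ^+ (maxw - wt j))%:C)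
    (fun i => (lam ^+ (maxw - wtPhi omega i))%:C)) => j.
  - by rewrite wtPhi_zi wt_zi.
  - by rewrite wtPhi_ci wt_zi.
  - by rewrite wtPhi_ui wt_ui.
have h1 : lam%:C ^+ wtPhi omega i * ((Phi l)^`M(i)).@[Phi_args (dil lam Z)] =
    lam%:C ^+ omega l * ((Phi l)^`M(i)).@[Phi_args Z].
  apply: meval_dil => c; rewrite mcoeff_deriv => ne.
  rewrite -(@hhom l (c + U_(i))%MM) ?mon_weightD ?mon_weightU //.
  by apply: contraNneq ne => ->; rewrite mul0rn.
have e1 : lam%:C ^+ maxw = lam%:C ^+ wtPhi omega i * (lam ^+ (maxw - wtPhi omega i))%:C.
  by rewrite rmorphXn -exprD subnKC ?wtPhi_le_maxw.
have e2 : lam%:C ^+ maxw = lam%:C ^+ omega l * (lam ^+ (maxw - omega l))%:C.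
  by rewrite rmorphXn -exprD subnKC ?omega_le_maxw.
have l0 : lam%:C != 0 by rewrite (inj_eq (@complexI R)).
rewrite !mulrA; congr (_ * _); apply: (mulfI (expf_neq0 (wtPhi omega i) l0)).
apply: (mulfI (expf_neq0 (omega l) l0)).
move: e1 e2 h1; set x := lam%:C ^+ _; set u := (lam ^+ _)%:C; set v := (lam ^+ _)%:C.
set p := lam%:C ^+ _; set q := lam%:C ^+ _; set r := _.@[_]; set t := _.@[_] => e1 e2 h1.
transitivity (x * (p * r)); first by rewrite e2; ring.
rewrite h1 e1; ring.
Qed.

Lemma ctangent_asym Z (a b : R -> 'I_(n + k) -> C) (al be : 'I_(n + k) -> nat -> C) l0 :
  (forall j, asym (fun lam => a lam j) (al j)) ->
  (forall j, asym (fun lam => b lam j) (be j)) -> 0 < l0 ->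
  (forall lam, 0 < lam < l0 -> ctangent Phi Z (a lam) (b lam)) ->
  forall e, ctangent Phi Z (fun j => al j e) (fun j => be j e).
Proof.
move=> ha hb l00 h e l.
have hd i : asym (fun lam => dPhi_args (a lam) (b lam) i)
    (fun e => dPhi_args (fun j => al j e) (fun j => be j e) i).
  elim/ord3_ind: i => [j|j|m].
  - by apply: asym_ext (ha (lshift k j)) => ?; rewrite dPhi_argsE triE.
  - by apply: asym_ext (hb (lshift k j)) => ?; rewrite dPhi_argsE triE.
  - apply: asym_ext (asymZ 2^-1 (asymD (ha (rshift n m)) (hb (rshift n m)))) => ?;
      by rewrite dPhi_argsE triE mulrC.
have := asymD (asymZ (2 * 'i)^-1 (asymD (ha (rshift n l)) (asymZ (-1) (hb (rshift n l)))))
  (asymZ (-1) (asym_sum (index_enum ('I_(n + n + k) : finType))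
    (fun i => asymZ (Phi l)^`M(i).@[Phi_args Z] (hd i)))).
move=> /asym_eq0 /(_ l00) H.
have {}H : forall e, (2 * 'i)^-1 * (al (rshift n l) e + -1 * be (rshift n l) e) +
    -1 * \sum_i (Phi l)^`M(i).@[Phi_args Z] *
      dPhi_args (fun j => al j e) (fun j => be j e) i = 0.
  by apply: H => lam /h/(_ l) E; rewrite !mulN1r mulrC E subrr.
by have /eqP := H e; rewrite !mulN1r subr_eq0 mulrC => /eqP.
Qed.

Lemma dil_small Z eps : 0 < eps -> exists r : R, [/\ 0 < r, r < 1 &
  forall lam, 0 < lam <= 1 -> polydisc (fun=> 0) eps (dil lam (dil r Z))].
Proof.
move=> eps0; pose M := \sum_j Normc.normc (Z j).
have M0 : 0 <= M by apply: sumr_ge0 => j _; apply: nrm_ge0.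
have M1 : 0 < M + 1 by rewrite ltr_wpDl.
pose r := Num.min (2^-1) (eps / (M + 1) / 2).
have r0 : 0 < r by rewrite lt_min invr_gt0 !divr_gt0 ?ltr0n.
have r1 : r < 1.
  by apply: le_lt_trans (_ : 2^-1 < 1); [rewrite ge_min lexx|rewrite invf_lt1 ?ltr1n].
exists r; split=> // lam /andP[lam0 lam1] j; rewrite subr0 /dil mulrA -rmorphM -exprMn.
rewrite Normc.normcM nrm_real ger0_norm; last by rewrite exprn_ge0 // mulr_ge0 // ltW.
have le1 : (lam * r) ^+ wt j <= r.
  have lr0 : 0 <= lam * r by rewrite mulr_ge0 ?ltW.
  have lr : lam * r <= r by rewrite ler_piMl // ltW.
  apply: le_trans lr; rewrite -[leRHS]expr1; apply: ler_wiXn2l => //.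
    by rewrite mulr_ile1 // ltW.
  exact: wt_gt0.
have ZM : Normc.normc (Z j) <= M.
  by rewrite /M (bigD1 j) //= lerDl; apply: sumr_ge0 => i _; apply: nrm_ge0.
apply: le_lt_trans (_ : r * M < eps).
  by apply: ler_pM => //; rewrite ?nrm_ge0 // exprn_ge0 // mulr_ge0 ?ltW.
apply: le_lt_trans (_ : eps / (M + 1) / 2 * (M + 1) < eps).
  apply: ler_pM => //; first exact: ltW.
    by rewrite ge_min lexx orbT.
  by rewrite lerDl.
have -> : eps / (M + 1) / 2 * (M + 1) = eps / 2 by field; rewrite gt_eqF.
by rewrite ltr_pdivrMr // ltr_pMr // ltr1n.
Qed.

(** Near the origin, the pullbacks by dilations are tangent at a fixed point, a linear condition
    that passes to each coefficient in [lam]. Homogeneity of the coefficients then carries it to all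
    of [M]. The pair [(f, g)] is general so as to cover automorphisms and the fields of finite type
    alike. *)
Lemma homogeneous_tangent (f g : ('I_(n + k) -> C) -> 'I_(n + k) -> C)
    (F G : nat -> 'I_(n + k) -> ('I_(n + k) -> C) -> C) (eps : R) : 0 < eps ->
  (forall Z j, polydisc (fun=> 0) eps Z ->
     asym (fun lam => f (dil lam Z) j) (fun e => F e j Z) /\
     asym (fun lam => g (dil lam Z) j) (fun e => G e j Z)) ->
  (forall Z, polydisc (fun=> 0) eps Z -> graph Phi Z -> ctangent Phi Z (f Z) (g Z)) ->
  (forall e j r Z, F e j (dil r Z) = (r ^+ e)%:C * F e j Z /\
     G e j (dil r Z) = (r ^+ e)%:C * G e j Z) ->
  forall Z s, graph Phi Z ->
    ctangent Phi Z (fun j => shift (maxw - wt j) (fun e => F e j Z) s)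
      (fun j => shift (maxw - wt j) (fun e => G e j Z) s).
Proof.
move=> eps0 hfg tan hom Z s gZ; have [r [r0 r1 hr]] := dil_small Z eps0.
pose Z' := dil r Z.
have Z'p : polydisc (fun=> 0) eps Z'.
  have := hr 1; rewrite ltr01 lexx => /(_ isT).
  by rewrite (_ : dil 1 _ = Z') //; apply/funext => j; rewrite /dil expr1n mul1r.
have T : ctangent Phi Z' (fun j => shift (maxw - wt j) (fun e => F e j Z') s)
    (fun j => shift (maxw - wt j) (fun e => G e j Z') s).
  move: s; apply: (@ctangent_asym Z'
    (fun lam j => (lam ^+ (maxw - wt j))%:C * f (dil lam Z') j)
    (fun lam j => (lam ^+ (maxw - wt j))%:C * g (dil lam Z') j)
    (fun j => shift (maxw - wt j) (fun e => F e j Z'))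
    (fun j => shift (maxw - wt j) (fun e => G e j Z')) 1) => [j|j||lam /andP[l0 l1]].
  - by apply: asym_shift; apply: (hfg _ _ Z'p).1.
  - by apply: asym_shift; apply: (hfg _ _ Z'p).2.
  - exact: ltr01.
  - apply: ctangent_dil; first by rewrite gt_eqF.
    by apply: tan; [apply: hr; rewrite l0 ltW|apply/graph_dil/graph_dil].
(* Back from [Z' = dil r Z] to [Z]: by homogeneity all components pick up the same factor [r^s]. *)
have rn0 : r != 0 by rewrite gt_eqF.
have := ctangentZ (r ^+ s)%:C^-1 (ctangent_dil rn0 T).
have E (H : nat -> 'I_(n + k) -> ('I_(n + k) -> C) -> C) j :
    (forall e, H e j (dil r Z) = (r ^+ e)%:C * H e j Z) ->
    (r ^+ s)%:C^-1 * ((r ^+ (maxw - wt j))%:C * shift (maxw - wt j) (fun e => H e j Z') s)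
    = shift (maxw - wt j) (fun e => H e j Z) s.
  move=> hH; rewrite /shift; case: ifP => [le|_]; last by rewrite !mulr0.
  rewrite hH [in X in _ * X]mulrA -rmorphM -exprD subnKC // mulrA mulVf ?mul1r //.
  by rewrite (inj_eq (@complexI R)) expf_neq0.
under [X in ctangent _ _ X]eq_fun => j do rewrite (E F j (fun e => (hom e j r Z).1)).
by under [X in ctangent _ _ _ X]eq_fun => j do rewrite (E G j (fun e => (hom e j r Z).2)).
Qed.

End Dilations.

(** * Polynomiality of the automorphisms *)

Section HomogeneousComponents.
Variables (R : realType) (M : nat) (c : 'I_M -> nat) (mu : nat).
Hypothesis c_gt0 : forall j, (0 < c j)%N.
Hypothesis c_le : forall j, (c j <= mu)%N.
Implicit Types X : vf R M.

(* The component of weight [s - mu] of the vector field [X]. *)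
Definition vcomp (X : vf R M) (s : nat) (j : 'I_M) : {mpoly R[i][M]} :=
  if (mu - c j <= s)%N then hcomp c (s - (mu - c j)) (X j) else 0.

Lemma mcoeff_vcomp X s j a :
  (vcomp X s j)@_a = if (mon_weight c a + mu == s + c j)%N then X j a else 0.
Proof.
have cj := c_le j; rewrite /vcomp; case: ifP => [le|/negbT].
  rewrite mcoeff_hcomp //; congr (if _ then _ else _).
  by apply/eqP/eqP; lia.
rewrite -ltnNge => lt; rewrite mcoeff0; case: eqP => // E; lia.
Qed.

Lemma meval_vcomp X s j x :
  (vcomp X s j).@[x] = shift (mu - c j) (fun e => (hcomp c e (X j)).@[x]) s.
Proof. by rewrite /vcomp /shift; case: ifP => // _; rewrite meval0. Qed.

Lemma meval_hcomp_dil e (f : ps R M) (r : R) x :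
  (hcomp c e f).@[fun i => (r ^+ c i)%:C * x i] = (r ^+ e)%:C * (hcomp c e f).@[x].
Proof.
rewrite rmorphXn -(@meval_dilate _ _ c 0%N e) ?expr0 ?mul1r => [|a]; last first.
  by rewrite mcoeff_hcomp // addn0; case: (_ =P e) => [//|_]; rewrite eqxx.
by apply: meval_eq => i; rewrite rmorphXn.
Qed.

End HomogeneousComponents.

Section SeriesOfPolynomials.
Variables (R : realType) (m : nat).
Local Notation C := R[i].

Lemma ps_mul_of (p q : {mpoly C[m]}) : ps_mul (ps_of p) (ps_of q) = ps_of (p * q).
Proof.
apply/funext => a; rewrite /ps_mul /ps_of.
exact/esym/(mcoeff_poly_mul_lin p q (ltnSn _)).
Qed.

Lemma ps_deriv_of i (p : {mpoly C[m]}) : ps_deriv i (ps_of p) = ps_of p^`M(i).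
Proof. by apply/funext => a; rewrite /ps_deriv /ps_of mcoeff_deriv. Qed.

Lemma vf_bracketE (X Y : vf R m) j a : vf_bracket X Y j a =
  \sum_(i < m) (ps_mul (X i) (ps_deriv i (Y j)) a - ps_mul (Y i) (ps_deriv i (X j)) a).
Proof. by rewrite /vf_bracket fct_sumE. Qed.

Definition vf_of (Q : 'I_m -> {mpoly C[m]}) : vf R m := fun j => ps_of (Q j).

Lemma vf_bracket_of Q Q' : vf_bracket (vf_of Q) (vf_of Q') = vf_of (vbr Q Q').
Proof.
apply/funext => j; apply/funext => a; rewrite vf_bracketE /vf_of /vbr /vder.
rewrite /ps_of -sumrB raddf_sum; apply: eq_bigr => i _.
by rewrite !ps_deriv_of !ps_mul_of /= mcoeffB.
Qed.

Lemma ps_mul_congr (f f' g g' : ps R m) a :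
  (forall b, (mdeg b <= mdeg a)%N -> f b = f' b) ->
  (forall b, (mdeg b <= mdeg a)%N -> g b = g' b) -> ps_mul f g a = ps_mul f' g' a.
Proof.
move=> ff gg; apply: eq_bigr => b ba; rewrite ff ?gg //; first exact: mdegB.
by rewrite -ltnS bmdeg.
Qed.

Lemma vf_bracket_congr (X X' Y Y' : vf R m) (D : nat) :
  (forall j a, (mdeg a <= D.+1)%N -> X j a = X' j a) ->
  (forall j a, (mdeg a <= D.+1)%N -> Y j a = Y' j a) ->
  forall j a, (mdeg a <= D)%N -> vf_bracket X Y j a = vf_bracket X' Y' j a.
Proof.
move=> XX YY j a aD; rewrite !vf_bracketE; apply: eq_bigr => i _; congr (_ - _);
  apply: ps_mul_congr => b ba.
- by rewrite XX // (leq_trans ba) // ltnW.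
- by rewrite /ps_deriv YY // mdegD mdeg1 addn1 ltnS (leq_trans ba).
- by rewrite YY // (leq_trans ba) // ltnW.
- by rewrite /ps_deriv XX // mdegD mdeg1 addn1 ltnS (leq_trans ba).
Qed.

Lemma vf_of_inj Q Q' : vf_of Q = vf_of Q' -> Q = Q'.
Proof.
move=> E; apply/funext => j; apply/mpolyP => a.
exact: (congr1 (fun X : vf R m => X j a) E).
Qed.

Lemma vf_ofD Q Q' : vf_of Q + vf_of Q' = vf_of (fun j => Q j + Q' j).
Proof. by apply/funext => j; apply/funext => a; rewrite /vf_of /ps_of mcoeffD. Qed.

Lemma vf_ofZ c Q : c *: vf_of Q = vf_of (fun j => c *: Q j).
Proof. by apply/funext => j; apply/funext => a; rewrite /vf_of /ps_of mcoeffZ. Qed.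

Lemma vf_of0 : vf_of (fun=> 0) = 0.
Proof. by apply/funext => j; apply/funext => a; rewrite /vf_of /ps_of mcoeff0. Qed.

End SeriesOfPolynomials.

Section Automorphisms.
Variables (R : realType) (n k : nat) (omega : 'I_k -> nat).
Local Notation C := R[i].
Local Notation ii := ('i%C : C).
Variable Phi : 'I_k -> {mpoly R[i][n + n + k]}.
Hypothesis hhom : forall l a, (Phi l)@_a != 0 ->
  mon_weight (wtPhi omega) a = omega l.
Hypothesis homega1 : forall l, (1 < omega l)%N.
Hypothesis hreal : forall l, real_valued (Phi l).
Local Notation wt := (@wt n k omega).
Local Notation maxw := (maxw omega).
Local Notation hol := (hol ii Phi).
Local Notation aho := (aho ii Phi).
Local Notation ptan := (ptan ii Phi).
Local Notation iota := (iota ii Phi).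
Local Notation cj := (cj (@ccj R)).
Local Notation A := {mpoly C[n + n + k]}.
Implicit Types (X : vf R (n + k)) (Q : 'I_(n + k) -> {mpoly C[n + k]}).

Lemma polydisc_le m (p : 'I_m -> C) e e' x : e <= e' -> polydisc p e x -> polydisc p e' x.
Proof. by move=> ee h i; apply: lt_le_trans (h i) ee. Qed.

Lemma vf_convergent_uniform m (X : vf R m) : vf_convergent X -> exists2 eps : R,
  0 < eps & forall x, polydisc (fun=> 0) eps x -> forall j, ps_summable (X j) x.
Proof.
move=> hX.
have H j : exists e : R, 0 < e /\
    forall x, polydisc (fun=> 0) e x -> ps_summable (X j) x.
  by have [e e0 h] := hX j; exists e.
have [e he] := choice H.
exists (\big[Num.min/1]_j e j).
  apply: (big_ind (fun e => 0 < e)) => // [a b a0 b0|j _]; last by have [] := he j.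
  by rewrite lt_min a0.
move=> x hx j; apply: (he j).2; apply: polydisc_le hx.
by rewrite (bigD1 j) //= ge_min lexx.
Qed.

Lemma hvf_at_of Q Z : hvf_at (vf_of Q) (fun=> 0) Z = fun j => (Q j).@[Z].
Proof.
apply/funext => j; rewrite /hvf_at /vf_of ps_eval_of.
by apply: meval_eq => i; rewrite subr0.
Qed.

Lemma ptan_iotaP Q : ptan (iota Q) (cj \o iota Q) <-> forall Z, graph Phi Z ->
  ctangent Phi Z (fun j => (Q j).@[Z]) (fun j => conjc (Q j).@[Z]).
Proof.
rewrite (ptan_ctangent hreal); split=> h Z gZ; have := h Z gZ.
  under [X in ctangent _ _ X]eq_fun => j do rewrite (meval_iota _ _ gZ).
  by under [X in ctangent _ _ _ X]eq_fun => j do rewrite /= (meval_cj_iota _ _ gZ).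
under [X in _ -> ctangent _ _ X _]eq_fun => j do rewrite (meval_iota _ _ gZ).
by under [X in _ -> ctangent _ _ _ X]eq_fun => j do rewrite /= (meval_cj_iota _ _ gZ).
Qed.

Lemma conjc_half (x : C) : conjc (x / 2) = conjc x / 2.
Proof.
apply: (etrans (rmorphM (@ccj R) _ _)); congr (_ * _).
by rewrite fmorphV rmorph_nat.
Qed.

Lemma aut_CR_of Q : ptan (iota Q) (cj \o iota Q) -> aut_CR Phi (vf_of Q).
Proof.
move=> /ptan_iotaP h; split; first by move=> j; apply: ps_convergent_of.
exists 1 => // Z _ gZ; rewrite /rtangent /vconj hvf_at_of.
have := ctangentZ 2^-1 (h Z gZ).
under [X in ctangent _ _ X _]eq_fun => j do rewrite mulrC.
under [X in ctangent _ _ _ X]eq_fun => j do rewrite mulrC -conjc_half.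
by [].
Qed.

Lemma aut_CR_vcomp X s : aut_CR Phi X ->
  ptan (iota (vcomp wt maxw X s)) (cj \o iota (vcomp wt maxw X s)).
Proof.
move=> [/vf_convergent_uniform[e1 e10 conv] [e2 e20 tan]]; apply/ptan_iotaP => Z gZ.
pose f Z j := hvf_at X (fun=> 0) Z j / 2; pose g Z j := conjc (f Z j).
pose F e j Z : C := (hcomp wt e (X j)).@[Z] / 2; pose G e j Z := conjc (F e j Z).
have T := @homogeneous_tangent R n k omega Phi hhom homega1 f g F G (Num.min e1 e2).
have {}T : ctangent Phi Z (fun j => shift (maxw - wt j) (fun e => F e j Z) s)
    (fun j => shift (maxw - wt j) (fun e => G e j Z) s).
  apply: T => //; first by rewrite lt_min e10.
  - move=> Z' j hZ'.
    have as1 : asym (fun lam => f (dil omega lam Z') j) (fun e => F e j Z').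
      have h := conv Z' (polydisc_le _ hZ') j.
      have {}h := h (ltac:(by rewrite ge_min lexx)).
      apply: asym_ext (asymZ 2^-1 (asym_ps_eval (wt_gt0 homega1) h)) => [lam|e].
        rewrite /f /hvf_at mulrC; congr (_ * ps_eval _ _).
        by apply/funext => i; rewrite subr0.
      by rewrite /F mulrC.
    by split=> //; apply: asym_conj.
  - move=> Z' hZ'; apply: tan; apply: polydisc_le hZ'.
    by rewrite ge_min lexx orbT.
  move=> e j r Z'; have E : F e j (dil omega r Z') = (r ^+ e)%:C * F e j Z'.
    by rewrite /F /dil meval_hcomp_dil ?mulrA // => i; apply: wt_gt0.
  split=> //; rewrite /G E; apply: (etrans (rmorphM (@ccj R) _ _)).
  by congr (_ * _); exact: conjc_real.
have := ctangentZ 2 T.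
have E1 j : 2 * shift (maxw - wt j) (fun e => F e j Z) s = (vcomp wt maxw X s j).@[Z].
  rewrite meval_vcomp /shift; case: ifP => _; last by rewrite mulr0.
  by rewrite /F mulrC divfK // two_neq0.
under [X in ctangent _ _ X _]eq_fun => j do rewrite E1.
have E2 j : 2 * shift (maxw - wt j) (fun e => G e j Z) s =
    conjc (vcomp wt maxw X s j).@[Z].
  rewrite -E1 /shift; case: ifP => _; last by rewrite !mulr0 conjc0.
  rewrite /G; apply/esym; apply: (etrans (rmorphM (@ccj R) _ _)).
  by congr (_ * _); rewrite rmorph_nat.
by under [X in ctangent _ _ _ X]eq_fun => j do rewrite E2.
Qed.

Variable r : nat.
Hypothesis det : forall Q, ptan (iota Q) (cj \o iota Q) ->
  (forall j, ordge r (Q j)) -> forall j, Q j = 0.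

(** From this index on, the coefficient monomials of a component have weight at least [maxw * r],
    hence degree at least [r], and [det] applies. *)
Definition top : nat := (maxw * r + maxw)%N.

Lemma vcomp_top X s : aut_CR Phi X -> (top <= s)%N -> forall j, vcomp wt maxw X s j = 0.
Proof.
move=> aX ts; apply: det; first exact: aut_CR_vcomp.
move=> j a; rewrite mcoeff_vcomp; last first.
- exact: wt_le_maxw.
- exact: wt_gt0.
case: (_ =P (s + _)%N) => [E _|_]; last by rewrite eqxx.
have h := mon_weight_le_mdeg a (wt_le_maxw omega).
have : (maxw * r <= maxw * mdeg a)%N.
  apply: leq_trans h; rewrite -(leq_add2r maxw) E.
  by apply: leq_trans ts _; apply: leq_addr.
by rewrite leq_mul2l /maxw.
Qed.

Lemma aut_CR_coef_top X j a : aut_CR Phi X ->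
  (top + wt j <= mon_weight wt a + maxw)%N -> X j a = 0.
Proof.
move=> aX le; have wj := wt_le_maxw omega j.
pose s := (mon_weight wt a + maxw - wt j)%N.
have ts : (top <= s)%N by rewrite /s; lia.
have := congr1 (mcoeff a) (vcomp_top aX ts j); rewrite mcoeff_vcomp ?mcoeff0.
- by rewrite /s subnK ?eqxx // (leq_trans wj) ?leq_addl.
- exact: wt_gt0.
- exact: wt_le_maxw.
Qed.

(** Each Taylor coefficient belongs to exactly one weighted component, and only those of index below
    [top] survive. *)
Lemma aut_CRP X : aut_CR Phi X <->
  exists Q, X = vf_of Q /\ ptan (iota Q) (cj \o iota Q).
Proof.
split=> [aX|[Q [-> tQ]]]; last exact: aut_CR_of.
exists (fun j => \sum_(s < top) vcomp wt maxw X s j); split; last first.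
  have -> : iota (fun j => \sum_(s < top) vcomp wt maxw X s j) =
      fun j => \sum_(s < top) iota (vcomp wt maxw X s) j.
    by apply/funext => j; apply: rmorph_sum.
  rewrite [X in ptan _ X](_ : _ = fun j => \sum_(s < top) cj (iota (vcomp wt maxw X s) j)).
    by apply: (@ptan_sum _ _ n k Phi _ _ predT) => s _; apply: aut_CR_vcomp.
  by apply/funext => j; apply: (rmorph_sum cj).
apply/funext => j; apply/funext => a; rewrite /vf_of /ps_of raddf_sum /=.
have wj := wt_le_maxw omega j.
under eq_bigr => s _ do rewrite (mcoeff_vcomp (wt_gt0 homega1) (wt_le_maxw omega)).
pose s := (mon_weight wt a + maxw - wt j)%N.
have Es : (s + wt j = mon_weight wt a + maxw)%N.
  by rewrite subnK // (leq_trans wj) ?leq_addl.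
have [st|ts] := ltnP s top.
  rewrite (bigD1 (Ordinal st)) //= Es eqxx big1 ?addr0 // => t ne.
  case: eqP => // E; case/eqP: ne; apply/val_inj => /=.
  by apply/eqP; rewrite -(eqn_add2r (wt j)) Es E.
rewrite (aut_CR_coef_top aX) ?big1 // => [t _|]; last by rewrite -Es leq_add2r.
by case: eqP.
Qed.

End Automorphisms.

(** * From finite type to derivations of [A] spanning at the origin *)

Section FiniteType.

Lemma sum_mulrCDr (K : comNzRingType) (I : finType) (h : K) (c x y : I -> K) :
  \sum_s c s * (h * (x s + y s)) = h * (\sum_s c s * x s + \sum_s c s * y s).
Proof.
by rewrite -big_split mulr_sumr; apply: eq_bigr => s _ /=; rewrite -mulrDr mulrCA.
Qed.

Variables (R : realType) (n k : nat) (omega : 'I_k -> nat).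
Local Notation C := R[i].
Local Notation ii := ('i%C : C).
Variable Phi : 'I_k -> {mpoly R[i][n + n + k]}.
Hypothesis hhom : forall l a, (Phi l)@_a != 0 ->
  mon_weight (wtPhi omega) a = omega l.
Hypothesis homega1 : forall l, (1 < omega l)%N.
Hypothesis hreal : forall l, real_valued (Phi l).
Local Notation N := (n + k)%N.
Local Notation wt := (@wt n k omega).
Local Notation maxw := (maxw omega).
Local Notation hol := (hol ii Phi).
Local Notation aho := (aho ii Phi).
Local Notation ptan := (ptan ii Phi).
Local Notation crder := (crder ii Phi).
Local Notation A := {mpoly C[n + n + k]}.

Definition hola : 'I_(N + N) -> A :=
  fun i => match fintype.split i with inl j => hol j | inr j => aho j end.

Definition wt2 : 'I_(N + N) -> nat :=
  fun i => match fintype.split i with inl j => wt j | inr j => wt j end.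

Lemma wt2_gt0 i : (0 < wt2 i)%N.
Proof. by rewrite /wt2; case: fintype.split => j; apply: wt_gt0. Qed.

Lemma wt2_le i : (wt2 i <= maxw)%N.
Proof. by rewrite /wt2; case: fintype.split => j; apply: wt_le_maxw. Qed.

Lemma meval_hola (P : {mpoly C[N + N]}) Z : graph Phi Z ->
  (psub hola P).@[Phi_args Z] = P.@[with_conj Z].
Proof.
move=> gZ; rewrite meval_psub; apply: meval_eq => i; rewrite /hola /with_conj.
by case: fintype.split => j; [exact: meval_hol|exact: meval_aho].
Qed.

Lemma hola_ordge1 i : ordge 1 (hola i).
Proof.
rewrite /hola; case: fintype.split => j; first exact: (hol_ordge1 homega1 hhom).
rewrite -(cj_hol (@ccj_ii R) (cjPhi_real hreal)); apply: cj_ordge.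
exact: (hol_ordge1 homega1 hhom).
Qed.

Lemma with_conj_dil (lam : R) (Z : 'I_N -> C) (i : 'I_(N + N)) :
  with_conj (dil omega lam Z) i = (lam ^+ wt2 i)%:C * with_conj Z i.
Proof.
rewrite /with_conj /wt2; case: fintype.split => j //.
by apply: (etrans (rmorphM (@ccj R) _ _)); congr (_ * _); exact: conjc_real.
Qed.

Lemma with_conj_norm (Z : 'I_N -> C) eps : polydisc (fun=> 0) eps Z ->
  polydisc (fun=> 0) eps (with_conj Z).
Proof.
move=> h i; rewrite subr0 /with_conj; case: fintype.split => j; rewrite ?nrm_conj;
  by have := h j; rewrite subr0.
Qed.

Lemma tangent_cvf_vcomp (X : vf R (N + N)) s : tangent_cvf Phi (fun=> 0) X ->
  ptan (fun j => psub hola (vcomp wt2 maxw X s (lshift N j)))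
       (fun j => psub hola (vcomp wt2 maxw X s (rshift N j))).
Proof.
move=> [/vf_convergent_uniform[e1 e10 conv] [e2 e20 tan]].
apply/(ptan_ctangent hreal) => Z gZ.
have asx i Z' : polydisc (fun=> 0) (Num.min e1 e2) Z' ->
    asym (fun lam => ps_eval (X i) (with_conj (fun j => dil omega lam Z' j - 0)))
      (fun e => (hcomp wt2 e (X i)).@[with_conj Z']).
  move=> hZ'; have h : ps_summable (X i) (with_conj Z').
    by apply: conv; apply: with_conj_norm; apply: polydisc_le hZ'; rewrite ge_min lexx.
  apply: asym_ext (asym_ps_eval wt2_gt0 h) => [lam|//]; congr (ps_eval _ _).
  apply/funext => j; rewrite -with_conj_dil; congr with_conj.
  by apply/funext => l; rewrite subr0.
have homx i e r Z' : (hcomp wt2 e (X i)).@[with_conj (dil omega r Z')] =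
    (r ^+ e)%:C * (hcomp wt2 e (X i)).@[with_conj Z'].
  rewrite -(meval_hcomp_dil wt2_gt0); apply: meval_eq => j; exact: with_conj_dil.
have := @homogeneous_tangent R n k omega Phi hhom homega1
  (cvf_dZ X (fun=> 0)) (cvf_dZbar X (fun=> 0))
  (fun e j Z' => (hcomp wt2 e (X (lshift N j))).@[with_conj Z'])
  (fun e j Z' => (hcomp wt2 e (X (rshift N j))).@[with_conj Z'])
  (Num.min e1 e2).
rewrite lt_min e10 e20 => /(_ isT) T.
have {}T := T (fun Z' j hZ' => conj (asx _ _ hZ') (asx _ _ hZ')).
have {}T := T (fun Z' hZ' => tan Z' (polydisc_le
  (ltac:(by rewrite ge_min lexx orbT) : Num.min e1 e2 <= e2) hZ')).
have {T} := T (fun e j r Z' => conj (homx _ e r Z') (homx _ e r Z')) Z s gZ.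
have El j : wt2 (lshift N j) = wt j by rewrite /wt2 split_lshift.
have Er j : wt2 (rshift N j) = wt j by rewrite /wt2 split_rshift.
under [X in ctangent _ _ X _]eq_fun => j do rewrite -El -meval_vcomp -meval_hola //.
by under [X in ctangent _ _ _ X]eq_fun => j do rewrite -Er -meval_vcomp -meval_hola //.
Qed.

(** Monomials of degree at most [D] have weight at most [maxw * D], so they lie in components of
    index at most [maxw * D + maxw]. *)
Lemma vcomp_sum (X : vf R (N + N)) (D : nat) i a : (mdeg a <= D)%N ->
  (\sum_(s < (maxw * D + maxw).+1) vcomp wt2 maxw X s i)@_a = X i a.
Proof.
move=> aD; rewrite raddf_sum /=.
under eq_bigr => s _ do rewrite (mcoeff_vcomp wt2_gt0 wt2_le).
have wi := wt2_le i.
have wa : (mon_weight wt2 a <= maxw * D)%N.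
  by apply: leq_trans (mon_weight_le_mdeg a wt2_le) _; rewrite leq_mul2l aD orbT.
pose s := (mon_weight wt2 a + maxw - wt2 i)%N.
have sS : (s < (maxw * D + maxw).+1)%N by rewrite /s ltnS; lia.
have Es : (s + wt2 i = mon_weight wt2 a + maxw)%N.
  by rewrite subnK // (leq_trans wi) ?leq_addl.
rewrite (bigD1 (Ordinal sS)) //= Es eqxx big1 ?addr0 // => t ne.
case: eqP => // E; case/eqP: ne; apply/val_inj => /=.
by apply/eqP; rewrite -(eqn_add2r (wt2 i)) Es E.
Qed.

(* Up to terms of high degree, the generated fields are polynomial fields tangent
   to [M], whose restrictions to [M] lie in the Lie algebra generated by the
   polynomial fields of type (1,0) and (0,1). *)
Lemma cr_generated_approx (X : vf R (N + N)) : cr_generated Phi (fun=> 0) X ->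
  forall D : nat, exists (P : 'I_(N + N) -> {mpoly C[N + N]}) d,
    [/\ lie_closure crder d, forall i, vder d (hola i) = psub hola (P i)
      & forall i a, (mdeg a <= D)%N -> X i a = (P i)@_a].
Proof.
have base X' D : tangent_cvf Phi (fun=> 0) X' ->
    ((forall j, X' (rshift N j) = 0) \/ (forall j, X' (lshift N j) = 0)) ->
    exists (P : 'I_(N + N) -> {mpoly C[N + N]}) d,
    [/\ lie_closure crder d, forall i, vder d (hola i) = psub hola (P i)
      & forall i a, (mdeg a <= D)%N -> X' i a = (P i)@_a].
  move=> tX X0; pose S := (maxw * D + maxw).+1.
  pose P i := \sum_(s < S) vcomp wt2 maxw X' s i.
  pose x j := psub hola (P (lshift N j)); pose y j := psub hola (P (rshift N j)).
  have txy : ptan x y.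
    have -> : x = fun j => \sum_(s < S) psub hola (vcomp wt2 maxw X' s (lshift N j)).
      by apply/funext => j; apply: rmorph_sum.
    have -> : y = fun j => \sum_(s < S) psub hola (vcomp wt2 maxw X' s (rshift N j)).
      by apply/funext => j; apply: rmorph_sum.
    by apply: (@ptan_sum _ _ n k Phi _ _ predT) => s _; apply: tangent_cvf_vcomp.
  have vl j := ptan_hol (@iiN0 R) txy j; have vr j := ptan_aho (@iiN0 R) txy j.
  have P0 i : X' i = 0 -> P i = 0.
    move=> Xi; apply: big1 => s _; apply/mpolyP => a.
    by rewrite (mcoeff_vcomp wt2_gt0 wt2_le) mcoeff0 Xi; case: ifP.
  exists P, (vE x y); split.
  - apply: lie_closure_incl; case: X0 => X0; [right|left] => j.
      by rewrite vr /y P0 ?rmorph0.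
    by rewrite vl /x P0 ?rmorph0.
  - move=> i; rewrite /hola -[i in RHS]splitK; case: fintype.split => j /=.
      exact: vl.
    exact: vr.
  - by move=> i a aD; rewrite vcomp_sum.
elim=> {X} [X tX X0|X tX X0|X Y _ IHX _ IHY] D.
- by apply: base => //; left.
- by apply: base => //; right.
(* The jet of order [D] of a bracket involves jets of order [D + 1]. *)
have [P [d [Ld dP XP]]] := IHX D.+1; have [Q [e [Le eQ YQ]]] := IHY D.+1.
exists (vbr P Q), (vbr d e); split.
- exact: lie_closure_vbr.
- move=> i; rewrite vder_vbr eQ dP (vder_psub_rel _ dP) (vder_psub_rel _ eQ).
  by rewrite -rmorphB.
- move=> i a aD; rewrite -[RHS]/(vf_of (vbr P Q) i a) -vf_bracket_of.
  exact: vf_bracket_congr aD.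
Qed.

Lemma finite_type_spans : finite_type Phi -> spans_at0 (lie_closure crder).
Proof.
move=> hfin i; have g0 := graph0 hhom homega1.
pose E (l : 'I_(n + n + k)) : A := (l == i)%:R.
have args0 := @Phi_args0 R n k.
have := ptan_vder (@iiN0 R) Phi E; rewrite (ptan_ctangent hreal) => /(_ _ g0) t0.
have [r [c [X [gX ax bx]]]] := hfin _ g0 _ _ t0.
(* Spanning concerns only values at the origin, so agreement in degree [0] suffices. *)
have [P hP] := choice (fun s => cr_generated_approx (gX s) 0).
have [d hd] := choice hP; exists r, c, d; split=> [s|l]; first by case: (hd s).
have val0 s j : (vder (d s) (hola j))@_0%MM = X s j 0%MM.
  have [_ -> XP] := hd s; rewrite XP ?mdeg0 //.
  rewrite -(@meval_fun0 _ _ _ (fun=> 0)) // meval_psub meval_fun0 // => j'.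
  by rewrite meval_fun0 //; apply/ordge1/hola_ordge1.
have wc0 : with_conj (fun i : 'I_N => (0 : C) - 0) = fun=> 0.
  apply/funext => j; rewrite /with_conj; case: fintype.split => j'; rewrite subr0 //.
  exact: conjc0.
have holv j : \sum_s c s * (vder (d s) (hol j))@_0%MM = (vder E (hol j))@_0%MM.
  have := ax j; rewrite meval_fun0 // => ->; apply: eq_bigr => s _; congr (_ * _).
  have := val0 s (lshift N j); rewrite /hola split_lshift => ->.
  by rewrite /cvf_dZ wc0 ps_eval0.
have ahov j : \sum_s c s * (vder (d s) (aho j))@_0%MM = (vder E (aho j))@_0%MM.
  have := bx j; rewrite meval_fun0 // => ->; apply: eq_bigr => s _; congr (_ * _).
  have := val0 s (rshift N j); rewrite /hola split_rshift => ->.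
  by rewrite /cvf_dZbar wc0 ps_eval0.
transitivity (E l)@_0%MM; last first.
  by rewrite /E eq_sym -mpolyC_nat mcoeffC eqxx mulr1.
have eqE (e : 'I_(n + n + k) -> A) : e l = vE (fun j => vder e (hol j)) (fun j => vder e (aho j)) l.
  by rewrite vE_vder.
rewrite eqE; under eq_bigr => s _ do rewrite eqE.
elim/ord3_ind: l {eqE} => [a|a|l]; rewrite /vE triE.
- by rewrite -holv; apply: eq_bigr => s _; rewrite triE.
- by rewrite -ahov; apply: eq_bigr => s _; rewrite triE.
- have hl := holv (rshift n l); have al := ahov (rshift n l).
  rewrite mcoeffZ mcoeffD -[X in _ * (X + _)]hl -[X in _ * (_ + X)]al.
  apply: etrans (sum_mulrCDr _ _ _ _); apply: eq_bigr => s _.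
  by rewrite triE mcoeffZ mcoeffD.
Qed.

End FiniteType.

(** * The grading *)

Section LinearCombinations.
Variables (C : numFieldType) (ii : C) (n k : nat) (cc : {rmorphism C -> C}).
Variable Phi : 'I_k -> {mpoly C[n + n + k]}.
Local Notation ptan := (ptan ii Phi).
Local Notation iota := (iota ii Phi).
Local Notation cj := (@cj C n k cc).
Implicit Types Q : 'I_(n + k) -> {mpoly C[n + k]}.

Lemma ptan_iota_lin c Q Q' : cc c = c ->
  ptan (iota Q) (cj \o iota Q) -> ptan (iota Q') (cj \o iota Q') ->
  ptan (iota (fun j => c *: Q j + Q' j)) (cj \o iota (fun j => c *: Q j + Q' j)).
Proof.
move=> hc h h'; have H := ptanD (ptanZ c h) h'.
have E j : iota (fun j => c *: Q j + Q' j) j = c *: iota Q j + iota Q' j.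
  by rewrite /iota rmorphD /= psubZ.
rewrite (_ : iota _ = fun j => c *: iota Q j + iota Q' j); last exact/funext.
rewrite (_ : cj \o _ = fun j => c *: (cj \o iota Q) j + (cj \o iota Q') j) //.
by apply/funext => j; rewrite /= rmorphD /= cjZ hc.
Qed.

Lemma ptan_iota0 : ptan (iota (fun=> 0)) (cj \o iota (fun=> 0)).
Proof.
rewrite (_ : iota _ = fun=> 0); last by apply/funext => j; apply: rmorph0.
rewrite (_ : cj \o _ = fun=> 0); last by apply/funext => j; apply: (rmorph0 cj).
by apply/ptanE => l; rewrite !big1 // => j _; rewrite mul0r.
Qed.

End LinearCombinations.

Section Brackets.
Variables (R : realType) (n k : nat) (omega : 'I_k -> nat).
Local Notation wt := (@wt n k omega).
Implicit Types X Y : vf R (n + k).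

Lemma ps_mul_deriv_weight X Y s t i j a :
  vf_weighted_homogeneous omega s X -> vf_weighted_homogeneous omega t Y ->
  ps_mul (X i) (ps_deriv i (Y j)) a != 0 ->
  (mon_weight wt a)%:Z - (wt j)%:Z = s + t.
Proof.
move=> hX hY; apply: contra_neq_eq => ne; apply: big1 => b ba.
have [->|/hX Eb] := eqVneq (X i b) 0; first by rewrite mul0r.
rewrite /ps_deriv.
have [->|/hY Ec] := eqVneq (Y j (a - b + U_(i))%MM) 0; first by rewrite mul0rn mulr0.
have Ea : mon_weight wt a = (mon_weight wt b + mon_weight wt (a - b)%MM)%N.
  by rewrite -mon_weightD addmC submK.
move: ne Eb Ec; rewrite Ea mon_weightD mon_weightU => /eqP ne Eb Ec; case: ne.
by rewrite -Eb -Ec !PoszD; ring.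
Qed.

Lemma vf_bracket_weight X Y s t :
  vf_weighted_homogeneous omega s X -> vf_weighted_homogeneous omega t Y ->
  vf_weighted_homogeneous omega (s + t) (vf_bracket X Y).
Proof.
move=> hX hY j a; rewrite vf_bracketE => ne.
have [i hi] : exists i, ps_mul (X i) (ps_deriv i (Y j)) a != 0 \/
    ps_mul (Y i) (ps_deriv i (X j)) a != 0.
  apply: contrapT => /forallNP h; case/eqP: ne; apply: big1 => i _.
  have /not_orP[/negP/negPn/eqP -> /negP/negPn/eqP ->] := h i.
  by rewrite subrr.
case: hi; first exact: (ps_mul_deriv_weight hX hY).
by rewrite [RHS]addrC; apply: (ps_mul_deriv_weight hY hX).
Qed.

End Brackets.

Section Generic.
Variables (R : realType) (n k : nat) (omega : 'I_k -> nat).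
Local Notation C := R[i].
Local Notation ii := ('i%C : C).
Variable Phi : 'I_k -> {mpoly R[i][n + n + k]}.
Hypothesis hhom : forall l a, (Phi l)@_a != 0 ->
  mon_weight (wtPhi omega) a = omega l.
Hypothesis homega1 : forall l, (1 < omega l)%N.

(** As [omega l > 1], the linear part of [Phi l] involves only [u]; so at the origin the imaginary
    parts of the [w]-components are given by their real parts. *)
Lemma rtangent0_w (a : 'I_(n + k) -> C) : rtangent Phi (fun=> 0) a -> forall l,
  a (rshift n l) = \sum_m Bmx ii Phi l m * (complex.Re (a (rshift n m)))%:C.
Proof.
move=> h l; have {}h := h l.
have E i : (Phi l)^`M(i).@[Phi_args (fun=> 0)] = (Phi l)@_U_(i).
  by rewrite meval_fun0 ?mcoeff0_mderiv // => j; apply: Phi_args0.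
have lhs : (a (rshift n l) - vconj a (rshift n l)) / (2 * 'i) =
    (complex.Im (a (rshift n l)))%:C.
  have key (x : C) : 2%:R * x * ii / (2 * ii) = x.
    by rewrite (mulrC 2%:R) -[x * _ * ii]mulrA mulfK // mulf_neq0 ?two_neq0 // iiN0.
  by rewrite /vconj subcJ; apply: key.
rewrite lhs sum_ord3 in h.
rewrite [X in _ = X + _ + _]big1 ?add0r in h; last first.
  move=> b _; rewrite E (Phi_coefU hhom) ?mul0r // wtPhi_zi.
  by rewrite neq_ltn homega1.
rewrite [X in _ = X + _]big1 ?add0r in h; last first.
  move=> b _; rewrite E (Phi_coefU hhom) ?mul0r // wtPhi_ci.
  by rewrite neq_ltn homega1.
rewrite [LHS]complexE h mulr_sumr.
transitivity (\sum_m (l == m)%:R * (complex.Re (a (rshift n m)))%:C +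
  \sum_m ii * (Phi l)@_U_(ui n m) * (complex.Re (a (rshift n m)))%:C).
  congr (_ + _).
    rewrite (bigD1 l) //= eqxx mul1r big1 ?addr0 // => m ne.
    by rewrite eq_sym (negPf ne) mul0r.
  apply: eq_bigr => m _; rewrite E -mulrA; congr (_ * (_ * _)).
  rewrite dPhi_argsE triE /vconj addcJ mulrAC divff ?mul1r //.
  exact: two_neq0.
by rewrite -big_split; apply: eq_bigr => m _; rewrite mxE mulrDl.
Qed.

(** Genericity at the origin writes each basis vector in [w] as [a + i b] with [a], [b] tangent,
    hence as the image under [Bmx] of a complex vector. *)
Lemma cr_generic_Bmx_unit : cr_generic Phi -> Bmx ii Phi \in unitmx.
Proof.
move=> hgen; rewrite unitmxE unitfE; apply/det0P => -[v v0 vB].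
case/eqP: v0; apply/rowP => l; rewrite [RHS]mxE.
have [a [b [ta tb E]]] := hgen _ (graph0 hhom homega1)
  (duo (fun=> 0) (fun m => (m == l)%:R)).
pose q m : C := (complex.Re (a (rshift n m)))%:C + ii * (complex.Re (b (rshift n m)))%:C.
have Bq m : (m == l)%:R = \sum_m' Bmx ii Phi m m' * q m'.
  have := E (rshift n m); rewrite duow => ->.
  rewrite (rtangent0_w ta) (rtangent0_w tb) -complexiE mulr_sumr -big_split.
  by apply: eq_bigr => m' _; rewrite /q /= mulrDr mulrCA.
have -> : v 0 l = \sum_m v 0 m * (m == l)%:R.
  rewrite (bigD1 l) //= eqxx mulr1 big1 ?addr0 // => m /negPf ->.
  by rewrite mulr0.
under eq_bigr => m _ do rewrite Bq mulr_sumr.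
rewrite exchange_big big1 // => m' _ /=.
under eq_bigr => m _ do rewrite mulrA.
have := congr1 (fun V : 'rV_k => V 0 m') vB; rewrite !mxE -mulr_suml => ->.
by rewrite mul0r.
Qed.

Hypothesis hreal : forall l, real_valued (Phi l).

Lemma holomorphically_nondegenerate_poly : holomorphically_nondegenerate Phi ->
  forall Q : 'I_(n + k) -> {mpoly C[n + k]},
  ptan ii Phi (iota ii Phi Q) (fun=> 0) -> forall j, Q j = 0.
Proof.
move=> hnd Q tQ j; suff E : vf_of Q = vf_of (fun=> 0).
  exact: (congr1 (fun P => P j) (vf_of_inj E)).
rewrite vf_of0; apply: (hnd _ (graph0 hhom homega1)).
  by move=> i; apply: ps_convergent_of.
exists 1 => // Z _ gZ; rewrite hvf_at_of.
have /(ptan_ctangent hreal)/(_ Z gZ) := tQ.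
under [X in ctangent _ _ X _]eq_fun => i do rewrite (meval_iota _ _ gZ).
by under [X in ctangent _ _ _ X]eq_fun => i do rewrite meval0.
Qed.

End Generic.

Theorem proposition3p5 (R : realType) (n k : nat) (hn : (0 < n)%N)
    (hk : (0 < k)%N) (omega : 'I_k -> nat)
    (homega1 : forall l, (1 < omega l)%N)
    (homega : forall l l' : 'I_k, (l <= l')%N -> (omega l <= omega l')%N)
    (Phi : 'I_k -> {mpoly R[i][n + n + k]})
    (hreal : forall l, real_valued (Phi l))
    (hhom : forall l, poly_weighted_homogeneous omega (omega l) (Phi l))
    (hgen : cr_generic Phi)
    (hfin : finite_type Phi)
    (hnd : holomorphically_nondegenerate Phi) :
  exists rho varrho : nat,
    tanaka_graded (@vf_bracket R (n + k)) (aut_CR Phi)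
      (aut_CR_weight omega Phi) rho varrho.
Proof.
have [r det] := finite_determination (@ccjK R) (@ccj_ii R)
  (cjPhi_real hreal) homega1 hhom (cr_generic_Bmx_unit hhom homega1 hgen)
  (holomorphically_nondegenerate_poly hhom homega1 hreal hnd)
  (finite_type_spans hhom homega1 hreal hfin).
have autP := aut_CRP hhom homega1 hreal det.
have coef_top := aut_CR_coef_top hhom homega1 hreal det.
have aut_comp := aut_CR_vcomp hhom homega1 hreal.
set g := aut_CR Phi in autP *; set g_ := aut_CR_weight omega Phi.
set w := @wt n k omega; set mu := maxw omega.
have wle j : (w j <= mu)%N by apply: wt_le_maxw.
have g0 : g 0.
  by apply/autP; exists (fun=> 0); split; [rewrite vf_of0|apply: ptan_iota0].
have glin (c : R) X Y : g X -> g Y -> g (c%:C *: X + Y).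
  move=> /autP[Q [-> tQ]] /autP[Q' [-> tQ']]; apply/autP.
  exists (fun j => c%:C *: Q j + Q' j); split; first by rewrite vf_ofZ vf_ofD.
  by apply: (ptan_iota_lin _ tQ tQ'); exact: conjc_real.
have gbr X Y : g X -> g Y -> g (vf_bracket X Y).
  move=> /autP[Q [-> tQ]] /autP[Q' [-> tQ']]; apply/autP.
  exists (vbr Q Q'); split; first by rewrite vf_bracket_of.
  exact: (ptan_iota_vbr (@iiN0 R) (@ccjK R) tQ tQ').
have gsum (I : Type) (s : seq I) (G : I -> vf R (n + k)) :
    (forall i, g (G i)) -> g (\sum_(i <- s) G i).
  move=> gG; apply: (big_ind g) => // X Y gX gY.
  by have := glin 1 X Y gX gY; rewrite scale1r.
have g_lin t : real_subspace (g_ t).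
  split; first by split=> // j a; rewrite eqxx.
  move=> c X Y [gX hX] [gY hY]; split; first exact: glin.
  move=> j a; have [Xja|/hX//] := eqVneq (X j a) 0.
  have [Yja|/hY//] := eqVneq (Y j a) 0.
  rewrite -[(_ + _) j a]/(c%:C *: X j a + Y j a) Xja Yja scaler0 addr0.
  by rewrite eqxx.
have lie : real_lie_algebra (@vf_bracket R (n + k)) g.
  split=> //.
  - move=> c X Y Z /autP[Q [-> _]] /autP[Q' [-> _]] /autP[S [-> _]].
    rewrite !(vf_ofZ, vf_ofD, vf_bracket_of); congr vf_of; apply/funext => j.
    rewrite /vbr vderDl vderZl linearD linearZ /= scalerBr opprD addrACA.
    by [].
  - move=> c X Y Z /autP[Q [-> _]] /autP[Q' [-> _]] /autP[S [-> _]].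
    rewrite !(vf_ofZ, vf_ofD, vf_bracket_of); congr vf_of; apply/funext => j.
    by rewrite /vbr vderDl vderZl linearD linearZ /= scalerBr opprD addrACA.
  - by move=> X _; apply/funext => j; apply: big1 => i _; rewrite subrr.
  - move=> X Y Z /autP[Q [-> _]] /autP[Q' [-> _]] /autP[S [-> _]].
    rewrite !(vf_ofD, vf_bracket_of) -(vf_of0 R (n + k)); congr vf_of.
    by apply/funext => j; apply: vbr_jacobi.
(* A monomial has weight at least [0] and a coordinate at most [mu], whence the lower bound;
   [coef_top] gives the upper one. *)
have g_vanish t : ~~ (- mu%:Z <= t <= (top omega r)%:Z) -> forall X, g_ t X -> X = 0.
  move=> ht X [gX hX]; apply/funext => j; apply/funext => a.
  apply/eqP/negPn/negP => Xja; have wj := wle j.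
  have E : (mon_weight w a)%:Z - (w j)%:Z = t := hX j a Xja.
  case/negP: ht; apply/andP; split; first by rewrite -E; lia.
  rewrite leNgt; apply/negP => lt; move/eqP: Xja; apply; apply: (coef_top _ _ _ gX).
  by rewrite -/w -/mu; lia.
pose comp (X : vf R (n + k)) (t : int) : vf R (n + k) := fun j a =>
  if (mon_weight w a)%:Z - (w j)%:Z == t then X j a else 0.
have g_comp X t : g X -> g_ t (comp X t).
  move=> gX; split; last first.
    by move=> j a; rewrite /comp; case: (_ =P t) => [//|_]; rewrite eqxx.
  (* The components [vcomp] are indexed by the natural number [t + mu]; below [- mu] there is
     nothing to represent. *)
  have [le|lt] := lerP 0 (t + mu%:Z); last first.
    rewrite (_ : comp X t = 0) //; apply/funext => j; apply/funext => a; rewrite /comp.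
    by case: eqP => // E; have := wle j; lia.
  rewrite (_ : comp X t = vf_of (vcomp w mu X (absz (t + mu%:Z)))).
    by apply/autP; exists (vcomp w mu X (absz (t + mu%:Z))); split=> //; apply: aut_comp.
  apply/funext => j; apply/funext => a; rewrite /vf_of /ps_of /comp.
  rewrite (mcoeff_vcomp (wt_gt0 homega1) (wt_le_maxw omega)) -/w -/mu.
  by congr (if _ then _ else _); apply/eqP/eqP; lia.
exists mu, (top omega r); split=> //.
- split=> // t ht; apply/seteqP; split=> X; first exact: (g_vanish t ht).
  by move=> ->; have [] := g_lin t.
- apply/seteqP; split=> X.
    move=> gX; exists (comp X); first by move=> t; apply: g_comp.
    apply/funext => j; apply/funext => a; rewrite /graded_sum !fct_sumE.
    have wj := wle j; pose s := absz ((mon_weight w a)%:Z - (w j)%:Z + mu%:Z).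
    have [lt|le] := ltnP s (mu + top omega r).+1.
      rewrite (bigD1 (Ordinal lt)) //= big1 ?addr0 => [|i ne].
        by rewrite /comp ifT //; apply/eqP; rewrite /s; lia.
      rewrite /comp ifF //; apply/negP => /eqP E; case/eqP: ne; apply/val_inj => /=.
      by rewrite /s; lia.
    have X0 : X j a = 0 by apply: (coef_top _ _ _ gX); rewrite -/w -/mu; move: le; rewrite /s; lia.
    by rewrite X0; apply: big1 => i _; rewrite /comp X0; case: ifP.
  by move=> [Y gY <-]; apply: gsum => i; have [] := gY (i%:Z - mu%:Z).
- move=> Y gY Y0 t; have [ht|/g_vanish h] := boolP (- mu%:Z <= t <= (top omega r)%:Z); last first.
    exact: h (gY t).
  (* A coordinate [j] and a monomial [a] determine the weight, so only one summand contributes to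
     this coefficient of the sum. *)
  apply/funext => j; apply/funext => a; apply/eqP/negPn/negP => ne.
  have E : (mon_weight w a)%:Z - (w j)%:Z = t := (gY t).2 j a ne.
  have := congr1 (fun X : vf R (n + k) => X j a) Y0.
  rewrite /graded_sum !fct_sumE.
  have lt : (absz (t + mu%:Z)%R < (mu + top omega r).+1)%N by lia.
  rewrite (bigD1 (Ordinal lt)) //= big1 ?addr0 => [|i ni].
    have -> : (absz (t + mu%:Z))%:Z - mu%:Z = t by lia.
    by move/eqP: ne.
  apply/eqP/negPn/negP => nz.
  have Et : (mon_weight w a)%:Z - (w j)%:Z = i%:Z - mu%:Z := (gY _).2 j a nz.
  by case/eqP: ni; apply/val_inj => /=; lia.
- by move=> s t X Y [gX hX] [gY hY]; split; [apply: gbr|apply: vf_bracket_weight].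
Qed.
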